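(* Let ${\boldsymbol{\nu}}$ be any $k$-tuple of skew shapes with $\mathrm{diam}({\boldsymbol{\nu}})\le 3$, and $n=|{\boldsymbol{\nu}}|$. Then \[G_{\boldsymbol{\nu}}(X;q)=\sum_{\lambda\vdash n}\;\sum_{{\bf T}\in{\bf T}({\boldsymbol{\nu}},\lambda)} q^{\mathrm{inv}_k({\bf T})}\,s_\lambda .\]
   Context: Diagrams are in French notation in $\mathbb Z^2$: a cell in column $j$ and row $i$ has content $c=j-i$. Let ${\boldsymbol{\nu}}=(\nu^{(0)},\dots,\nu^{(k-1)})$ be a $k$-tuple of skew shapes with $n$ cells in total. A standard filling ${\bf T}=(T^{(0)},\dots,T^{(k-1)})$ of ${\boldsymbol{\nu}}$ is a bijective assignment of $1,\dots,n$ to the cells such that each $T^{(i)}$ increases from left to right along rows and from bottom to top along columns; $\mathrm{SYT}({\boldsymbol{\nu}})$ is the set of these. The shifted content of a cell $x$ of $\nu^{(i)}$ is $\tilde c(x)=k\,c(x)+i$. The shifted content word of ${\bf T}$ lists its entries in order of increasing shifted content, cells of equal shifted content (which lie on one diagonal of one $\nu^{(i)}$) being read from southwest to northeast. $\sigma({\bf T})\in\{\pm1\}^{n-1}$ is the signature of this word $w$: $\sigma_i=+1$ if $i$ appears before $i+1$ in $w$, else $-1$. $\mathrm{inv}_k({\bf T})$ is the number of pairs of cells $(x,y)$ with $0<\tilde c(y)-\tilde c(x)<k$ and ${\bf T}(x)>{\bf T}(y)$. $\mathrm{diam}({\boldsymbol{\nu}})$ is the maximum size of a set $R$ of distinct shifted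 contents of cells of ${\boldsymbol{\nu}}$ with $|x-y|\le k$ for all $x,y\in R$. For $\sigma\in\{\pm1\}^{n-1}$, $F_\sigma(X)=\sum x_{i_1}\cdots x_{i_n}$ over $i_1\le\dots\le i_n$ with $i_j=i_{j+1}\Rightarrow\sigma_j=+1$. The LLT polynomial is $G_{\boldsymbol{\nu}}(X;q)=\sum_{{\bf T}\in\mathrm{SYT}({\boldsymbol{\nu}})}q^{\mathrm{inv}_k({\bf T})}F_{\sigma({\bf T})}(X)$. $s_\lambda$ is the Schur function. $P(w)$ is the Robinson–Schensted insertion tableau of $w\in S_n$; $U_\lambda$ is the standard tableau of shape $\lambda$ filled with $1,\dots,n$ row by row from the bottom row up, each row left to right; $\mathrm{SYam}(\lambda)=\{w\in S_n: P(w)=U_\lambda\}$. Finally ${\bf T}({\boldsymbol{\nu}},\lambda)=\{{\bf T}\in\mathrm{SYT}({\boldsymbol{\nu}}):\text{the shifted content word of }{\bf T}\text{ lies in }\mathrm{SYam}(\lambda)\}$. *)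

(* Defs.v *)
From HB Require Import structures.
From mathcomp Require Import all_boot all_order all_algebra.
From mathcomp Require Import finmap multiset.
From mathcomp Require Import functions.

Set Implicit Arguments.
Unset Strict Implicit.
Unset Printing Implicit Defensive.

Import Order.TTheory GRing.Theory Num.Theory.
Local Open Scope ring_scope.

(* A partition is the list of its (positive) parts, largest first. *)
Definition is_part (la : seq nat) : bool := sorted geq la && (0%N \notin la).

Definition partitions (n : nat) : seq (seq nat) :=
  [seq la <- [seq map val (tval t) | l <- iota 0 n.+1, t <- enum {: l.-tuple 'I_n.+1}]
     | is_part la & sumn la == n].

(* Up to a translation along the main diagonal, which changes no content,
   every placement of a skew diagram in Z^2 is of the form outer / inner. *)
Record skew_shape := SkewShape {
  outer : seq nat;
  inner : seq nat;
  outer_part : is_part outer;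
  inner_part : is_part inner;
  inner_sub_outer : forall r : nat, (nth 0 inner r <= nth 0 outer r)%N }.

(* A cell is a pair (row, column), both counted from 0; rows go upwards
   (French notation), row 0 being the longest one. *)
Definition diagram (la mu : seq nat) : seq (nat * nat) :=
  [seq (r, c) | r <- iota 0 (size la),
                c <- iota (nth 0 mu r) (nth 0 la r - nth 0 mu r)].

Definition content (x : nat * nat) : int := x.2%:Z - x.1%:Z.

(* The monomial x_{i_1} ... x_{i_n} is the multiset {i_1, ..., i_n}; a series
   is the function giving the coefficient of each monomial, and q is 'X. *)
Notation fpseries := ({mset nat}%mset -> {poly int}^o).

(* The sum of \prod_(a : I) x_{f a} over all f : I -> nat satisfying P.  If
   that product is the monomial m, then f takes its values in the support of m,
   so the coefficient of m counts finitely many functions. *)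
Definition gen_series (I : finType) (P : pred (I -> nat)) : fpseries :=
  fun m => #|[set f : {ffun I -> finsupp m} |
               P (fun a => val (f a))
               && (seq_mset [seq val (f a) | a : I] == m)]|%:R.

(* Signs are booleans, true standing for +1; sigma_j is nth true sigma j.-1. *)
Definition fund_quasisym (n : nat) (sigma : n.-1.-tuple bool) : fpseries :=
  gen_series (fun i : 'I_n -> nat =>
    [forall a : 'I_n, forall b : 'I_n, (val b == a.+1) ==>
       (i a <= i b)%N && ((i a == i b) ==> nth true sigma a)]).

Definition schur (la : seq nat) : fpseries :=
  gen_series (fun T : seq_sub (diagram la [::]) -> nat =>
    [forall x, forall y,
       (((val x).1 == (val y).1) && ((val x).2 < (val y).2)%N ==> (T x <= T y)%N)
    && (((val x).2 == (val y).2) && ((val x).1 < (val y).1)%N ==> (T x < T y)%N)]).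

Definition signature (n : nat) (w : seq nat) : n.-1.-tuple bool :=
  [tuple (index j.+1 w < index j.+2 w)%N | j < n.-1].

Fixpoint row_insert (x : nat) (r : seq nat) : seq nat * option nat :=
  if r is y :: r' then
    if (x < y)%N then (x :: r', Some y)
    else let: (r'', bumped) := row_insert x r' in (y :: r'', bumped)
  else ([:: x], None).

(* A tableau is the list of its rows, bottom row first. *)
Fixpoint tab_insert (x : nat) (t : seq (seq nat)) : seq (seq nat) :=
  if t is r :: t' then
    let: (r', bumped) := row_insert x r in
    if bumped is Some y then r' :: tab_insert y t' else r' :: t'
  else [:: [:: x]].

Definition RS_P (w : seq nat) : seq (seq nat) :=
  foldl (fun t x => tab_insert x t) [::] w.

Definition U_tab (la : seq nat) : seq (seq nat) :=
  reshape la (iota 1 (sumn la)).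

Definition SYam (la : seq nat) : pred (seq nat) :=
  fun w => perm_eq w (iota 1 (sumn la)) && (RS_P w == U_tab la).

Section Fillings.
Variables (k : nat) (nu : k.-tuple skew_shape).

Definition cells : seq ('I_k * (nat * nat)) :=
  [seq (i, x) | i <- enum 'I_k,
                x <- diagram (outer (tnth nu i)) (inner (tnth nu i))].

Definition cell : finType := seq_sub cells.

Definition ncells : nat := #|cell|.

Definition cell_comp (x : cell) : 'I_k := (val x).1.
Definition cell_row (x : cell) : nat := (val x).2.1.
Definition cell_col (x : cell) : nat := (val x).2.2.

Definition shifted_content (x : cell) : int :=
  k%:Z * content (val x).2 + (cell_comp x)%:Z.

Definition diam : nat :=
  let D := [fset shifted_content x | x in cell]%fset in
  \max_(R : {set D} | [forall x in R, forall y in R, `|val x - val y| <= k%:Z])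
     #|R|.

Definition filling := {ffun cell -> 'I_ncells}.

(* The entries are 1, ..., n. *)
Definition entry (T : filling) (x : cell) : nat := (T x).+1.

(* An injective filling is bijective, by cardinality. *)
Definition SYT (T : filling) : bool :=
  injectiveb T &&
  [forall x, forall y, (cell_comp x == cell_comp y) ==>
     (((cell_row x == cell_row y) && (cell_col x < cell_col y)%N ==>
         (entry T x < entry T y)%N)
   && ((cell_col x == cell_col y) && (cell_row x < cell_row y)%N ==>
         (entry T x < entry T y)%N))].

(* On a diagonal, from southwest to northeast means by increasing row. *)
Definition reading_le : rel cell := fun x y =>
  (shifted_content x < shifted_content y)
  || ((shifted_content x == shifted_content y) && (cell_row x <= cell_row y)%N).

Definition content_word (T : filling) : seq nat :=
  [seq entry T x | x <- sort reading_le (enum cell)].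

Definition inv_k (T : filling) : nat :=
  #|[set xy : cell * cell |
       (0 < shifted_content xy.2 - shifted_content xy.1 < k%:Z)
       && (entry T xy.2 < entry T xy.1)%N]|.

Definition LLT : fpseries :=
  \sum_(T : filling | SYT T)
     'X^(inv_k T) *: fund_quasisym (signature ncells (content_word T)).

Definition SYam_fillings (la : seq nat) : {set filling} :=
  [set T | SYT T && SYam la (content_word T)].

End Fillings.

Lemma mem_partitions (n : nat) (la : seq nat) :
  (la \in partitions n) = is_part la && (sumn la == n).
Proof.
rewrite mem_filter andb_idr // => /andP[/andP[_ pos] /eqP sum_la].
have le_sum s x : x \in s -> (x <= sumn s)%N.
  elim: s => //= y s IHs; rewrite inE => /predU1P[-> | /IHs le_x].
    exact: leq_addr.
  exact: leq_trans le_x (leq_addl _ _).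
have le_size : (size la <= n)%N.
  rewrite -sum_la {sum_la}; elim: la pos => //= y s IHs.
  rewrite inE negb_or eq_sym -lt0n => /andP[y_gt0 /IHs le_s].
  by rewrite -add1n leq_add.
apply/allpairsPdep; exists (size la).
exists (map_tuple (fun x => inord x) (in_tuple la)); split.
- by rewrite mem_iota ltnS.
- exact: mem_enum.
- rewrite /= -map_comp -[LHS]map_id; apply/eq_in_map => x /le_sum le_x /=.
  by rewrite inordK // ltnS -sum_la.
Qed.

Lemma partitions_uniq (n : nat) : uniq (partitions n).
Proof.
apply/filter_uniq/allpairs_uniq_dep => [|l _|].
- exact: iota_uniq.
- exact: enum_uniq.
- move=> [l t] [l' t'] _ _ /= eq_tt'.
  have := congr1 size eq_tt'; rewrite !size_map !size_tuple => eq_l.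
  case: l' / eq_l t' eq_tt' => t' eq_tt'.
  by congr existT; apply/val_inj/(inj_map val_inj).
Qed.

(* Main.v *)
Require Import Defs.
From mathcomp Require Import all_boot all_order all_algebra.
From mathcomp Require Import finmap multiset.
From mathcomp Require Import functions.
From mathcomp Require Import boolp fingroup perm zify.

Set Implicit Arguments.
Unset Strict Implicit.
Unset Printing Implicit Defensive.

Import Order.TTheory GRing.Theory Num.Theory.
Local Open Scope ring_scope.

(* Let [u_a] be the operator adding a cell of shifted content [a] (the [a]-th
   content in increasing order) to a set of cells, weighted by the inversions
   it creates.  Products of the [u_a] enumerate standard fillings, and the
   coefficient of a monomial in the LLT polynomial is a matrix entry of a
   product of noncommutative complete functions [h_i], the sums of increasing
   words of length [i].  The [u_a] satisfy enough relations for the [h_i] to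
   commute; when the diameter is at most 3, letters at least three ranks apart
   commute as well.  This suffices for Gasharov's sign-reversing exchange of row
   heads: the Jacobi-Trudi alternating sum of products of the [h_i] equals the
   sum over arrays with increasing rows and, right-justified, decreasing
   columns, and these arrays are the inverses of the standardized Yamanouchi
   words.  A symmetric function is determined by its Jacobi-Trudi sums, and the
   same argument for a single straight shape with [k = 1] identifies those of
   Schur functions. *)

(** * Noncommutative complete functions *)

(** Commuting [h_i] alone would not justify the exchange of heads: in the product the tail of the
    first row stands between the two heads, so one head has to be carried across it. This is where
    the number 3 comes from. At the first bad column, with letter [c] in the second row, the tail of
    the second row lies above [c], and the tail of the first row lies above that of the second
    column by column, hence at [c + 2] or higher, while the second head uses letters up to [c - 1].
    The exchange thus needs letters three ranks apart to commute. If the diameter is at most 3, four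
    distinct contents never fit in a window of length [k], and cells more than [k] apart can be
    added in either order with no inversion between them. The operators are matrices indexed by sets
    of cells, so all of this is computation in a ring, with the power of [q] carried by the entries.
    Both sides are compared at exponent vectors of one length [l], at least the number of cells and
    large enough for the variables of the given monomial. *)

Lemma sorted_geq_nth (s : seq nat) (i j : nat) :
  sorted geq s -> (i <= j)%N -> (nth 0 s j <= nth 0 s i)%N.
Proof.
move=> srt le_ij; have [lt_j|le_j] := ltnP j (size s); last by rewrite nth_default.
have geq_tr : transitive geq by move=> ? ? ? /= h1 h2; apply: leq_trans h1.
by apply: (sorted_leq_nth geq_tr leqnn 0%N srt i j _ lt_j le_ij); rewrite inE (leq_ltn_trans le_ij).
Qed.

Lemma sumn_takeS (la : seq nat) (r : nat) :
  sumn (take r.+1 la) = (sumn (take r la) + nth 0 la r)%N.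
Proof.
have [lt_r|le_r] := ltnP r (size la).
  by rewrite (take_nth 0%N lt_r) -cats1 sumn_cat /= addn0.
by rewrite nth_default // addn0 !take_oversize // leqW.
Qed.

Lemma sumn_take_le (la : seq nat) (r : nat) : (sumn (take r la) <= sumn la)%N.
Proof. by rewrite -[X in (_ <= sumn X)%N](cat_take_drop r la) sumn_cat leq_addr. Qed.

Section Commutation.

Variables (R : pzRingType) (u : nat -> R).

(** The third relation only asks the commutator of the outer letters to commute with the middle one.
    It covers outer letters that commute, and a middle letter that commutes with the outer ones up
    to opposite powers of [q]. *)
Definition switch_ideal : Prop :=
  [/\ forall a, u a * u a = 0,
      forall a b, a != b -> u a * u b * u a = 0 &
      forall a b c, (a < b < c)%N -> GRing.comm (u b) (u c * u a - u a * u c)].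

(** The generating function of the [h_i] when [l] is increasing. The parameter [s] is a ring element
    and not a formal variable, so that induction on the alphabet stays in one ring. *)
Definition incr_gen (s : R) (l : seq nat) : R := \prod_(a <- l) (1 + s * u a).

Hypothesis uP : switch_ideal.

(** As [u a] squares to zero and [s] is central, [1 - s * u a] inverts the factor [1 + s * u a]. *)
Lemma incr_gen_inv (s : R) (l : seq nat) : (forall x, GRing.comm s x) ->
  exists2 N, incr_gen s l * N = 1 & N * incr_gen s l = 1.
Proof.
case: uP => u2 _ _ sC; elim: l => [|a l [N EN NE]].
  by exists 1; rewrite /incr_gen big_nil mul1r.
have sa2 : s * u a * (s * u a) = 0 by rewrite -mulrA [u a * _]mulrA -sC mulrA -mulrA -mulrA u2
    !mulr0.
have inv1 : (1 + s * u a) * (1 - s * u a) = 1.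
  by rewrite mulrDl mul1r mulrBr mulr1 sa2 subr0 subrK.
have inv2 : (1 - s * u a) * (1 + s * u a) = 1.
  by rewrite mulrBl mul1r mulrDr mulr1 sa2 addr0 addrK.
exists (N * (1 - s * u a)); rewrite /incr_gen big_cons -/(incr_gen s l).
  by rewrite mulrA -[_ * _ * N]mulrA EN mulr1.
by rewrite mulrA -[_ * _ * (1 + _)]mulrA inv2 mulr1.
Qed.

(* With [E = (1 + s a) M (1 + s z)], exchanging the two middle factors of
   [E(s) E(t)] leaves [s t [z, a]], which absorbs [1 + s a] and [1 + t z] and
   commutes with [M].  The main term is symmetric in [s] and [t] by induction
   on the alphabet, because [M] is invertible. *)
Lemma incr_gen_comm (s t : R) (l : seq nat) :
  (forall x, GRing.comm s x) -> (forall x, GRing.comm t x) -> pairwise ltn l ->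
  incr_gen s l * incr_gen t l = incr_gen t l * incr_gen s l.
Proof.
case: (uP) => u2 u3 uC sC tC.
have [n] := ubnP (size l); elim: n l => // n IHn [|a l] /=.
  by move=> _ _; rewrite /incr_gen !big_nil.
rewrite ltnS; case/lastP: l => [_ _|m z lt_n].
  rewrite /incr_gen !big_seq1.
  have : GRing.comm (1 + s * u a) (1 + t * u a); last by [].
  have C2 : GRing.comm (1 + s * u a) (u a).
    apply: commr_sym; apply: commrD; first exact: commr1.
    by apply: commrM => //; apply: commr_sym; apply: sC.
  apply: commrD; first exact: commr1.
  by apply: commrM => //; apply: commr_sym; apply: tC.
rewrite pairwise_rcons all_rcons => /andP[/andP[az /allP m_gt_a]].
move=> /andP[/allP m_lt_z srtm].
have lt_n1 : ((size m).+1 < n)%N by move: lt_n; rewrite size_rcons.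
have le_n := ltnW lt_n1.
pose k := u z * u a - u a * u z.
have genE r : incr_gen r (a :: rcons m z) = (1 + r * u a) * incr_gen r m * (1 + r * u z).
  by rewrite /incr_gen big_cons -cats1 big_cat big_seq1 mulrA.
pose L r := (1 + r * u a) * incr_gen r m.
pose Q r := incr_gen r m * (1 + r * u z).
have LC : L s * L t = L t * L s.
  have := IHn (a :: m) lt_n1; rewrite /incr_gen !big_cons; apply.
  by rewrite /= srtm andbT; apply/allP.
have QC : Q s * Q t = Q t * Q s.
  have := IHn (rcons m z); rewrite size_rcons => /(_ lt_n1); rewrite -cats1 /incr_gen !big_cat
      !big_seq1.
  by apply=> //; rewrite cats1 pairwise_rcons srtm andbT; apply/allP.
have MC := IHn m le_n srtm.
have [Ns MNs NMs] := incr_gen_inv m sC.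
have [Nt MNt NMt] := incr_gen_inv m tC.
have NC : Nt * Ns = Ns * Nt.
  have e1 : (Nt * Ns) * (incr_gen s m * incr_gen t m) = 1.
    by rewrite mulrA -[Nt * Ns * _]mulrA NMs mulr1.
  have e2 : (incr_gen s m * incr_gen t m) * (Ns * Nt) = 1.
    by rewrite MC mulrA -[_ * Ns]mulrA MNs mulr1.
  by rewrite -[LHS]mulr1 -e2 mulrA e1 mul1r.
have kC r : (forall x, GRing.comm r x) -> GRing.comm k (incr_gen r m).
  move=> rC; rewrite /incr_gen big_seq; apply: commr_prod => b b_m.
  apply: commrD; first exact: commr1.
  apply: commrM; first by apply: commr_sym; apply: rC.
  by apply: commr_sym; apply: uC; apply/andP; split; [exact: m_gt_a|exact: m_lt_z].
have ak : u a * k = 0.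
  by rewrite /k mulrBr !mulrA u2 mul0r subr0 u3 // ltn_eqF.
have kz : k * u z = 0.
  by rewrite /k mulrBl -!mulrA u2 mulr0 subr0 mulrA u3 // gtn_eqF.
have swapped r r' : (forall x, GRing.comm r x) -> (forall x, GRing.comm r' x) ->
    (1 + r * u z) * (1 + r' * u a) = (1 + r' * u a) * (1 + r * u z) + r * r' * k.
  move=> rC r'C.
  have e1 : r * u z * (r' * u a) = r * r' * (u z * u a).
    by rewrite -!mulrA; congr (_ * _); rewrite !mulrA r'C.
  have e2 : r' * u a * (r * u z) = r * r' * (u a * u z).
    by rewrite (rC r') -!mulrA; congr (_ * _); rewrite !mulrA rC.
  have -> : r * r' * k = r * u z * (r' * u a) - r' * u a * (r * u z).
    by rewrite e1 e2 -mulrBr.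
  rewrite !(mulrDl, mulrDr) !mul1r !mulr1 !addrA.
  by rewrite [X in _ = X - _]addrAC addrK [X in X + _]addrAC.
have main r r' Nr Nr' : (forall x, GRing.comm r x) -> (forall x, GRing.comm r' x) ->
    incr_gen r m * Nr = 1 -> Nr * incr_gen r m = 1 ->
    incr_gen r' m * Nr' = 1 -> Nr' * incr_gen r' m = 1 ->
    incr_gen r (a :: rcons m z) * incr_gen r' (a :: rcons m z) =
    L r * L r' * (Nr' * Nr) * (Q r * Q r')
      + r * r' * (incr_gen r m * incr_gen r' m * k).
  move=> rC r'C MN NM MN' NM'.
  have -> : L r * L r' * (Nr' * Nr) * (Q r * Q r')
     = (1 + r * u a) * incr_gen r m * ((1 + r' * u a) * (1 + r * u z))
        * (incr_gen r' m * (1 + r' * u z)).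
    have -> : L r' = (1 + r' * u a) * incr_gen r' m by [].
    have -> : Q r = incr_gen r m * (1 + r * u z) by [].
    rewrite -/(L r) -/(Q r') !mulrA -(mulrA _ _ Nr') MN' mulr1.
    by rewrite -(mulrA _ Nr) NM mulr1.
  have rr'C x : GRing.comm (r * r') x.
    by apply: commr_sym; apply: commrM; apply: commr_sym.
  have k1 : (1 + r * u a) * k = k by rewrite mulrDl mul1r -mulrA ak mulr0 addr0.
  have k2 : k * (1 + r' * u z) = k.
    by rewrite mulrDr mulr1 mulrA -(r'C k) -mulrA kz mulr0 addr0.
  have kM : k * (incr_gen r m * incr_gen r' m) = incr_gen r m * incr_gen r' m * k.
    by apply: commrM; apply: kC.
  have e1 X Y : X * (r * r' * k) * Y = r * r' * (X * k * Y).
    by rewrite mulrA -(rr'C X) -!mulrA.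
  have e2 X Y : X * incr_gen r m * k * (incr_gen r' m * Y) = X * (k * (incr_gen r m * incr_gen r'
      m)) * Y.
    by rewrite -!mulrA; congr (_ * _); rewrite !mulrA (kC r rC).
  have <- : (1 + r * u a) * incr_gen r m * (r * r' * k) * (incr_gen r' m * (1 + r' * u z))
      = r * r' * (incr_gen r m * incr_gen r' m * k).
    by rewrite e1 e2 [_ * (k * _)]mulrA k1 kM -(mulrA _ k) k2.
  by rewrite !genE -mulrDl -mulrDr -swapped // !mulrA.
rewrite (main s t Ns Nt) // (main t s Nt Ns) //.
by rewrite LC QC NC MC (sC t).
Qed.

End Commutation.

(** Increasing words read from the right, largest letter first: position [p] of the list is column
    [p] of a right-justified row, and the tail of the row is a prefix of the list. *)
Fixpoint decs (b : nat) : seq (seq nat) :=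
  if b is b'.+1 then decs b' ++ [seq b' :: w | w <- decs b'] else [:: [::]].

Lemma mem_decs (b : nat) (w : seq nat) :
  (w \in decs b) = pairwise gtn w && all (gtn b) w.
Proof.
elim: b w => [|b IHb] w /=; first by case: w => [|a w] //=; rewrite andbF.
rewrite mem_cat IHb; apply/idP/idP => [/orP[/andP[-> /allP lt_b]|]|].
- by apply/allP => a /lt_b /= /leqW.
- move=> /mapP[v]; rewrite IHb => /andP[dec_v lt_v] -> /=.
  by rewrite lt_v dec_v ltnSn; apply/allP => a /(allP lt_v) /= /leqW.
- case: w => [|a w] //=; rewrite -!andbA => /and4P[gt_a dec_w].
  rewrite ltnS leq_eqVlt => /predU1P[eq_ab _|lt_ab _]; last first.
    rewrite gt_a dec_w lt_ab; apply/orP; left; apply/allP => d /(allP gt_a) /= lt_da.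
    exact: ltn_trans lt_ab.
  by subst a; rewrite gt_a dec_w ltnn /= (map_f (cons b)) // IHb dec_w.
Qed.

Lemma decs_uniq (b : nat) : uniq (decs b).
Proof.
elim: b => //= b IHb; rewrite cat_uniq IHb map_inj_uniq ?IHb ?andbT; last first.
  by move=> v w [].
apply/hasPn => _ /mapP[v _ ->] /=; apply/negP.
by rewrite mem_decs /= ltnn andbF.
Qed.

Lemma size_decs (b : nat) (w : seq nat) : w \in decs b -> (size w <= b)%N.
Proof.
elim: b w => [|b IHb] w /=; first by rewrite inE => /eqP ->.
rewrite mem_cat => /orP[/IHb /leqW //|/mapP[v /IHb le_v ->]].
by rewrite /= ltnS.
Qed.

Section Complete.

Variables (R : pzRingType) (u : nat -> R).

(* Words are stored from right to left. *)
Definition revprod (w : seq nat) : R := \prod_(a <- rev w) u a.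

Definition hsym (n b : nat) : R := \sum_(w <- decs b | size w == n) revprod w.

Lemma revprod_nil : revprod [::] = 1.
Proof. by rewrite /revprod big_nil. Qed.

Lemma revprod_cons (a : nat) (w : seq nat) : revprod (a :: w) = revprod w * u a.
Proof. by rewrite /revprod rev_cons -cats1 big_cat big_seq1. Qed.

Lemma revprod_cat (v w : seq nat) : revprod (v ++ w) = revprod w * revprod v.
Proof. by rewrite /revprod rev_cat big_cat. Qed.

Lemma hsym0 (b : nat) : hsym 0 b = 1.
Proof.
elim: b => [|b IHb]; first by rewrite /hsym big_cons big_nil /= revprod_nil addr0.
by rewrite /hsym big_cat big_map /= big_pred0_eq addr0.
Qed.

Lemma hsymS (n b : nat) : hsym n.+1 b.+1 = hsym n.+1 b + hsym n b * u b.
Proof.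
rewrite /hsym /= big_cat big_map /= mulr_suml; congr (_ + _).
by apply: eq_bigr => w _; rewrite revprod_cons.
Qed.

Lemma incr_gen_decs (s : R) (b : nat) : (forall x, GRing.comm s x) ->
  incr_gen u s (iota 0 b) = \sum_(w <- decs b) revprod w * s ^+ size w.
Proof.
move=> sC; elim: b => [|b IHb].
  by rewrite /incr_gen !big_cons !big_nil /= revprod_nil mulr1 addr0.
rewrite -[in iota 0 _]addn1 iotaD /incr_gen big_cat big_seq1 -/(incr_gen _ _ _) IHb /=.
rewrite mulrDr mulr1 big_cat big_map /= mulr_suml; congr (_ + _).
apply: eq_bigr => w _; rewrite revprod_cons add0n -!mulrA; congr (_ * _).
by rewrite mulrA -exprSr; apply: commr_sym; apply: commrX; apply: commr_sym.
Qed.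

End Complete.

(** The parameters of the two generating functions become the outer and the inner variable of
    [{poly {poly R}}], both central although [R] is not commutative; then coefficients are
    compared. *)
Lemma hsym_comm (R : nzRingType) (u : nat -> R) (i j b : nat) : switch_ideal u ->
  GRing.comm (hsym u i b) (hsym u j b).
Proof.
move=> [u2 u3 uC]; pose v a : {poly {poly R}} := (u a)%:P%:P.
have vP : switch_ideal v.
  split=> [a|a c ac|a c d acd]; rewrite /v -!polyCM.
  - by rewrite u2 !polyC0.
  - by rewrite u3 ?polyC0.
  - by rewrite -!polyCB /GRing.comm -!polyCM uC.
have sC (x : {poly {poly R}}) : GRing.comm 'X x.
  by apply: commr_sym; apply: commr_polyX.
have tC (x : {poly {poly R}}) : GRing.comm ('X%:P : {poly {poly R}}) x.
  by apply/polyP => n; rewrite coefCM coefMC -commr_polyX.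
have revP w : revprod v w = (revprod u w)%:P%:P.
  by rewrite /revprod -!rmorph_prod.
have := incr_gen_comm vP sC tC (l := iota 0 b).
rewrite -(sorted_pairwise ltn_trans) iota_ltn_sorted => /(_ isT).
rewrite !incr_gen_decs // => /(congr1 (fun p : {poly {poly R}} => p`_i`_j)).
have E1 : \sum_(w <- decs b) revprod v w * 'X%:P ^+ size w =
    (\sum_(w <- decs b) (revprod u w)%:P * 'X^(size w) : {poly R})%:P.
  by rewrite rmorph_sum; apply: eq_bigr => w _; rewrite revP rmorphM rmorphXn.
have E2 : (\sum_(w <- decs b) revprod v w * 'X ^+ size w)`_i = (hsym u i b)%:P.
  rewrite coef_sum /hsym rmorph_sum [RHS]big_mkcond; apply: eq_bigr => w _.
  by rewrite revP coefCM coefXn eq_sym; case: eqP; rewrite ?mulr1 ?mulr0.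
have E3 : (\sum_(w <- decs b) (revprod u w)%:P * 'X^(size w) : {poly R})`_j = hsym u j b.
  rewrite coef_sum /hsym [RHS]big_mkcond; apply: eq_bigr => w _.
  by rewrite coefCM coefXn eq_sym; case: eqP; rewrite ?mulr1 ?mulr0.
by rewrite E1 coefMC coefCM E2 coefCM coefMC E3.
Qed.

(** * The sieve on right-justified arrays *)

Section BadPairs.

Variables (R : nzRingType) (u : nat -> R).
Hypothesis uP : switch_ideal u.
Hypothesis u_far : forall a d, (a + 3 <= d)%N -> GRing.comm (u a) (u d).

Lemma comm_revprod (a : nat) (X : seq nat) :
  all (leq (a + 3)) X -> GRing.comm (u a) (revprod u X).
Proof.
move=> /allP far; rewrite /revprod big_seq; apply: commr_prod => x.
by rewrite mem_rev => /far; apply: u_far.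
Qed.

(** The head has letters up to [c - 1] and [X] has letters from [c + 2] on: exactly the three ranks
    of [u_far]. *)
Lemma hsym_comm_revprod (b c : nat) (X : seq nat) : all (ltn c.+1) X ->
  GRing.comm (hsym u b c) (revprod u X).
Proof.
move=> /allP gtX; apply: commr_sym; rewrite /hsym big_seq_cond.
apply: commr_sum => w /andP[]; rewrite mem_decs => /andP[_ /allP lt_c] _.
rewrite {2}/revprod big_seq; apply: commr_prod => a; rewrite mem_rev => /lt_c /= lt_ac.
apply: commr_sym; apply: comm_revprod; apply/allP => x /gtX /=; lia.
Qed.

(** Only the smallest letter [x] of [X] may be too close to [c] to commute with it. It is the first
    factor, so the right-hand [u c] moves left as far as [x], and [u c * u x * u c] vanishes. *)
Lemma revprod_between (c : nat) (X : seq nat) :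
  pairwise gtn X -> all (ltn c.+1) X -> u c * revprod u X * u c = 0.
Proof.
case: uP => u2 u3 _; case/lastP: X => [|X x].
  by rewrite revprod_nil mulr1.
rewrite pairwise_rcons all_rcons => /andP[/allP gtX _] /andP[/= lt_x _].
rewrite -cats1 revprod_cat revprod_cons revprod_nil mul1r -!mulrA -comm_revprod.
  by rewrite !mulrA u3 ?mul0r // neq_ltn (ltnW lt_x).
by apply/allP => y /gtX /=; lia.
Qed.

(** Besides crossing [X], the head gets its alphabet enlarged from [c] to [c.+1]: the extra words
    end in [u c] and are killed by [revprod_between]. Both heads then have the same alphabet, so
    their complete functions commute. *)
Lemma hsym_slide (b c : nat) (X : seq nat) :
  pairwise gtn X -> all (ltn c.+1) X ->
  revprod u X * hsym u b c * u c = hsym u b c.+1 * revprod u X * u c.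
Proof.
move=> decX gtX; rewrite -hsym_comm_revprod //.
case: b => [|b]; first by rewrite !hsym0.
by rewrite hsymS !mulrDl -(mulrA _ (u c)) -(mulrA _ (_ * _)) revprod_between // mulr0 addr0.
Qed.

End BadPairs.

(** The vanishing of the diagonal is a separate hypothesis because [V] may have 2-torsion. *)
Lemma antisym_double_sum (V : zmodType) (N : nat) (t : nat -> nat -> V) :
  (forall a, t a a = 0) -> (forall a b, t a b = - t b a) ->
  \sum_(a < N) \sum_(b < N) t a b = 0.
Proof.
move=> t0 tN; elim: N => [|N IHN]; first by rewrite big_ord0.
rewrite big_ord_recr /= big_ord_recr /= t0 addr0.
under eq_bigr => a _ do rewrite big_ord_recr /=.
rewrite big_split /= IHN add0r -big_split /= big1 // => a _.
by rewrite tN addNr.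
Qed.

Section Sieve.

Variables (R : nzRingType) (u : nat -> R) (m : nat).

Fixpoint rows (l : nat) : seq (seq (seq nat)) :=
  if l is l'.+1 then [seq x :: rs | x <- decs m, rs <- rows l'] else [:: [::]].

Definition rows_prod (rs : seq (seq nat)) : R := \prod_(x <- rs) revprod u x.

Lemma big_rowsS (V : nmodType) (l : nat) (F : seq (seq nat) -> V) :
  \sum_(rs <- rows l.+1) F rs = \sum_(x <- decs m) \sum_(rs <- rows l) F (x :: rs).
Proof. by rewrite /= big_allpairs_dep. Qed.

Lemma big_rows_cat (V : nmodType) (i j : nat) (F : seq (seq nat) -> V) :
  \sum_(rs <- rows (i + j)) F rs = \sum_(r <- rows i) \sum_(s <- rows j) F (r ++ s).
Proof.
elim: i F => [|i IHi] F; first by rewrite big_seq1.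
by rewrite addSn !big_rowsS; apply: eq_bigr => x _; rewrite IHi.
Qed.

Lemma mem_rows (l : nat) (rs : seq (seq nat)) :
  (rs \in rows l) = (size rs == l) && all (mem (decs m)) rs.
Proof.
elim: l rs => [|l IHl] [|x rs] //=.
  by apply/allpairsP => [[p []]].
rewrite eqSS andbCA -IHl; apply/allpairsP/andP => [[[y s] /= [? ? [-> ->]]] // | [? ?]].
by exists (x, rs).
Qed.

Lemma rows_uniq (l : nat) : uniq (rows l).
Proof.
elim: l => //= l IHl; apply: allpairs_uniq => //; first exact: decs_uniq.
by move=> [? ?] [? ?] _ _ /= [-> ->].
Qed.

(* Column [p] is counted from the right: rows are right-justified. *)
Definition col_ok (p : nat) (x y : seq nat) : bool :=
  (p < size y)%N ==> (p < size x)%N && (nth 0 y p < nth 0 x p)%N.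

Definition pair_ok (p i : nat) (rs : seq (seq nat)) : bool :=
  col_ok p (nth [::] rs i) (nth [::] rs i.+1).

Definition cols_ok (p : nat) (rs : seq (seq nat)) : bool :=
  all (fun q => all (fun i => pair_ok q i rs) (iota 0 (size rs).-1)) (iota 0 p).

Definition good (rs : seq (seq nat)) : bool := cols_ok m rs.

(** If [checked p i.+1] holds and [pair_ok p i] fails, the bad pair lies in the first bad column
    from the right and is the last bad one in that column. *)
Definition checked (p i : nat) (rs : seq (seq nat)) : bool :=
  cols_ok p rs && all (fun j => pair_ok p j rs) (iota i ((size rs).-1 - i)).

Lemma col_ok_take (p : nat) (x x' y y' : seq nat) :
  take p.+1 x = take p.+1 x' -> take p.+1 y = take p.+1 y' ->
  col_ok p x y = col_ok p x' y'.
Proof.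
move=> ex ey.
have sizeE (z z' : seq nat) : take p.+1 z = take p.+1 z' -> (p < size z)%N = (p < size z')%N.
  by move=> /(congr1 size); rewrite !size_take_min; lia.
by rewrite /col_ok (sizeE _ _ ex) (sizeE _ _ ey) -(nth_take _ (ltnSn p)) ey
  -[nth 0 x p](nth_take _ (ltnSn p)) ex !(nth_take _ (ltnSn p)).
Qed.

(** Row [x] is tested in columns below [p] only, and row [y] in columns up to [p]. The test
    therefore does not see the heads to be exchanged, which is the reason for choosing the last bad
    pair of the column. *)
Lemma checked_heads (p : nat) (pre post : seq (seq nat)) (x x' y y' : seq nat) :
  take p x = take p x' -> take p.+1 y = take p.+1 y' ->
  checked p (size pre).+1 (pre ++ x :: y :: post) =
  checked p (size pre).+1 (pre ++ x' :: y' :: post).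
Proof.
move=> ex ey.
have take_le q (z z' : seq nat) n : (q <= n)%N -> take n z = take n z' -> take q z = take q z'.
  by move=> le_qn ez; rewrite -(take_takel z le_qn) ez take_takel.
pose s := pre ++ x :: y :: post; pose s' := pre ++ x' :: y' :: post.
have nthE q j : (q < p)%N || (size pre < j)%N && (q <= p)%N ->
    take q.+1 (nth [::] s j) = take q.+1 (nth [::] s' j).
  rewrite /s /s' !nth_cat; have [//|lt_j|->] := ltngtP j (size pre); last first.
    by rewrite subnn orbF => lt_qp; apply: take_le ex.
  have -> : (j - size pre = (j - size pre).-1.+1)%N by lia.
  rewrite /=; case: (j - size pre).-1 => [|k] //= cond.
  by apply: take_le ey; lia.
have sizeE : size s' = size s by rewrite /s /s' !size_cat.
rewrite /checked /cols_ok -/s -/s' sizeE; congr (_ && _).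
  apply: eq_in_all => q; rewrite mem_iota => /andP[_ lt_qp].
  by apply: eq_all => j; apply: col_ok_take; apply: nthE; rewrite lt_qp.
apply: eq_in_all => j; rewrite mem_iota => /andP[lt_j _].
by apply: col_ok_take; apply: nthE; rewrite leqnn ?lt_j ?(leqW lt_j) // orbT.
Qed.

End Sieve.

Lemma big_decs_cat (V : nmodType) (m p : nat) (F : seq nat -> V) :
  \sum_(x <- decs m | (p <= size x)%N) F x =
  \sum_(X <- decs m | size X == p)
    \sum_(A <- decs m | pairwise gtn (X ++ A)) F (X ++ A).
Proof.
rewrite -big_filter -[RHS]big_filter.
under [RHS]eq_bigr => X _ do rewrite -big_filter.
rewrite -(big_allpairs_dep (h := fun X A => X ++ A)).
apply: perm_big; apply: uniq_perm; first exact/filter_uniq/decs_uniq.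
  apply: allpairs_uniq_dep => [|X _|]; try exact/filter_uniq/decs_uniq.
  move=> [X A] [X' A'] /allpairsPdep[X1 [A1 [X1_in _ /(congr1 tag) /= eX]]].
  move=> /allpairsPdep[X2 [A2 [X2_in _ /(congr1 tag) /= eX']]] /= /eqP.
  move: X1_in X2_in; rewrite -eX -eX' !mem_filter => /andP[/eqP sX _] /andP[/eqP sX' _].
  by rewrite eqseq_cat ?sX // => /andP[/eqP -> /eqP ->].
move=> x; rewrite mem_filter mem_decs; apply/idP/allpairsPdep.
  move=> /and3P[le_p dec_x lt_x]; exists (take p x), (drop p x).
  rewrite !mem_filter !mem_decs cat_take_drop size_takel // eqxx dec_x.
  move: dec_x lt_x; rewrite -{1 2}(cat_take_drop p x) pairwise_cat all_cat.
  by move=> /and3P[_ -> ->] /andP[-> ->].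
move=> [X [A []]]; rewrite !mem_filter !mem_decs.
move=> /and3P[/eqP sX dec_X ltX] /and3P[dec_XA _ ltA] ->.
by rewrite dec_XA all_cat ltX ltA size_cat sX leq_addr.
Qed.

Lemma big_decs_cons (V : nmodType) (m : nat) (F : seq nat -> V) :
  \sum_(x <- decs m | (0 < size x)%N) F x =
  \sum_(c <- iota 0 m) \sum_(B <- decs c) F (c :: B).
Proof.
elim: m => [|m IHm]; first by rewrite big_mkcond big_seq1 big_nil.
rewrite -[in iota 0 m.+1](addn1 m) iotaD big_cat /= big_cat IHm; congr (_ + _).
by rewrite big_seq1 add0n big_map.
Qed.

(** Cuts a row at its letter [c] in column [p]; once [c] is fixed, the head [B] is any word in the
    letters below [c]. *)
Lemma big_decs_split (V : nmodType) (m p : nat) (F : seq nat -> V) :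
  \sum_(y <- decs m | (p < size y)%N) F y =
  \sum_(Y <- decs m | size Y == p) \sum_(c <- iota 0 m | all (ltn c) Y)
    \sum_(B <- decs c) F (Y ++ c :: B).
Proof.
pose G y := if (p < size y)%N then F y else 0.
transitivity (\sum_(y <- decs m | (p <= size y)%N) G y).
  rewrite /G -big_mkcondr; apply: eq_bigl => y.
  by apply/idP/andP => [lt_p|[]//]; rewrite ltnW.
rewrite big_decs_cat big_seq_cond [RHS]big_seq_cond.
apply: eq_bigr => Y /andP[Y_decs /eqP sY].
transitivity (\sum_(A <- decs m | (0 < size A)%N)
    if pairwise gtn (Y ++ A) then F (Y ++ A) else 0).
  rewrite [LHS]big_mkcond [RHS]big_mkcond; apply: eq_bigr => A _.
  rewrite /G size_cat sY -{1}[p]addn0 ltn_add2l.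
  by case: (0 < _)%N; case: pairwise.
rewrite big_decs_cons [RHS]big_mkcond; apply: eq_bigr => c _.
have eqP B : B \in decs c -> pairwise gtn (Y ++ c :: B) = all (ltn c) Y.
  move: Y_decs; rewrite !mem_decs => /andP[dec_Y _] /andP[dec_B lt_B].
  rewrite pairwise_cat dec_Y /= dec_B lt_B /= !andbT allrel_consr.
  apply/andP/idP => [[]//|gtY]; split=> //.
  apply/allrelP => y b /(allP gtY) /= lt_cy /(allP lt_B) /= lt_bc.
  exact: ltn_trans lt_cy.
case: ifP => gtY; rewrite big_seq; last by rewrite big1 // => B /eqP ->; rewrite gtY.
by rewrite [RHS]big_seq; apply: eq_bigr => B /eqP ->; rewrite gtY.
Qed.

(** All letters of [X] exceed [c], so a head with letters at most [c] can be joined to [X] without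
    further condition. *)
Lemma big_decs_low (V : nmodType) (m c : nat) (X : seq nat) (F : seq nat -> V) :
  (c < m)%N -> pairwise gtn X -> all (ltn c) X ->
  \sum_(A <- decs m | pairwise gtn (X ++ A) && all (geq c) A) F A =
  \sum_(A <- decs c.+1) F A.
Proof.
move=> lt_cm dec_X gtX; rewrite -big_filter; apply: perm_big.
apply: uniq_perm; [exact/filter_uniq/decs_uniq|exact: decs_uniq|].
move=> A; rewrite mem_filter !mem_decs pairwise_cat dec_X /= -!andbA.
apply/and5P/andP => [[_ -> le_c _ _]|[dec_A le_c]]; first by split.
split=> //.
  by apply/allrelP => x a /(allP gtX) /= lt_cx /(allP le_c) /= le_ac; apply: leq_trans lt_cx.
by apply/allP => a /(allP le_c) /= le_ac; apply: leq_trans lt_cm.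
Qed.

Section Step.

Variables (R : nzRingType) (u : nat -> R) (m : nat).
Hypothesis uP : switch_ideal u.
Hypothesis u_far : forall a d, (a + 3 <= d)%N -> GRing.comm (u a) (u d).

(** Groups the heads by length. The bound [M] may exceed the lengths that occur, so that both heads
    can be summed over one index range. *)
Lemma big_decs_size (M b : nat) (P : R) (Z : nat -> R) : (b < M)%N ->
  \sum_(A <- decs b) P * revprod u A * Z (size A) =
  \sum_(a < M) P * hsym u a b * Z a.
Proof.
move=> lt_bM.
have E (a : 'I_M) : P * hsym u a b * Z a =
    \sum_(A <- decs b | size A == a) P * revprod u A * Z (size A).
  by rewrite /hsym mulr_sumr mulr_suml; apply: eq_bigr => A /eqP ->.
under [RHS]eq_bigr => a _ do rewrite E.
rewrite (exchange_big_dep predT) //= big_seq [RHS]big_seq; apply: eq_bigr => A A_b.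
have lt_A : (size A < M)%N by apply: leq_ltn_trans (size_decs A_b) lt_bM.
rewrite (big_pred1 (Ordinal lt_A)) //.
Qed.

Variables (l : nat) (D : seq nat -> int).
(** The exchange turns row lengths [p + a] and [p + b + 1] into [p + b] and [p + a + 1], the letter
    [c] of the bad column staying in the second row; hence the successor. *)
Hypothesis D_swap : forall pre post s t, (size pre + (size post).+2)%N = l ->
  D (pre ++ s :: t.+1 :: post) = - D (pre ++ t :: s.+1 :: post).

Let wt (rs : seq (seq nat)) : R := rows_prod u rs * (D (map size rs))%:~R.

(* The last [p] letters [X] of a row are above [c] and the last [p.+1] letters
   [c], [Y] of the next row, and the first bad column is that of [c].  Every
   letter of [X] is at least two ranks above [c], so [X] can be moved past the
   head [B]; the sum over the two heads is then symmetric in their sizes, while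
   [D] is antisymmetric. *)
Lemma sieve_heads (p c : nat) (pre post : seq (seq nat)) (X Y : seq nat) :
  (c < m)%N -> size X = p -> size Y = p -> pairwise gtn X -> all (ltn c.+1) X ->
  (size pre + (size post).+2)%N = l ->
  \sum_(A <- decs c.+1) \sum_(B <- decs c)
    wt (pre ++ (X ++ A) :: (Y ++ c :: B) :: post) = 0.
Proof.
move=> lt_cm sX sY dec_X gtX size_l.
pose DD a b := D (map size pre ++ (p + a)%N :: (p + b).+1 :: map size post).
pose Z a b := u c * revprod u Y * rows_prod u post * (DD a b)%:~R.
transitivity (\sum_(A <- decs c.+1) \sum_(B <- decs c)
    rows_prod u pre * revprod u A * revprod u X * revprod u B * Z (size A) (size B)).
  apply: eq_bigr => A _; apply: eq_bigr => B _.
  have -> : wt (pre ++ (X ++ A) :: (Y ++ c :: B) :: post) =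
      rows_prod u (pre ++ (X ++ A) :: (Y ++ c :: B) :: post) * (DD (size A) (size B))%:~R.
    by rewrite /wt /DD map_cat /= !size_cat /= sX sY addnS.
  rewrite /rows_prod big_cat !big_cons !revprod_cat revprod_cons /Z /=.
  by rewrite /rows_prod !mulrA.
pose t a b := rows_prod u pre * hsym u a c.+1 * revprod u X * hsym u b c * Z a b.
transitivity (\sum_(a < m.+2) \sum_(b < m.+2) t a b).
  pose Z' a := \sum_(b < m.+2) revprod u X * hsym u b c * Z a b.
  transitivity (\sum_(A <- decs c.+1) rows_prod u pre * revprod u A * Z' (size A)).
    apply: eq_bigr => A _; rewrite (big_decs_size _ (Z (size A)) (M := m.+2)).
      by rewrite mulr_sumr; apply: eq_bigr => b _; rewrite !mulrA.
    by rewrite ltnW // ltnW.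
  rewrite (big_decs_size _ Z' (M := m.+2)); last by rewrite ltnS ltnW.
  by apply: eq_bigr => a _; rewrite mulr_sumr; apply: eq_bigr => b _; rewrite /t !mulrA.
have tE a b : t a b = rows_prod u pre * (hsym u a c.+1 * hsym u b c.+1)
    * (revprod u X * (u c * (revprod u Y * (rows_prod u post)))) * (DD a b)%:~R.
  rewrite /t /Z !mulrA; congr (_ * _); rewrite -!mulrA; congr (_ * (_ * _)).
  by rewrite !mulrA hsym_slide.
have DN a b : DD a b = - DD b a.
  by rewrite /DD D_swap // !size_map.
apply: antisym_double_sum => [a|a b].
  have : DD a a = 0 by have := DN a a; lia.
  by rewrite tE => ->; rewrite mulr0.
by rewrite !tE DN hsym_comm // mulrNz mulrN.
Qed.

End Step.

Section SieveSum.

Variables (R : nzRingType) (u : nat -> R) (m : nat).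
Hypothesis uP : switch_ideal u.
Hypothesis u_far : forall a d, (a + 3 <= d)%N -> GRing.comm (u a) (u d).
Variables (l : nat) (D : seq nat -> int).
Hypothesis D_swap : forall pre post s t, (size pre + (size post).+2)%N = l ->
  D (pre ++ s :: t.+1 :: post) = - D (pre ++ t :: s.+1 :: post).

Let wt (rs : seq (seq nat)) : R := rows_prod u rs * (D (map size rs))%:~R.

Lemma checked_col_ok (p q : nat) (pre post : seq (seq nat)) (x y : seq nat) :
  (q < p)%N -> checked p (size pre).+1 (pre ++ x :: y :: post) -> col_ok q x y.
Proof.
move=> lt_qp /andP[/allP ok _].
have /allP ok_q := ok q ltac:(by rewrite mem_iota).
have := ok_q (size pre) ltac:(by rewrite mem_iota size_cat /=; lia).
by rewrite /pair_ok !nth_cat ltnn subnn ltnNge leqnSn subSn // subnn.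
Qed.

(** With all other rows frozen and the two rows cut at the bad column, the conditions leave the
    heads free over full alphabets, and [sieve_heads] applies. *)
Lemma sieve_pair (p : nat) (pre post : seq (seq nat)) :
  (size pre + (size post).+2)%N = l ->
  \sum_(x <- decs m) \sum_(y <- decs m |
      checked p (size pre).+1 (pre ++ x :: y :: post) && ~~ col_ok p x y)
    wt (pre ++ x :: y :: post) = 0.
Proof.
move=> size_l.
pose cond x y := checked p (size pre).+1 (pre ++ x :: y :: post) && ~~ col_ok p x y.
pose F x y := if cond x y then wt (pre ++ x :: y :: post) else 0.
(* The bad column is occupied in [y]; if [p] is positive, column [p.-1] is occupied in [y] and
   correct, hence occupied in [x]. *)
have condP x y : cond x y -> (p < size y)%N && (p <= size x)%N.
  case/andP => ok; rewrite /col_ok; case: ltnP => //= lt_y _.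
  have [-> //|p_gt0] := posnP p.
  have := checked_col_ok (q := p.-1) _ ok; rewrite /col_ok prednK // leqnn => /(_ isT).
  by rewrite ltnW // => /andP[].
transitivity (\sum_(y <- decs m | (p < size y)%N)
    \sum_(x <- decs m | (p <= size x)%N) F x y).
  under eq_bigr => x _ do rewrite big_mkcond.
  rewrite exchange_big [RHS]big_mkcond; apply: eq_bigr => y _.
  rewrite -/(F _ y); case: ifP => lt_y; last first.
    by apply: big1 => x _; rewrite -/(cond x y); case: ifP => // /condP; rewrite lt_y.
  rewrite [RHS]big_mkcond; apply: eq_bigr => x _.
  rewrite -/(cond x y) /F; case: (boolP (cond x y)) => [/condP/andP[_ ->]//|_].
  by case: ifP.
rewrite big_decs_split big1_seq // => Y /andP[/eqP sY]; rewrite mem_decs => /andP[dec_Y lt_Y].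
rewrite big1_seq // => c; rewrite mem_iota add0n => /andP[gtY lt_cm].
under eq_bigr => B _ do rewrite big_decs_cat.
rewrite exchange_big big1_seq // => X /andP[/eqP sX]; rewrite mem_decs => /andP[dec_X lt_X].
pose kappa := checked p (size pre).+1 (pre ++ X :: rcons Y c :: post).
(* Once the tails and [c] are fixed, badness of column [p] only says that the letters of [A] are at
   most [c]; [B] is unconstrained. *)
have condE A B : pairwise gtn (X ++ A) ->
    cond (X ++ A) (Y ++ c :: B) = kappa && all (geq c) A.
  move=> dec_XA; rewrite /cond.
  rewrite (@checked_heads _ _ _ _ X _ (rcons Y c)); last 2 first.
  - by rewrite -sX take_size_cat // take_size.
  - by rewrite -sY -cat_rcons -(size_rcons Y c) take_size_cat // take_size.
  rewrite -/kappa; congr (_ && _).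
  rewrite /col_ok !size_cat sX sY /= addnS ltnS leq_addr /= !nth_cat sX sY ltnn subnn /=.
  case: A dec_XA => [|a A]; first by rewrite addn0 ltnn.
  rewrite pairwise_cat /= addnS ltnS leq_addr /= -leqNgt => /and4P[_ _ gtA _].
  apply/idP/andP => [le_a|[]//]; split=> //; apply/allP => b /(allP gtA) /= lt_ba.
  exact: leq_trans (ltnW lt_ba) le_a.
have [kap|/negbTE kap] := boolP kappa; last first.
  by apply: big1 => B _; apply: big1 => A dec_XA; rewrite /F condE // kap.
(* Each letter of [X] exceeds the letter of [Y] in its column, which exceeds [c]: two strict
   steps. *)
have gtX : all (ltn c.+1) X.
  apply/(all_nthP 0) => q; rewrite sX => lt_q.
  have := checked_col_ok lt_q kap.
  rewrite /col_ok size_rcons sY ltnS ltnW //= nth_rcons sY lt_q => /andP[_].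
  by apply: leq_trans; rewrite ltnS; apply: (allP gtY); rewrite mem_nth ?sY.
transitivity (\sum_(B <- decs c) \sum_(A <- decs c.+1)
    wt (pre ++ (X ++ A) :: (Y ++ c :: B) :: post)).
  apply: eq_bigr => B _; rewrite -(@big_decs_low _ m c X) //; last first.
    by apply: sub_all gtX => x /= /ltnW.
  rewrite big_mkcondr; apply: eq_bigr => A dec_XA.
  by rewrite /F condE // kap.
by rewrite exchange_big (sieve_heads uP u_far D_swap lt_cm sX sY).
Qed.

Lemma sieve_step (p i : nat) : (i.+1 < l)%N ->
  \sum_(rs <- rows m l | checked p i.+1 rs && ~~ pair_ok p i rs) wt rs = 0.
Proof.
move=> lt_il; have {1}-> : l = (i + (l - i.+2).+2)%N by lia.
rewrite big_mkcond big_rows_cat big1_seq // => pre /andP[_].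
rewrite mem_rows => /andP[/eqP size_pre _].
rewrite big_rowsS.
under eq_bigr => x _ do rewrite big_rowsS exchange_big.
rewrite exchange_big big1_seq // => post /andP[_].
rewrite mem_rows => /andP[/eqP size_post _].
rewrite -[RHS](@sieve_pair p pre post); last by rewrite size_pre size_post; lia.
apply: eq_bigr => x _; rewrite [RHS]big_mkcond; apply: eq_bigr => y _.
by rewrite /pair_ok !nth_cat -size_pre ltnn subnn ltnNge leqnSn subSn // subnn.
Qed.

(** The conditions are imposed one pair at a time, column by column from the right and from the last
    pair of each column; the arrays lost at each stage cancel by [sieve_step]. *)
Lemma sieve : \sum_(rs <- rows m l) wt rs = \sum_(rs <- rows m l | good m rs) wt rs.
Proof.
have checked_sum p i : (i <= l.-1)%N ->
    \sum_(rs <- rows m l | checked p (l.-1 - i) rs) wt rs =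
    \sum_(rs <- rows m l | cols_ok p rs) wt rs.
  elim: i => [_|i IHi lt_il].
    rewrite big_seq_cond [RHS]big_seq_cond; apply: eq_bigl => rs.
    rewrite mem_rows; case: eqP => //= size_rs.
    by rewrite /checked size_rs subn0 subnn andbT.
  rewrite -IHi ?(ltnW lt_il) // [RHS](bigID (pair_ok p (l.-1 - i.+1))) /=.
  have -> : (l.-1 - i = (l.-1 - i.+1).+1)%N by lia.
  rewrite sieve_step; last by lia.
  rewrite addr0 big_seq_cond [RHS]big_seq_cond; apply: eq_bigl => rs.
  rewrite mem_rows; case: eqP => //= size_rs; congr (_ && _).
  rewrite /checked -andbA size_rs; congr (_ && _).
  have -> : (l.-1 - (l.-1 - i.+1) = (l.-1 - (l.-1 - i.+1).+1).+1)%N by lia.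
  by rewrite /= andbC.
have cols_sum p : \sum_(rs <- rows m l) wt rs = \sum_(rs <- rows m l | cols_ok p rs) wt rs.
  elim: p => [|p IHp]; first by apply: eq_bigl.
  rewrite IHp -(checked_sum _ _ (leqnn _)) subnn.
  rewrite big_seq_cond [RHS]big_seq_cond; apply: eq_bigl => rs.
  rewrite mem_rows; case: eqP => //= size_rs; congr (_ && _).
  by rewrite /checked /cols_ok -addn1 iotaD all_cat /= andbT subn0.
exact: cols_sum.
Qed.

End SieveSum.

(** * Jacobi-Trudi sums *)

Section JacobiTrudi.

Variable l : nat.

(** The matrix tests [ns_i - i = la_j - j], written without truncated subtraction. The determinant
    is the coefficient of the sequence [ns] in the expansion of [det (h_(la_j - j + i))]. *)
Definition jt_sign (la ns : seq nat) : int :=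
  \det (\matrix_(i < l, j < l) ((nth 0 ns i + j == nth 0 la j + i)%N%:R : int)).

(** Excludes negative indices, where complete functions are zero and the subtraction in [shift_part]
    would be truncated. *)
Definition shift_ok (la : seq nat) (s : {perm 'I_l}) : bool :=
  [forall i, (s i <= nth 0 la (s i) + i)%N].

Definition shift_part (la : seq nat) (s : {perm 'I_l}) : seq nat :=
  [seq (nth 0 la (s i) + i - s i)%N | i <- enum 'I_l].

Definition jt_sum (V : zmodType) (Psi : seq nat -> V) (la : seq nat) : V :=
  \sum_(s : {perm 'I_l} | shift_ok la s) Psi (shift_part la s) *~ (-1) ^+ s.

Lemma size_shift_part (la : seq nat) (s : {perm 'I_l}) : size (shift_part la s) = l.
Proof. by rewrite size_map size_enum_ord. Qed.

Lemma nth_shift_part (la : seq nat) (s : {perm 'I_l}) (i : 'I_l) :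
  nth 0%N (shift_part la s) i = (nth 0 la (s i) + i - s i)%N.
Proof. by rewrite (nth_map i) ?nth_ord_enum ?size_enum_ord. Qed.

Lemma shift_ok1 (la : seq nat) : shift_ok la 1%g.
Proof. by apply/forallP => i; rewrite perm1 leq_addl. Qed.

Lemma shift_part1 (la : seq nat) : size la = l -> shift_part la 1%g = la.
Proof.
move=> size_la; apply: (@eq_from_nth _ 0%N); rewrite size_shift_part ?size_la // => i lt_i.
by rewrite (nth_shift_part _ _ (Ordinal lt_i)) perm1 addnK.
Qed.

Lemma jt_signE (la ns : seq nat) : size ns = l ->
  jt_sign la ns =
  \sum_(s : {perm 'I_l} | shift_ok la s) (-1) ^+ s * (ns == shift_part la s)%:R.
Proof.
move=> size_ns; rewrite [RHS]big_mkcond; apply: eq_bigr => s _.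
have -> : \prod_i (\matrix_(i < l, j < l) ((nth 0 ns i + j == nth 0 la j + i)%N%:R : int)) i (s i)
    = [forall i : 'I_l, (nth 0 ns i + s i == nth 0 la (s i) + i)%N]%:R.
  have [/forallP all_eq|] := boolP [forall i : 'I_l, (nth 0 ns i + s i == nth 0 la (s i) + i)%N].
    by rewrite big1 // => i _; rewrite mxE (eqP (all_eq i)) eqxx.
  by rewrite negb_forall => /existsP[i /negbTE ne_i]; rewrite (bigD1 i) //= mxE ne_i mul0r.
have -> : [forall i : 'I_l, (nth 0 ns i + s i == nth 0 la (s i) + i)%N] =
    shift_ok la s && (ns == shift_part la s).
  apply/forallP/andP => [all_eq|[/forallP ok /eqP ->] i].
    split; first by apply/forallP => i; have := all_eq i; lia.
    apply/eqP; apply: (@eq_from_nth _ 0%N); rewrite size_ns ?size_shift_part // => i lt_i.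
    by rewrite (nth_shift_part la s (Ordinal lt_i)); have := all_eq (Ordinal lt_i); move=> /=; lia.
  by rewrite nth_shift_part; have := ok i; lia.
by case: shift_ok => //=; rewrite mulr0.
Qed.

(** The value [t] in row [i] and the value [t.+1] in row [i + 1] give the same matrix row, so the
    two matrices differ by a transposition of rows. *)
Lemma jt_sign_swap (la pre post : seq nat) (s t : nat) :
  (size pre + (size post).+2)%N = l ->
  jt_sign la (pre ++ s :: t.+1 :: post) = - jt_sign la (pre ++ t :: s.+1 :: post).
Proof.
move=> size_l.
have lt_i : (size pre < l)%N by lia.
have lt_j : ((size pre).+1 < l)%N by lia.
pose i := Ordinal lt_i; pose j := Ordinal lt_j.
have ne_ij : i != j by apply/eqP => /(congr1 val) /=; lia.
transitivity ((-1) ^+ (tperm i j) * jt_sign la (pre ++ t :: s.+1 :: post)); last first.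
  by rewrite odd_tperm ne_ij expr1 mulN1r.
rewrite -det_perm -det_mulmx; congr (\det _).
rewrite -/(tperm_mx i j) -xrowE; apply/matrixP => a b; rewrite !mxE !nth_cat.
case: tpermP => [->|->|ne_i ne_j] /=.
- rewrite ltnn subnn ltnNge leqnSn subSn // subnn /=; congr (nat_of_bool _)%:R.
  by rewrite addSn addnS eqSS.
- rewrite ltnn subnn ltnNge leqnSn subSn // subnn /=; congr (nat_of_bool _)%:R.
  by rewrite addSn addnS eqSS.
case: ltnP => // le_a; have ->: (a - size pre = (a - size pre).-2.+2)%N => //.
move/eqP: ne_i; move/eqP: ne_j; rewrite -!(inj_eq val_inj) /=; lia.
Qed.

Lemma perm_increasing (s : {perm 'I_l}) : {homo s : i j / (i < j)%N} -> s = 1%g.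
Proof.
have le_incr (t : {perm 'I_l}) : {homo t : i j / (i < j)%N} ->
      forall i : 'I_l, (i <= t i)%N.
  move=> incr_t [i lt_i] /=; elim: i lt_i => // i IHi lt_i.
  by apply: leq_ltn_trans (IHi (ltnW lt_i)) (incr_t _ _ _).
move=> incr_s; have incr_V : {homo s^-1%g : i j / (i < j)%N}.
  move=> i j lt_ij; rewrite ltnNge leq_eqVlt; apply/negP => /orP[/eqP e|lt_s].
    by have /perm_inj e' := val_inj e; rewrite e' ltnn in lt_ij.
  by have := incr_s _ _ lt_s; rewrite !permKV ltnNge ltnW.
apply/permP => i; rewrite perm1; apply/val_inj/eqP; rewrite eqn_leq le_incr // andbT.
by have := le_incr _ incr_V (s i); rewrite permK.
Qed.

(** Both [ns_i - i] and [la_j - j] are strictly decreasing, so a permutation matching them is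
    increasing, hence the identity. *)
Lemma jt_sign_part (la ns : seq nat) :
  size la = l -> size ns = l -> sorted geq la -> sorted geq ns ->
  jt_sign la ns = (ns == la)%:R.
Proof.
move=> size_la size_ns srt_la srt_ns; rewrite jt_signE // (bigD1 1%g) ?shift_ok1 //.
rewrite shift_part1 //= odd_perm1 mul1r big1 ?addr0 // => s /andP[/forallP ok ne_s].
case: eqP => [e|]; last by rewrite mulr0.
case/eqP: ne_s; apply: perm_increasing => i j lt_ij.
have := sorted_geq_nth srt_ns (ltnW lt_ij).
rewrite e !nth_shift_part; have := ok i; have := ok j; move=> okj oki le_ns.
rewrite ltn_neqAle; apply/andP; split.
  by apply/eqP => /val_inj /perm_inj e'; rewrite e' ltnn in lt_ij.
rewrite leqNgt; apply/negP => lt_s.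
by have := sorted_geq_nth srt_la (ltnW lt_s); lia.
Qed.

Section Uniqueness.

Variables (V : zmodType) (n : nat) (Psi : seq nat -> V).
Hypothesis Psi_perm : forall s t, perm_eq s t -> Psi s = Psi t.
Hypothesis Psi_deg : forall s, sumn s != n -> Psi s = 0.
Hypothesis Psi_jt : forall la, size la = l -> sorted geq la -> sumn la = n ->
  jt_sum Psi la = 0.

(* A base [n + 1] numeral, so that [digits] is increasing for the
   lexicographic order on sequences of the same length. *)
Let digits (s : seq nat) : nat := foldl (fun d x => d * n.+1 + x)%N 0%N s.

Let digits_acc_ub (d : nat) (s : seq nat) : all (geq n) s ->
  (foldl (fun d x => d * n.+1 + x)%N d s < d.+1 * n.+1 ^ size s)%N.
Proof.
elim: s d => [|x s IHs] d /=; first by rewrite expn0 muln1.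
case/andP=> le_x le_s; apply: leq_trans (IHs _ le_s) _.
rewrite expnS mulnA leq_mul2r; apply/orP; right; rewrite mulSn; lia.
Qed.

Let digits_lt (pre u v : seq nat) (a b : nat) :
  (a < b)%N -> size u = size v -> all (geq n) u ->
  (digits (pre ++ a :: u) < digits (pre ++ b :: v))%N.
Proof.
move=> lt_ab size_uv le_u; rewrite /digits !foldl_cat /=.
have lb d (s : seq nat) : (d * n.+1 ^ size s <= foldl (fun d x => d * n.+1 + x)%N d s)%N.
  elim: s d => [|x s IHs] d /=; first by rewrite expn0 muln1.
  by apply: leq_trans (IHs _); rewrite expnS mulnA leq_mul2r leq_addr orbT.
apply: leq_trans (digits_acc_ub _ le_u) _; apply: leq_trans (lb _ _).
by rewrite size_uv leq_mul2r ltn_add2l lt_ab orbT.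
Qed.

Let digits_ub (s : seq nat) : all (geq n) s -> (digits s < n.+1 ^ size s)%N.
Proof.
by move=> le_s; rewrite -[X in (_ < X)%N]mul1n; apply: digits_acc_ub.
Qed.

(* Take [al] lexicographically maximal with [Psi al != 0].  For [s != 1] let [j]
   be the first index moved by [s] and [i] its preimage; the shifted sequence
   agrees with [al] before [j] and contains [al_j + (i - j)], so it can be
   rearranged into a larger sequence than [al], where [Psi] is zero. *)
Lemma jt_unique (al : seq nat) : size al = l -> Psi al = 0.
Proof.
have sum_le s : sumn s = n -> all (geq n) s.
  move=> <-; apply/allP => x /=; elim: s => //= y s IHs.
  rewrite inE => /predU1P[-> | /IHs le_x]; first exact: leq_addr.
  exact: leq_trans le_x (leq_addl _ _).
have [k] := ubnP (n.+1 ^ l - digits al).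
elim: k al => // k IHk al lt_k size_al; apply/eqP/negPn/negP => ne0.
have sum_al : sumn al = n by apply/eqP/negPn/negP => /Psi_deg e; rewrite e eqxx in ne0.
have le_al := sum_le _ sum_al.
have larger be pre u v a b : al = pre ++ a :: u -> be = pre ++ b :: v -> (a < b)%N ->
    size be = l -> Psi be = 0.
  move=> e e' lt_ab size_be; have [sum_be|/Psi_deg //] := eqVneq (sumn be) n.
  apply: IHk => //; have := digits_ub (sum_le _ sum_be); rewrite size_be => ub.
  have : (digits al < digits be)%N.
    rewrite e e'; apply: digits_lt => //.
      by move: size_al size_be; rewrite e e' !size_cat /=; lia.
    by move: le_al; rewrite e all_cat /= => /and3P[].
  by move: lt_k; rewrite ltnS; lia.
have cat_nth (s : seq nat) i : (i < size s)%N -> s = take i s ++ nth 0%N s i :: drop i.+1 s.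
  by move=> lt_i; rewrite -drop_nth // cat_take_drop.
have srt_al : sorted geq al.
  apply/(sortedP 0%N) => i lt_i; rewrite /= leqNgt; apply/negP => lt_nth.
  case/eqP: ne0; pose be := take i al ++ nth 0%N al i.+1 :: nth 0%N al i :: drop i.+2 al.
  have e : al = take i al ++ nth 0%N al i :: nth 0%N al i.+1 :: drop i.+2 al.
    by rewrite -drop_nth // -drop_nth ?cat_take_drop // ltnW.
  have perm_be : perm_eq al be.
    by rewrite {1}e perm_cat2l; apply/permPl/(perm_catCA [:: _] [:: _]).
  rewrite (Psi_perm perm_be); apply: (larger be _ _ _ _ _ e erefl lt_nth).
  by rewrite -(perm_size perm_be).
case/eqP: ne0; have := Psi_jt size_al srt_al sum_al.
rewrite /jt_sum (bigD1 1%g) ?shift_ok1 // shift_part1 //= odd_perm1 big1 ?addr0 // => s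
    /andP[/forallP ok ne_s].
suff -> : Psi (shift_part al s) = 0 by rewrite mul0rz.
have [j0 ne_j0] : exists j, s j != j.
  apply/existsP; rewrite -negb_forall; apply: contra ne_s => /forallP fix_s.
  by apply/eqP/permP => j; rewrite perm1 (eqP (fix_s j)).
case: (@arg_minnP _ j0 (fun j => s j != j) (fun j => val j) ne_j0) => j ne_j min_j.
have fix_lt (i : 'I_l) : (i < j)%N -> s i = i.
  by move=> lt_ij; apply/eqP/negPn/negP => /min_j; rewrite leqNgt lt_ij.
pose i := (s^-1)%g j; have si : s i = j by rewrite permKV.
have lt_ji : (j < i)%N.
  rewrite ltnNge leq_eqVlt; apply/negP => /orP[/eqP /val_inj e|/fix_lt e].
    by case/eqP: ne_j; rewrite -{1}e si.
  have ij : i = j by rewrite -e si.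
  by case/eqP: ne_j; rewrite -{1}ij si.
pose sh := shift_part al s.
have size_sh : size sh = l by rewrite size_shift_part.
have sh_i : nth 0%N sh i = (nth 0%N al j + (i - j))%N.
  by rewrite nth_shift_part si addnBA // ltnW.
have sh_mem : nth 0%N sh i \in drop j sh.
  have -> : nth 0%N sh i = nth 0%N (drop j sh) (i - j) by rewrite nth_drop subnKC // ltnW.
  by rewrite mem_nth // size_drop size_sh ltn_sub2r.
have perm_sh : perm_eq sh (take j sh ++ nth 0%N sh i :: rem (nth 0%N sh i) (drop j sh)).
  by rewrite -{1}(cat_take_drop j sh) perm_cat2l perm_to_rem.
have take_sh : take j sh = take j al.
  apply: (@eq_from_nth _ 0%N); rewrite !size_takel ?size_sh ?size_al ?(ltnW (ltn_ord j)) //.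
  move=> a lt_a; have lt_al : (a < l)%N by apply: ltn_trans lt_a (ltn_ord j).
  rewrite !nth_take // (nth_shift_part _ _ (Ordinal lt_al)).
  by rewrite (fix_lt (Ordinal lt_al)) //= addnK.
rewrite (Psi_perm perm_sh) take_sh.
have e := cat_nth al j; rewrite size_al ltn_ord in e.
apply: larger (e isT) erefl _ _.
  by rewrite sh_i -[X in (X < _)%N]addn0 ltn_add2l subn_gt0.
by rewrite -take_sh -(perm_size perm_sh).
Qed.

End Uniqueness.

End JacobiTrudi.

Section NoncommutativeSchur.

Variables (R : nzRingType) (u : nat -> R) (m : nat).

Definition hprod (ns : seq nat) : R := \prod_(a <- ns) hsym u a m.

Lemma hprod_rows (ns : seq nat) :
  \sum_(rs <- rows m (size ns) | map size rs == ns) rows_prod u rs = hprod ns.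
Proof.
elim: ns => [|n ns IHns].
  by rewrite big_mkcond big_seq1 /rows_prod /hprod !big_nil.
rewrite big_mkcond big_rowsS /hprod big_cons -/(hprod ns) -IHns /hsym mulr_suml.
rewrite [RHS]big_mkcond; apply: eq_bigr => x _.
have [e|ne] := eqVneq (size x) n; last first.
  by rewrite big1 // => rs _; rewrite /= eqseq_cons (negbTE ne).
rewrite mulr_sumr [RHS]big_mkcond; apply: eq_bigr => rs _.
by rewrite /= eqseq_cons e eqxx /rows_prod big_cons.
Qed.

Hypothesis uP : switch_ideal u.
Hypothesis u_far : forall a d, (a + 3 <= d)%N -> GRing.comm (u a) (u d).

Lemma hprod_perm (s t : seq nat) : perm_eq s t -> hprod s = hprod t.
Proof.
move=> st; have C i j : GRing.comm (hsym u i m) (hsym u j m) by apply: hsym_comm.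
apply: (catCA_perm_ind (P := fun r => hprod s = hprod r) _ st) => // s1 s2 s3 ->.
rewrite /hprod !big_cat /= !mulrA; congr (_ * _).
apply: commr_prod => i _; apply: commr_sym; apply: commr_prod => j _; exact: C.
Qed.

(** If a row were longer than the one before it, the column numbered by the length of the shorter
    row would be bad. *)
Lemma good_sorted (rs : seq (seq nat)) :
  all (mem (decs m)) rs -> good m rs -> sorted geq (map size rs).
Proof.
move=> /allP rs_decs /allP ok; apply/(sortedP 0%N) => i; rewrite size_map => lt_i.
rewrite !(nth_map [::]) ?(ltnW lt_i) //= leqNgt; apply/negP => lt_size.
have le_m : (size (nth [::] rs i.+1) <= m)%N.
  by apply: size_decs; apply: rs_decs; rewrite mem_nth.
have lt_m := leq_trans lt_size le_m.
have /allP/(_ i) := ok (size (nth [::] rs i)) ltac:(by rewrite mem_iota).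
rewrite mem_iota => /(_ ltac:(lia)).
by rewrite /pair_ok /col_ok lt_size ltnn.
Qed.

(** Expanding the products over arrays leaves the weight [jt_sign] of the row lengths. The sieve
    reduces the sum to good arrays, whose lengths are sorted, and there the weight is an
    indicator. *)
Lemma jt_sum_hprod (l : nat) (la : seq nat) : size la = l -> sorted geq la ->
  jt_sum l hprod la =
  \sum_(rs <- rows m l | good m rs && (map size rs == la)) rows_prod u rs.
Proof.
move=> size_la srt_la.
transitivity (\sum_(rs <- rows m l) rows_prod u rs * (jt_sign l la (map size rs))%:~R).
  rewrite /jt_sum.
  under eq_bigr => s _.
    rewrite -hprod_rows size_shift_part big_mkcond mulrz_suml.
    over.
  rewrite exchange_big big_seq [RHS]big_seq; apply: eq_bigr => rs.
  rewrite mem_rows => /andP[/eqP size_rs _].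
  rewrite jt_signE ?size_map // rmorph_sum mulr_sumr; apply: eq_bigr => s _.
  case: eqP => _; last by rewrite mul0rz mulr0 mulr0.
  by rewrite mulr1 mulrzr.
rewrite (sieve m uP u_far); last by move=> *; apply: jt_sign_swap.
rewrite big_seq_cond [RHS]big_mkcondr [RHS]big_seq_cond; apply: eq_bigr => rs.
rewrite mem_rows => /andP[/andP[/eqP size_rs rs_decs] ok].
rewrite jt_sign_part ?size_map //; last exact: good_sorted.
by case: eqP => _; rewrite ?mulr1 ?mulr0.
Qed.

End NoncommutativeSchur.

(** * Operators adding a cell *)

Section PartialMapMatrices.

Variables (T : finType) (t0 : T).

(** A dimension in successor form makes the square matrices a nonzero ring; [t0] witnesses that [T]
    is inhabited. *)
Lemma state_card : #|T|.-1.+1 = #|T|.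
Proof. by apply: prednK; apply/card_gt0P; exists t0. Qed.

Definition state (i : 'I_(#|T|.-1.+1)) : T := enum_val (cast_ord state_card i).
Definition state_index (t : T) : 'I_(#|T|.-1.+1) := cast_ord (esym state_card) (enum_rank t).

Lemma state_indexK : cancel state_index state.
Proof. by move=> t; rewrite /state /state_index cast_ordKV enum_rankK. Qed.

Lemma stateK : cancel state state_index.
Proof. by move=> i; rewrite /state /state_index enum_valK cast_ordK. Qed.

Definition wentry (g : T -> option (T * nat)) (s t : T) : {poly int} :=
  if g s is Some (t', e) then (t == t')%:R * 'X^e else 0.

(** Row [s] records the image of [s], so a product of such matrices applies its leftmost factor
    first. *)
Definition pmat (g : T -> option (T * nat)) : 'M[{poly int}]_(#|T|.-1.+1) :=
  \matrix_(i, j) wentry g (state i) (state j).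

Definition pcomp (g h : T -> option (T * nat)) (s : T) : option (T * nat) :=
  if g s is Some (t, e) then
    if h t is Some (t', e') then Some (t', (e + e')%N) else None
  else None.

Lemma pmatM (g h : T -> option (T * nat)) : pmat g * pmat h = pmat (pcomp g h).
Proof.
apply/matrixP => i j; rewrite !mxE.
under eq_bigr do rewrite !mxE.
rewrite {1}/wentry /(wentry (pcomp _ _)) /pcomp.
case: (g _) => [[t e]|]; last by rewrite big1 // => k _; rewrite mul0r.
rewrite (bigD1 (state_index t)) //= state_indexK eqxx mul1r big1 ?addr0.
  rewrite /wentry; case: (h t) => [[t' e']|]; last by rewrite mulr0.
  by rewrite mulrCA exprD.
move=> k ne_k; case: eqP => [e_k|_]; last by rewrite !mul0r.
by rewrite -e_k stateK eqxx in ne_k.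
Qed.

Lemma eq_pmat (g h : T -> option (T * nat)) : g =1 h -> pmat g = pmat h.
Proof. by move=> gh; apply/matrixP => i j; rewrite !mxE /wentry gh. Qed.

Lemma pmat0 (g : T -> option (T * nat)) : g =1 (fun=> None) -> pmat g = 0.
Proof. by move=> g0; apply/matrixP => i j; rewrite !mxE /wentry g0. Qed.

Lemma pmat1 : pmat (fun s => Some (s, 0%N)) = 1.
Proof.
apply/matrixP => i j; rewrite !mxE /wentry mulr1 eq_sym.
by rewrite (inj_eq (can_inj stateK)).
Qed.

Lemma pmatZ (g h : T -> option (T * nat)) :
  (forall s, h s = if g s is Some (t, e) then Some (t, e.+1) else None) ->
  pmat h = 'X *: pmat g.
Proof.
move=> hE; apply/matrixP => i j; rewrite !mxE /wentry hE.
case: (g _) => [[t e]|]; last by rewrite mulr0.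
by rewrite mulrCA exprS.
Qed.

End PartialMapMatrices.

(* [diagram] is stated with the zero of the ring structure of [nat]. *)
Lemma diagramE (la mu : seq nat) : diagram la mu =
  [seq (r, c) | r <- iota 0 (size la),
                c <- iota (nth 0%N mu r) (nth 0%N la r - nth 0%N mu r)].
Proof. by []. Qed.

Lemma mem_diagram (la mu : seq nat) (r c : nat) :
  ((r, c) \in diagram la mu) = (nth 0 mu r <= c < nth 0 la r)%N.
Proof.
rewrite diagramE; apply/allpairsPdep/idP => [[r' [c' [_ + [-> ->]]]]|].
  by rewrite mem_iota => /andP[h1 h2]; apply/andP; split; lia.
case/andP=> le_c lt_c; exists r, c; split=> //; last by rewrite mem_iota; lia.
by rewrite mem_iota /= ltnNge; apply/negP => /(nth_default 0%N) e; rewrite e in lt_c.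
Qed.

Lemma part_nth (la : seq nat) (r r' : nat) : is_part la -> (r <= r')%N ->
  (nth 0 la r' <= nth 0 la r)%N.
Proof. by case/andP=> srt _; apply: sorted_geq_nth. Qed.

Lemma digits_unique (k i j : nat) (a b : int) : (i < k)%N -> (j < k)%N ->
  k%:Z * a + i%:Z = k%:Z * b + j%:Z -> i = j /\ a = b.
Proof.
move=> lt_i lt_j e.
have ge_k (d : int) : 1 <= d -> k%:Z <= k%:Z * d.
  by move=> le_d; rewrite -{1}[k%:Z]mulr1; apply: ler_wpM2l.
have ab : a = b.
  case: (ltgtP a b) => // lt_ab.
    by have := ge_k (b - a); rewrite mulrBr; lia.
  by have := ge_k (a - b); rewrite mulrBr; lia.
by split=> //; move: e; rewrite ab; lia.
Qed.

(** * Comparable cells and their shifted contents *)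

Section Cells.

Variables (k : nat) (nu : k.-tuple skew_shape).

Notation cell := (cell nu).
Notation sc := (@shifted_content k nu).

Lemma cell_eq (x y : cell) : cell_comp x = cell_comp y ->
  cell_row x = cell_row y -> cell_col x = cell_col y -> x = y.
Proof.
rewrite /cell_comp /cell_row /cell_col; case: x y => [[i [r c]] p] [[j [r' c']] q] /=.
by move=> e1 e2 e3; apply: val_inj; rewrite /= e1 e2 e3.
Qed.

(** Skew shapes are convex: the row bounds are monotone, so the rectangle between two cells stays
    inside the shape. *)
Lemma cell_rect (x y : cell) (r c : nat) : cell_comp x = cell_comp y ->
  (cell_row x <= r <= cell_row y)%N -> (cell_col x <= c <= cell_col y)%N ->
  exists z : cell, [/\ cell_comp z = cell_comp x, cell_row z = r & cell_col z = c].
Proof.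
rewrite /cell_comp /cell_row /cell_col; case: x y => [[i [rx cx]] px] [[j [ry cy]] py] /=.
move=> eij /andP[le1 le2] /andP[le3 le4]; case: j / eij py => py.
have in_diag a b : (i, (a, b)) \in cells nu ->
    (a, b) \in diagram (outer (tnth nu i)) (inner (tnth nu i)).
  by case/allpairsPdep => i' [x' [_ + [-> ->]]].
move: (in_diag _ _ px) (in_diag _ _ py); rewrite !mem_diagram => /andP[h1 h2] /andP[h3 h4].
have le_in := part_nth (inner_part (tnth nu i)) le1.
have le_out := part_nth (outer_part (tnth nu i)) le2.
suff p : (i, (r, c)) \in cells nu by exists (SeqSub p).
apply/allpairsPdep; exists i, (r, c); split=> //; first by rewrite mem_enum.
by rewrite mem_diagram; apply/andP; split; lia.
Qed.

Definition prec (x y : cell) : bool :=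
  (cell_comp x == cell_comp y) &&
  ((cell_row x == cell_row y) && (cell_col x < cell_col y)%N
  || (cell_col x == cell_col y) && (cell_row x < cell_row y)%N).

Lemma prec_irr (x : cell) : prec x x = false.
Proof. by rewrite /prec !ltnn !andbF. Qed.

Lemma SYT_prec (T : filling nu) :
  SYT T = injectiveb T && [forall x, forall y, prec x y ==> (T x < T y)%N].
Proof.
rewrite /SYT; congr (_ && _); apply: eq_forallb => x; apply: eq_forallb => y.
rewrite /prec /entry !ltnS; case: eqP => //= _.
by case: (_ == _); case: (_ == _); case: (cell_row x < _)%N; case: (cell_col x < _)%N => //=;
    case: (_ < _)%N.
Qed.

Lemma scE (x : cell) : sc x =
  k%:Z * ((cell_col x)%:Z - (cell_row x)%:Z) + (cell_comp x)%:Z.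
Proof. by []. Qed.

Lemma sc_sub (x y : cell) : cell_comp x = cell_comp y ->
  sc y - sc x =
  k%:Z * ((cell_col y)%:Z - (cell_row y)%:Z - ((cell_col x)%:Z - (cell_row x)%:Z)).
Proof. by move=> e; rewrite !scE e; lia. Qed.

Lemma sc_eq (x y : cell) : sc x = sc y ->
  cell_comp x = cell_comp y /\ (cell_col x + cell_row y = cell_col y + cell_row x)%N.
Proof.
rewrite !scE => e; have := ltn_ord (cell_comp x); have := ltn_ord (cell_comp y).
set i := nat_of_ord _ in e *; set j := nat_of_ord _ in e *; move=> lt_j lt_i.
have [eij edc] := digits_unique lt_i lt_j e.
by split; [apply: val_inj | lia].
Qed.

Lemma prec_sc (x y : cell) : prec x y ->
  k%:Z <= `|sc y - sc x|.
Proof.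
rewrite /prec => /andP[/eqP e cond]; rewrite sc_sub //.
by case/orP: cond => /andP[/eqP e2 lt]; rewrite e2; nia.
Qed.

(** Adjacent cells of a row or column are exactly [k] apart; at a larger distance, the neighbour of
    [x] towards [y] lies strictly between. *)
Lemma prec_far (x y : cell) : prec x y -> k%:Z < `|sc y - sc x| ->
  exists2 w, prec x w & prec w y.
Proof.
rewrite /prec => /andP[/eqP e cond]; rewrite sc_sub //.
case/orP: cond => /andP[/eqP e2 lt] far.
  have lt2 : ((cell_col x).+1 < cell_col y)%N.
    rewrite ltn_neqAle lt andbT; apply/eqP => e3; move: far; rewrite -e3 e2.
    set d := (X in k%:Z * X); have -> : d = 1 by rewrite /d; lia.
    by rewrite mulr1; lia.
  have [||w [w1 w2 w3]] := @cell_rect x y (cell_row x) (cell_col x).+1 e.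
  - by rewrite leqnn e2 leqnn.
  - by rewrite leqnSn ltnW.
  by exists w; rewrite w1 w2 w3 ?e e2 !eqxx ?ltnSn ?lt2.
have lt2 : ((cell_row x).+1 < cell_row y)%N.
  rewrite ltn_neqAle lt andbT; apply/eqP => e3; move: far; rewrite -e3 e2.
  set d := (X in k%:Z * X); have -> : d = -1 by rewrite /d; lia.
  by rewrite mulrN1; lia.
have [||w [w1 w2 w3]] := @cell_rect x y (cell_row x).+1 (cell_col x) e.
- by rewrite leqnSn ltnW.
- by rewrite leqnn e2 leqnn.
by exists w; rewrite w1 w2 w3 ?e e2 !eqxx ?ltnSn ?lt2 orbT.
Qed.

End Cells.

Section AddCell.

Variables (k : nat) (nu : k.-tuple skew_shape).

Notation cell := (cell nu).
Notation sc := (@shifted_content k nu).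

Definition lower (S : {set cell}) : bool :=
  [forall x in S, forall z, prec z x ==> (z \in S)].

Lemma lowerP (S : {set cell}) :
  reflect (forall x z, x \in S -> prec z x -> z \in S) (lower S).
Proof.
apply: (iffP forall_inP) => [h x z x_S zx|h x x_S].
  by have /forallP/(_ z) := h x x_S; rewrite zx.
by apply/forallP => z; apply/implyP; apply: h.
Qed.

(** Requiring [S] itself to be an order ideal makes the operators vanish on all other sets, so their
    relations hold as identities of full matrices. *)
Definition can_add (S : {set cell}) (x : cell) : bool :=
  [&& lower S, x \notin S & lower (x |: S)].

(** The cells of [S] were added before [x] and carry smaller entries, so these [y] are the
    inversions with first cell [x]. *)
Definition near_above (S : {set cell}) (x : cell) : nat :=
  #|[set y in S | 0 < sc y - sc x < k%:Z]|.

Definition add_cell (x : cell) (S : {set cell}) : option ({set cell} * nat) :=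
  if can_add S x then Some (x |: S, near_above S x) else None.

Definition cell_op (x : cell) := pmat set0 (add_cell x).

Lemma cell_op2 (x y : cell) : cell_op x * cell_op y =
  pmat set0 (fun S => if can_add S x && can_add (x |: S) y
    then Some (y |: (x |: S), (near_above S x + near_above (x |: S) y)%N) else None).
Proof.
rewrite /cell_op pmatM; apply: eq_pmat => S; rewrite /pcomp /add_cell.
by case: can_add => //=; case: can_add.
Qed.

Lemma can_add_prec (S : {set cell}) (x y w : cell) :
  can_add S x -> can_add (x |: S) y -> prec x w -> prec w y -> False.
Proof.
case/and3P=> /lowerP low_S x_S _ /and3P[_ _ /lowerP low] xw wy.
have := low y w (setU11 _ _) wy; rewrite !inE => /or3P[/eqP e|/eqP e|w_S].
- by rewrite e prec_irr in wy.
- by rewrite e prec_irr in xw.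
- by rewrite (low_S _ _ w_S xw) in x_S.
Qed.

(** The hypothesis allows [x] before [y] only with a cell between them, which two successive
    additions exclude; so [y] does not depend on [x]. *)
Lemma can_add_swap (S : {set cell}) (x y : cell) :
  (prec x y -> exists2 w, prec x w & prec w y) ->
  can_add S x -> can_add (x |: S) y -> can_add S y && can_add (y |: S) x.
Proof.
move=> indep Sx xSy; case/and3P: (Sx) => /lowerP low_S x_S _.
case/and3P: (xSy) => _; rewrite !inE negb_or => /andP[ne_yx y_S] low_xyS.
have nxy : ~~ prec x y.
  apply/negP => /indep[w xw wy]; exact: (can_add_prec Sx xSy xw wy).
have low_yS : lower (y |: S).
  apply/lowerP => z w; rewrite !inE => /predU1P[->|z_S] wz.
    have := lowerP _ low_xyS y w (setU11 _ _) wz; rewrite !inE => /or3P[->//|/eqP e|->].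
      by rewrite e (negbTE nxy) in wz.
    by rewrite orbT.
  by rewrite (low_S _ _ z_S wz) orbT.
rewrite /can_add y_S low_yS !inE negb_or eq_sym ne_yx x_S setUCA low_xyS !andbT.
exact/lowerP.
Qed.

Lemma near_aboveU (S : {set cell}) (x y : cell) : x \notin S ->
  near_above (x |: S) y = ((0 < sc x - sc y < k%:Z)%R + near_above S y)%N.
Proof.
move=> x_S; rewrite /near_above.
have [near|far] := boolP (0 < sc x - sc y < k%:Z).
  have -> : [set z in x |: S | 0 < sc z - sc y < k%:Z] =
      x |: [set z in S | 0 < sc z - sc y < k%:Z].
    apply/setP => z; rewrite !inE; case: eqP => [->|] //=.
  by rewrite cardsU1 !inE (negbTE x_S).
rewrite add0n; apply: eq_card => z; rewrite !inE.
by case: eqP => [->|] //=; rewrite (negbTE far) andbF.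
Qed.

(** At this distance the pair is never an inversion, and [prec_far] rules out that one cell enables
    the other. *)
Lemma cell_op_far (x z : cell) : k%:Z < sc z - sc x ->
  cell_op x * cell_op z = cell_op z * cell_op x.
Proof.
move=> far; rewrite !cell_op2; apply: eq_pmat => S.
have ixz : prec x z -> exists2 w, prec x w & prec w z.
  by move=> xz; apply: prec_far => //; lia.
have izx : prec z x -> exists2 w, prec z w & prec w x.
  by move=> zx; apply: prec_far => //; lia.
have -> : can_add S x && can_add (x |: S) z = can_add S z && can_add (z |: S) x.
  by apply/idP/idP => /andP[h1 h2]; apply: can_add_swap h2.
case: ifP => // /andP[/and3P[_ z_S _] /and3P[_ + _]].
rewrite !inE negb_or => /andP[_ x_S].
rewrite setUCA !near_aboveU //; congr (Some (_, _)).
have -> : (0 < sc x - sc z < k%:Z) = false by apply/negP => /andP[]; lia.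
have -> : (0 < sc z - sc x < k%:Z) = false by apply/negP => /andP[]; lia.
by rewrite !add0n addnC.
Qed.

(** Comparable cells are at least [k] apart, so [x] and [y] can be added in either order; adding [y]
    first costs exactly one inversion. *)
Lemma cell_op_near (x y : cell) : 0 < sc y - sc x < k%:Z ->
  cell_op y * cell_op x = 'X *: (cell_op x * cell_op y).
Proof.
move=> near; rewrite !cell_op2; apply: pmatZ => S.
have nxy : prec x y -> False by move/prec_sc; lia.
have nyx : prec y x -> False by move/prec_sc; lia.
have -> : can_add S x && can_add (x |: S) y = can_add S y && can_add (y |: S) x.
  by apply/idP/idP => /andP[h1 h2]; apply: can_add_swap h2.
case: ifP => // /andP[/and3P[_ y_S _] /and3P[_ + _]].
rewrite !inE negb_or => /andP[_ x_S].
rewrite setUCA !near_aboveU // near; congr (Some (_, _)).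
have -> : (0 < sc x - sc y < k%:Z) = false by apply/negP => /andP[]; lia.
by rewrite add0n add1n !addnS addnC.
Qed.

(** Cells of equal shifted content lie on one diagonal, and the witnesses are the other two corners
    of the rectangle they span. *)
Lemma sc_eq_prec (x y : cell) : sc x = sc y -> (cell_row x < cell_row y)%N ->
  exists w1 w2, [/\ w1 != w2, prec x w1, prec w1 y, prec x w2 & prec w2 y].
Proof.
case/sc_eq=> e diag lt_row.
have lt_col : (cell_col x < cell_col y)%N by lia.
have [||w1 [c1 r1 d1]] := @cell_rect _ _ x y (cell_row x) (cell_col y) e.
- by rewrite leqnn ltnW.
- by rewrite leqnn ltnW.
have [||w2 [c2 r2 d2]] := @cell_rect _ _ x y (cell_row y) (cell_col x) e.
- by rewrite leqnn ltnW.
- by rewrite leqnn ltnW.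
exists w1, w2; split; rewrite /prec ?c1 ?c2 ?r1 ?r2 ?d1 ?d2 -?e ?eqxx ?lt_row ?lt_col ?orbT //.
by apply/eqP => w12; move: lt_row; rewrite -r1 -r2 w12 ltnn.
Qed.

Lemma cell_op_same (x y : cell) : sc x = sc y -> cell_op x * cell_op y = 0.
Proof.
move=> e; rewrite cell_op2; apply: pmat0 => S.
case: ifP => // /andP[Sx xSy]; exfalso.
case/and3P: (xSy) => low; rewrite !inE negb_or => /andP[/eqP ne_yx y_S] _.
have [lt|lt|e_row] := ltngtP (cell_row x) (cell_row y).
- have [w [_ [_ xw wy _ _]]] := sc_eq_prec e lt.
  exact: (can_add_prec Sx xSy xw wy).
- have [w [_ [_ yw wx _ _]]] := sc_eq_prec (esym e) lt.
  have := lowerP _ low x w (setU11 _ _) wx; rewrite !inE => /predU1P[e1|w_S].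
    by rewrite e1 prec_irr in wx.
  case/and3P: Sx => /lowerP low_S _ _.
  by rewrite (low_S _ _ w_S yw) in y_S.
- by case/sc_eq: e => e_comp diag; apply: ne_yx; apply: cell_eq => //; lia.
Qed.

(** From a cell to a later one on its diagonal, two corners must be added in between, but only one
    step is available. *)
Lemma cell_op_sandwich (x y z : cell) : sc x = sc z ->
  cell_op x * cell_op y * cell_op z = 0.
Proof.
move=> e; rewrite cell_op2 /cell_op pmatM; apply: pmat0 => S; rewrite /pcomp /add_cell.
case: ifP => // /andP[Sx xSy]; case: ifP => // yxSz; exfalso.
case/and3P: (Sx) => /lowerP low_S x_S _.
case/and3P: (xSy) => /lowerP low_xS y_xS _.
case/and3P: (yxSz) => _ z_yxS /lowerP low.
have [lt|lt|e_row] := ltngtP (cell_row x) (cell_row z).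
- have [w1 [w2 [ne_w xw1 w1z xw2 w2z]]] := sc_eq_prec e lt.
  have is_y w : prec x w -> prec w z -> w = y.
    move=> xw wz; have := low z w (setU11 _ _) wz; rewrite !inE.
    case/or4P => [/eqP e1|/eqP //|/eqP e1|w_S].
    + by rewrite e1 prec_irr in wz.
    + by rewrite e1 prec_irr in xw.
    + by rewrite (low_S _ _ w_S xw) in x_S.
  by rewrite (is_y w1) // (is_y w2) // eqxx in ne_w.
- have [w [_ [_ zw wx _ _]]] := sc_eq_prec (esym e) lt.
  have := low_xS x w (setU11 _ _) wx; rewrite !inE => /predU1P[e1|w_S].
    by rewrite e1 prec_irr in wx.
  by move: z_yxS; rewrite !inE (low_S _ _ w_S zw) !orbT.
- have e1 : x = z by case/sc_eq: e => e_comp diag; apply: cell_eq => //; lia.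
  by move: z_yxS; rewrite !inE e1 eqxx !orbT.
Qed.

Lemma scaleX_inj : injective ( *:%R 'X : 'M[{poly int}]_(#|{set cell}|.-1.+1) -> _).
Proof.
move=> A B /matrixP e; apply/matrixP => i j; have := e i j; rewrite !mxE.
by apply: mulfI; rewrite polyX_eq0.
Qed.

(* For letters less than [k] apart, [cell_op] is commutative up to a power of
   ['X], and the two powers picked up by [y] cancel. *)
Lemma cell_op_switch (x y z : cell) : sc x < sc y -> sc y < sc z ->
  GRing.comm (cell_op y) (cell_op z * cell_op x - cell_op x * cell_op z).
Proof.
move=> lt_xy lt_yz; have [far|near] := ltP k%:Z (sc z - sc x).
  by rewrite (cell_op_far far) subrr; apply: commr0.
have yx : cell_op y * cell_op x = 'X *: (cell_op x * cell_op y).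
  by apply: cell_op_near; lia.
have zy : cell_op z * cell_op y = 'X *: (cell_op y * cell_op z).
  by apply: cell_op_near; lia.
apply: commrB; apply: scaleX_inj; rewrite /GRing.comm /=.
  by rewrite mulrA scalerAl -zy -[in RHS]mulrA scalerAr -yx mulrA.
by rewrite mulrA yx -[in RHS]mulrA zy -scalerAl -scalerAr mulrA.
Qed.

End AddCell.

(** * Letters: ranks of shifted contents *)

Section Letters.

Variables (k : nat) (nu : k.-tuple skew_shape).

Notation cell := (cell nu).
Notation sc := (@shifted_content k nu).

Definition contents : seq int := sort <=%O (undup [seq sc x | x : cell]).

Definition letter (x : cell) : nat := index (sc x) contents.

Lemma mem_contents (x : cell) : sc x \in contents.
Proof. by rewrite mem_sort mem_undup image_f. Qed.

Lemma contents_sorted : sorted <%O contents.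
Proof. by rewrite sort_lt_sorted undup_uniq. Qed.

Lemma letter_lt (x y : cell) : (letter x < letter y)%N = (sc x < sc y).
Proof.
have srt := contents_sorted.
have lt_of a b : (letter a < letter b)%N -> sc a < sc b.
  move=> lt_ab; apply: (sorted_ltn_index lt_trans srt) => //; exact: mem_contents.
apply/idP/idP => [/lt_of //|lt_xy]; rewrite ltnNge leq_eqVlt; apply/negP => /orP[/eqP e|/lt_of].
  have /(congr1 (nth 0 contents)) := e; rewrite !nth_index ?mem_contents // => e'.
  by rewrite e' ltxx in lt_xy.
by rewrite ltNge (ltW lt_xy).
Qed.

Lemma letter_eq (x y : cell) : (letter x == letter y) = (sc x == sc y).
Proof. by rewrite eqn_leq !(leqNgt (letter _)) !letter_lt -!leNgt eq_le. Qed.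

Lemma letter_size (x : cell) : (letter x < size contents)%N.
Proof. by rewrite index_mem mem_contents. Qed.

Lemma letter_onto (a : nat) : (a < size contents)%N -> exists x, letter x = a.
Proof.
move=> lt_a; have := mem_nth 0 lt_a; rewrite mem_sort mem_undup => /imageP[x _ e].
exists x; rewrite /letter -e index_uniq //.
by rewrite (sorted_uniq lt_trans ltxx contents_sorted).
Qed.

Definition letter_op (a : nat) := \sum_(x : cell | letter x == a) cell_op x.

Lemma letter_op_switch : switch_ideal letter_op.
Proof.
split=> [a|a b _|a b c /andP[lt_ab lt_bc]].
- rewrite /letter_op mulr_suml big1 // => x /eqP e_x; rewrite mulr_sumr big1 // => y /eqP e_y.
  by apply: cell_op_same; apply/eqP; rewrite -letter_eq e_x e_y.
- rewrite /letter_op -mulrA mulr_suml big1 // => x /eqP e_x.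
  rewrite mulr_suml mulr_sumr big1 // => y _; rewrite 2!mulr_sumr big1 // => z /eqP e_z.
  by rewrite mulrA cell_op_sandwich //; apply/eqP; rewrite -letter_eq e_x e_z.
have -> : letter_op c * letter_op a - letter_op a * letter_op c =
    \sum_(z : cell | letter z == c) \sum_(x : cell | letter x == a)
      (cell_op z * cell_op x - cell_op x * cell_op z).
  rewrite /letter_op !mulr_suml; under [RHS]eq_bigr => z _ do rewrite sumrB.
  rewrite sumrB; congr (_ - _); first by apply: eq_bigr => z _; rewrite mulr_sumr.
  rewrite exchange_big /=; apply: eq_bigr => x _; by rewrite mulr_sumr.
apply: commr_sum => z /eqP e_z; apply: commr_sum => x /eqP e_x; apply: commr_sym.
apply: commr_sum => y /eqP e_y; apply: commr_sym.
by apply: cell_op_switch; rewrite -letter_lt ?e_x ?e_y ?e_z.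
Qed.

(** The consequence of the diameter bound that the argument uses; straight shapes with [k = 1] are
    shown to satisfy it directly. *)
Definition four_spread : Prop := forall w c y x : cell,
  sc w < sc c -> sc c < sc y -> sc y < sc x -> k%:Z < sc x - sc w.

Lemma letter_op_far : four_spread ->
  forall a d, (a + 3 <= d)%N -> GRing.comm (letter_op a) (letter_op d).
Proof.
move=> spread a d lt_ad; rewrite /letter_op.
apply: commr_sum => z /eqP e_z; apply: commr_sym; apply: commr_sum => x /eqP e_x.
apply: commr_sym; apply: cell_op_far.
have lt_d := letter_size z; rewrite e_z in lt_d.
have [c e_c] := @letter_onto a.+1 ltac:(lia).
have [y e_y] := @letter_onto a.+2 ltac:(lia).
by apply: (spread x c y z); rewrite -letter_lt ?e_x ?e_c ?e_y ?e_z //; lia.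
Qed.

Lemma diam_four_spread : (diam nu <= 3)%N -> four_spread.
Proof.
move=> le3 w c y x lt_wc lt_cy lt_yx; rewrite ltNge; apply/negP => near.
pose D := [fset sc x | x in cell]%fset.
have inD z : sc z \in D by rewrite in_imfset.
pose v z : D := FSetSub (inD z).
pose s := [:: v w; v c; v y; v x]; pose R : {set D} := [set r in s].
have neq z z' : sc z < sc z' -> (v z == v z') = false.
  by move=> lt_z; apply/eqP => /(congr1 val) /= e; rewrite e ltxx in lt_z.
have card_R : #|R| = 4%N.
  rewrite cardsE; apply/(card_uniqP (s := s)); rewrite /= !inE.
  have lt_wy := lt_trans lt_wc lt_cy; have lt_cx := lt_trans lt_cy lt_yx.
  by rewrite !neq // (lt_trans lt_wy).
have bounds r : r \in R -> sc w <= val r <= sc x.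
  by rewrite !inE => /or4P[] /eqP -> /=; lia.
have : (#|R| <= diam nu)%N.
  rewrite /diam; apply: (@leq_bigmax_cond _ _ (fun R : {set D} => #|R|) R).
  apply/forall_inP => a /bounds ba; apply/forall_inP => b /bounds bb.
  have close (i j p q : int) : p <= i <= q -> p <= j <= q -> q - p <= k%:Z -> `|i - j| <= k%:Z.
    by rewrite ler_norml; lia.
  exact: close ba bb near.
by rewrite card_R => /leq_trans/(_ le3).
Qed.

End Letters.

(** * Products of cell operators and standard fillings *)

Section InverseFilling.

Variables (C D : finType) (d : D -> C).
Hypothesis card_eq : #|C| = #|D|.

(** A total function whose default [d i] is reached only outside the image of [T]; it is the inverse
    when [T] is injective and the cardinals agree. *)
Definition finv_at (T : C -> D) (i : D) : C := odflt (d i) [pick x | T x == i].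

Lemma finv_atK (T : C -> D) : injective T -> cancel T (finv_at T).
Proof.
move=> inj x; rewrite /finv_at; case: pickP => [y /eqP /inj //|/(_ x)].
by rewrite eqxx.
Qed.

Lemma finv_atKV (T : C -> D) : injective T -> cancel (finv_at T) T.
Proof.
move=> inj i; have [g gK Kg] := inj_card_bij inj (eq_leq (esym card_eq)).
by rewrite -{1}[i]Kg finv_atK // Kg.
Qed.

End InverseFilling.

Section Amplitude.

Variables (k : nat) (nu : k.-tuple skew_shape).

Notation cell := (cell nu).
Notation sc := (@shifted_content k nu).
Notation n := (ncells nu).
Notation op := 'M[{poly int}]_(#|{set cell}|.-1.+1).

Definition cell_at (T : cell -> 'I_n) (i : 'I_n) : cell := finv_at enum_val T i.

Lemma cell_atK (T : cell -> 'I_n) : injective T -> cancel T (cell_at T).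
Proof. exact: finv_atK. Qed.

Lemma cell_atKV (T : cell -> 'I_n) : injective T -> cancel (cell_at T) T.
Proof. by apply: finv_atKV; rewrite card_ord. Qed.

(** The inverse point of view on the content word: ranks of contents listed by increasing entry. *)
Definition letters (T : filling nu) : seq nat := [seq letter (cell_at T i) | i <- enum 'I_n].

Definition amplitude (M : op) : {poly int} :=
  M (state_index set0 set0) (state_index set0 setT).

Lemma amplitude_sum (I : Type) (r : seq I) (P : pred I) (F : I -> op) :
  amplitude (\sum_(i <- r | P i) F i) = \sum_(i <- r | P i) amplitude (F i).
Proof. by rewrite /amplitude summxE. Qed.

Lemma amplitude_pmat (g : {set cell} -> option ({set cell} * nat)) :
  amplitude (pmat set0 g) = wentry g set0 setT.
Proof. by rewrite /amplitude mxE !state_indexK. Qed.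

Definition run (t : seq cell) : {set cell} -> option ({set cell} * nat) :=
  foldr (fun x => pcomp (add_cell x)) (fun S => Some (S, 0%N)) t.

Lemma prod_cell_op (t : seq cell) : \prod_(x <- t) cell_op x = pmat set0 (run t).
Proof.
elim: t => [|x t IHt]; first by rewrite big_nil pmat1.
by rewrite big_cons IHt /cell_op pmatM.
Qed.

Lemma prod_cell_op_ord (p : nat) (f : 'I_p -> cell) :
  \prod_(i < p) cell_op (f i) = pmat set0 (run [seq f i | i <- enum 'I_p]).
Proof. by rewrite -prod_cell_op big_map enumT [index_enum _]unlock. Qed.

Lemma run_end (t : seq cell) (S S' : {set cell}) (e : nat) : run t S = Some (S', e) ->
  S' = S :|: [set x in t] /\ #|S'| = (#|S| + size t)%N.
Proof.
elim: t S S' e => [|x t IHt] S S' e /=.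
  by case=> <- _; rewrite addn0; split=> //; apply/setP => x; rewrite !inE orbF.
rewrite /pcomp /add_cell; case: ifP => // /and3P[_ x_S _].
case e1 : (run t _) => [[S1 e']|] // [<- _].
have [-> ->] := IHt _ _ _ e1; rewrite cardsU1 x_S addnS; split; last by rewrite add1n.
by apply/setP => y; rewrite !inE; case: (y == x); rewrite ?orbT.
Qed.

Definition below (T : filling nu) (j : nat) : {set cell} := [set x | (T x < j)%N].

(** By induction downwards from [n]: the set reached before step [j] is [below T j], and the run
    survives exactly when this set and all later ones are order ideals. *)
Lemma run_filling (T : filling nu) (j : nat) : injective T -> (j <= n)%N ->
  run [seq cell_at T i | i <- drop j (enum 'I_n)] (below T j) =
  if [forall i : 'I_n.+1, (j <= i)%N ==> lower (below T i)]
  then Some (setT, \sum_(x | (j <= T x)%N) near_above (below T (T x)) x)%N else None.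
Proof.
move=> inj; have [m] := ubnP (n - j); elim: m j => // m IHm j lt_m.
rewrite leq_eqVlt => /predU1P[->|lt_j].
  rewrite drop_oversize ?size_enum_ord //=.
  have belowT i : (n <= i)%N -> below T i = setT.
    by move=> le_i; apply/setP => x; rewrite !inE (leq_trans (ltn_ord _)).
  rewrite belowT // big1 => [|x]; last by rewrite leqNgt ltn_ord.
  case: forallP => // -[] i; apply/implyP => /belowT ->.
  by apply/lowerP => x z _ _; rewrite inE.
rewrite (drop_nth (Ordinal lt_j)) ?size_enum_ord //=.
have -> : nth (Ordinal lt_j) (enum 'I_n) j = Ordinal lt_j by exact: (nth_ord_enum _ (Ordinal lt_j)).
set x := cell_at T (Ordinal lt_j); have Tx : T x = Ordinal lt_j by apply: cell_atKV.
have belowS : below T j.+1 = x |: below T j.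
  apply/setP => y; rewrite !inE ltnS leq_eqVlt; congr (_ || _).
  by apply/eqP/eqP => [e|->]; [apply: inj; rewrite Tx; apply: val_inj | rewrite Tx].
set t := map _ _; have -> : pcomp (add_cell x) (run t) (below T j) =
    if can_add (below T j) x then
      if run t (x |: below T j) is Some (S1, e) then
        Some (S1, (near_above (below T j) x + e)%N) else None
    else None.
  by rewrite /pcomp /add_cell; case: can_add.
rewrite -belowS IHm //; last by lia.
have -> : can_add (below T j) x = lower (below T j) && lower (below T j.+1).
  by rewrite /can_add -belowS !inE Tx ltnn.
have -> : [forall i : 'I_n.+1, (j <= i)%N ==> lower (below T i)] =
    [&& lower (below T j), lower (below T j.+1) &
      [forall i : 'I_n.+1, (j.+1 <= i)%N ==> lower (below T i)]].
  have lt_j1 : (j < n.+1)%N by lia.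
  have lt_j2 : (j.+1 < n.+1)%N by lia.
  apply/forallP/and3P => [h|[h1 h2 /forallP h3] i].
    split; [exact: implyP (h (Ordinal lt_j1)) (leqnn _)|
            exact: implyP (h (Ordinal lt_j2)) (leqnSn _)|].
    by apply/forallP => i; apply/implyP => /ltnW; apply/implyP.
  apply/implyP; rewrite leq_eqVlt => /predU1P[<- //|]; exact/implyP.
case: (lower (below T j)) => //=; case: (lower _) => //=; case: ifP => // _.
congr (Some (_, _)); rewrite [RHS](bigD1 x) /=; last by rewrite Tx.
rewrite Tx /=; congr (_ + _)%N; apply: eq_bigl => y.
rewrite ltn_neqAle andbC; congr (_ && ~~ _).
by apply/eqP/eqP => [e|->]; [apply: inj; rewrite Tx; apply: val_inj | rewrite Tx].
Qed.

Lemma inv_kE (T : filling nu) :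
  inv_k T = (\sum_x near_above (below T (T x)) x)%N.
Proof.
rewrite /inv_k -sum1dep_card; under [RHS]eq_bigr do rewrite /near_above -sum1dep_card.
rewrite pair_big_dep /=; apply: eq_bigl => -[x y] /=.
by rewrite !inE /entry ltnS andbC.
Qed.

Lemma amplitude_filling (T : filling nu) : injective T ->
  amplitude (\prod_(i < n) cell_op (cell_at T i)) = if SYT T then 'X^(inv_k T) else 0.
Proof.
move=> inj; rewrite prod_cell_op_ord amplitude_pmat /wentry.
have := run_filling inj (leq0n n); rewrite drop0.
have -> : below T 0 = set0 by apply/setP => x; rewrite !inE.
move=> ->; have -> : [forall i : 'I_n.+1, (0 <= i)%N ==> lower (below T i)] = SYT T.
  rewrite SYT_prec; have -> : injectiveb T by apply/injectiveP.
  apply/forallP/forallP => [h x|h i].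
    apply/forallP => y; apply/implyP => xy.
    have lt_y : (T y < n)%N by [].
    have /lowerP/(_ y x) := h (Ordinal (lt_y : (T y).+1 < n.+1)%N); rewrite !inE /= leqnn => /(_
        isT xy).
    rewrite ltnS leq_eqVlt => /predU1P[/val_inj/inj e|//].
    by rewrite e prec_irr in xy.
  apply/lowerP => y x; rewrite !inE => lt_y xy.
  by have /forallP/(_ y)/implyP/(_ xy) := h x; move/ltn_trans; apply.
by case: SYT => //; rewrite eqxx mul1r inv_kE.
Qed.

Lemma prod_letter_op (p : nat) (v : seq nat) : size v = p ->
  \prod_(a <- v) letter_op nu a =
  \sum_(f : {ffun 'I_p -> cell} | [seq letter (f i) | i <- enum 'I_p] == v)
    \prod_(i < p) cell_op (f i).
Proof.
move=> <-; rewrite (big_nth 0%N) big_mkord /letter_op bigA_distr_big_dep.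
apply: eq_bigl => f; apply/familyP/eqP => [h|e i].
  apply: (@eq_from_nth _ 0%N); rewrite size_map size_enum_ord // => i lt_i.
  rewrite (nth_map (Ordinal lt_i)) ?size_enum_ord //.
  pose j := nth (Ordinal lt_i) (enum 'I_(size v)) i.
  have /eqP -> : letter (f j) == nth 0%N v j := h j.
  by rewrite nth_enum_ord.
have : letter (f i) == nth 0%N v i; last by [].
have := congr1 (nth 0%N ^~ i) e.
by rewrite /= (nth_map i) ?size_enum_ord // nth_ord_enum => ->.
Qed.

(** Expanding each letter into its cells gives sequences of cells. A run from the empty set to all
    cells adds each cell once, so it is the inverse of a bijective filling. *)
Lemma amplitude_letters (v : seq nat) :
  amplitude (\prod_(a <- v) letter_op nu a) =
  \sum_(T : filling nu | SYT T && (letters T == v)) 'X^(inv_k T).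
Proof.
have [size_v|size_v] := eqVneq (size v) n; last first.
  rewrite [RHS]big1 => [|T /andP[_ /eqP e]]; last first.
    by rewrite -e size_map size_enum_ord eqxx in size_v.
  rewrite (prod_letter_op (erefl (size v))) amplitude_sum big1 // => f _.
  rewrite prod_cell_op_ord amplitude_pmat /wentry.
  case e : run => [[S e']|] //; case: eqP => [eS|]; last by rewrite mul0r.
  have [_] := run_end e; rewrite -eS cards0 add0n size_map size_enum_ord cardsT => e1.
  by rewrite -e1 eqxx in size_v.
pose inv (f : {ffun 'I_n -> cell}) : filling nu := [ffun x => finv_at enum_rank f x].
pose fl (T : filling nu) : {ffun 'I_n -> cell} := [ffun i => cell_at T i].
have cardE : #|'I_n| = #|cell| by rewrite card_ord.
have inj_fl (T : filling nu) : injective T -> injective (fl T).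
  by move=> inj i j; rewrite !ffunE => /(congr1 T); rewrite !cell_atKV.
have inj_inv (f : {ffun 'I_n -> cell}) : injective f -> injective (inv f).
  by move=> inj x y; rewrite !ffunE => /(congr1 f); rewrite !finv_atKV.
have flK (T : filling nu) : injective T -> inv (fl T) = T.
  move=> inj; apply/ffunP => x; rewrite ffunE; apply: (inj_fl T inj).
  by rewrite finv_atKV //; [rewrite ffunE cell_atK | exact: inj_fl].
have invK (f : {ffun 'I_n -> cell}) : injective f -> fl (inv f) = f.
  move=> inj; apply/ffunP => i; rewrite ffunE; apply: (inj_inv f inj).
  by rewrite cell_atKV; [rewrite ffunE finv_atK | exact: inj_inv].
rewrite (prod_letter_op size_v) amplitude_sum (bigID (fun f : {ffun _ -> _} => injectiveb f)) /=.
(* A run that reaches [setT] adds distinct cells, so the sequences with repetitions contribute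
   nothing. *)
rewrite [X in _ + X]big1 ?addr0; last first.
  move=> f /andP[_ ninj].
  rewrite prod_cell_op_ord amplitude_pmat /wentry.
  case e : run => [[S e']|] //; case: eqP => [eS|]; last by rewrite mul0r.
  have [+ e2] := run_end e; rewrite set0U => e1.
  case/negP: ninj; rewrite /injectiveb /dinjectiveb; apply/card_uniqP.
  by rewrite -cardsE -e1 e2 cards0.
rewrite (reindex_onto fl inv) => [|f /andP[_ /injectiveP]]; last exact: invK.
rewrite big_mkcond [RHS]big_mkcond; apply: eq_bigr => T _.
have -> : ([seq letter (fl T i) | i <- enum 'I_n] == v) = (letters T == v).
  by congr (_ == _); apply: eq_map => i; rewrite ffunE.
rewrite -andbA; have -> : injectiveb (fl T) && (inv (fl T) == T) = injectiveb T.
  apply/andP/injectiveP => [[/injectiveP inj /eqP <-]|inj]; first exact: inj_inv.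
  by rewrite flK // eqxx; split=> //; apply/injectiveP; apply: inj_fl.
rewrite [SYT T && _]andbC; case: eqP => //= _.
case: (injectiveP T) => [inj|/injectiveP/negbTE ninj]; last by rewrite SYT_prec ninj.
by rewrite -(amplitude_filling inj); congr amplitude; apply: eq_bigr => i _; rewrite ffunE.
Qed.

End Amplitude.

Lemma big_at_most_one (V : nmodType) (I : eqType) (r : seq I) (Q : pred I) (x0 : I) (c : V) :
  uniq r -> (forall x, Q x -> x = x0) ->
  \sum_(x <- r | Q x) c = if (x0 \in r) && Q x0 then c else 0.
Proof.
move=> uniq_r Q_x0; case: ifP => [/andP[x0_r Qx0]|no]; last first.
  rewrite big1_seq // => x /andP[Qx x_r]; case/negP: no.
  by rewrite -(Q_x0 _ Qx) x_r Qx.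
rewrite big_mkcond (bigD1_seq x0) //= Qx0 big1 ?addr0 // => x /eqP ne_x.
by case: ifP => // /Q_x0.
Qed.

(** * Coefficients as matrix entries *)

Section WordCoefficients.

Variables (k : nat) (nu : k.-tuple skew_shape).

Notation n := (ncells nu).
Notation m := (size (contents nu)).
Notation u := (letter_op nu).

Definition word_rows (ns v : seq nat) : seq (seq nat) := map rev (reshape ns v).

(** The coefficient of the monomial with exponents [ns] in the LLT polynomial, as [LLT_coef]
    shows. *)
Definition word_coef (ns : seq nat) : {poly int} := amplitude (hprod u m ns).

Lemma letters_lt (T : filling nu) : all (gtn m) (letters T).
Proof. by apply/allP => _ /mapP[i _ ->]; apply: letter_size. Qed.

Lemma size_letters (T : filling nu) : size (letters T) = n.
Proof. by rewrite size_map size_enum_ord. Qed.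

Lemma rows_prod_flatten (rs : seq (seq nat)) :
  rows_prod u rs = \prod_(a <- flatten (map rev rs)) u a.
Proof.
elim: rs => [|x rs IHrs]; first by rewrite /rows_prod !big_nil.
by rewrite /rows_prod big_cons -/(rows_prod u rs) IHrs /= big_cat.
Qed.

Lemma word_rows_mem (ns v : seq nat) : size v = sumn ns -> all (gtn m) v ->
  (word_rows ns v \in rows m (size ns)) = all (sorted ltn) (reshape ns v).
Proof.
have gtn_tr : transitive gtn by move=> ? ? ? /= h1 h2; apply: ltn_trans h1.
move=> size_v lt_v; rewrite mem_rows size_map.
have -> : size (reshape ns v) = size ns.
  by rewrite -[in RHS](@reshapeKl _ ns v) ?size_v // size_map.
rewrite eqxx /= all_map; apply: eq_in_all => w w_in /=.
rewrite mem_decs all_rev -(sorted_pairwise gtn_tr) rev_sorted andb_idr // => _.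
apply/allP => a a_w; apply: (allP lt_v).
by rewrite -(reshapeKr (eq_leq size_v)); apply/flattenP; exists w.
Qed.

Lemma amplitude_rows (P : pred (seq (seq nat))) (l : nat) (ns : seq nat) : size ns = l ->
  amplitude (\sum_(rs <- rows m l | P rs && (map size rs == ns)) rows_prod u rs) =
  \sum_(T : filling nu | SYT T && [&& sumn ns == n, all (sorted ltn) (reshape ns (letters T))
      & P (word_rows ns (letters T))]) 'X^(inv_k T).
Proof.
move=> <-; rewrite amplitude_sum.
under eq_bigr => rs _ do rewrite rows_prod_flatten amplitude_letters.
rewrite (exchange_big_dep (@SYT _ nu)) /=; last by move=> rs T _ /andP[].
rewrite [RHS]big_mkcondr; apply: eq_bigr => T SYT_T; rewrite SYT_T.
(* Row lengths and letters determine the array: it is the word of [T] cut into blocks of lengths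
   [ns]. *)
rewrite (@big_at_most_one _ _ _ _ (word_rows ns (letters T))) ?rows_uniq //; last first.
  move=> rs /andP[/andP[_ /eqP <-] /eqP ->]; rewrite /word_rows.
  have <- : shape (map rev rs) = map size rs.
    by rewrite /shape -map_comp; apply: eq_map => x /=; rewrite size_rev.
  by rewrite flattenK -map_comp map_id_in // => x _ /=; rewrite revK.
have [sum_ns|ne] := eqVneq (sumn ns) n; last first.
  case: ifP => // /and3P[_ /andP[_ /eqP e] /eqP e']; case/eqP: ne.
  rewrite -(size_letters T) e' size_flatten /shape -map_comp -[in LHS]e; congr sumn.
  by apply: eq_map => x /=; rewrite size_rev.
have size_T : size (letters T) = sumn ns by rewrite size_letters.
rewrite word_rows_mem ?letters_lt // -!andbA; congr (if _ then _ else _).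
congr (_ && _); rewrite andb_idr // => _; apply/andP; split; apply/eqP.
  rewrite /word_rows -map_comp -[RHS](@reshapeKl _ ns (letters T)) ?size_T //.
  by apply: eq_map => x /=; rewrite size_rev.
by rewrite /word_rows -map_comp map_id_in ?reshapeKr ?size_T // => x _ /=; rewrite revK.
Qed.

Lemma word_coefE (ns : seq nat) : word_coef ns =
  \sum_(T : filling nu | SYT T &&
     ((sumn ns == n) && all (sorted ltn) (reshape ns (letters T)))) 'X^(inv_k T).
Proof.
rewrite /word_coef -hprod_rows.
rewrite (@eq_bigl _ _ _ _ _ _ (fun rs => xpredT rs && (map size rs == ns))) //.
by rewrite amplitude_rows //; apply: eq_bigl => T; rewrite andbT.
Qed.

Lemma word_coef_deg (ns : seq nat) : sumn ns != n -> word_coef ns = 0.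
Proof. by move=> /negbTE ne; rewrite word_coefE big1 // => T; rewrite ne andbF. Qed.

Lemma word_coef_perm (s t : seq nat) : perm_eq s t -> word_coef s = word_coef t.
Proof. by move=> st; rewrite /word_coef (hprod_perm m (letter_op_switch nu) st). Qed.

Definition yam_word (la v : seq nat) : bool :=
  all (sorted ltn) (reshape la v) && good m (word_rows la v).

Lemma word_coef_jt (l : nat) (la : seq nat) : four_spread nu ->
  size la = l -> sorted geq la -> sumn la = n ->
  jt_sum l word_coef la =
  \sum_(T : filling nu | SYT T && yam_word la (letters T)) 'X^(inv_k T).
Proof.
move=> spread size_la srt_la sum_la.
transitivity (amplitude (jt_sum l (hprod u m) la)).
  rewrite /jt_sum amplitude_sum; apply: eq_bigr => s _.
  by case: (odd_perm s); rewrite /= ?expr1 ?expr0 ?mulrN1z ?mulr1z /word_coef /amplitude ?mxE.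
rewrite (jt_sum_hprod m (letter_op_switch nu) (letter_op_far spread) size_la srt_la).
by rewrite amplitude_rows //; apply: eq_bigl => T; rewrite sum_la eqxx.
Qed.

End WordCoefficients.

(** * Coefficients of monomials *)

Lemma seq_mset_perm (K : choiceType) (s : seq K) (A : {mset K}%mset) :
  (seq_mset s == A) = perm_eq s (enum_mset A).
Proof.
by apply/eqP/idP => [<-|/eq_seq_msetP ->]; rewrite ?seq_mset_id // perm_sym perm_eq_seq_mset.
Qed.

Lemma mem_finsupp_mset (K : choiceType) (A : {mset K}%mset) (a : K) :
  (a \in finsupp A) = (a \in enum_mset A).
Proof. by rewrite msuppE. Qed.

(** For weakly increasing [s]: [v] increases strictly along each block of equal values of [s]. This
    is when the monomial of [s] occurs in the fundamental function of a filling with letters [v]. *)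
Definition compatible (s v : seq nat) : bool :=
  sorted (fun p q => (p.1 == q.1) ==> (p.2 < q.2)%N) (zip s v).

Definition exponents (M : nat) (s : seq nat) : seq nat := [seq count_mem a s | a <- iota 0 M].

Lemma sorted_min (a : nat) (s : seq nat) : sorted leq s -> all (leq a) s ->
  s = nseq (count_mem a s) a ++ filter (predC1 a) s.
Proof.
elim: s => //= x s IHs srt /andP[le_ax le_s].
have srt' := path_sorted srt; have [e|ne] := eqVneq x a.
  by rewrite /= {1}(IHs srt' le_s) e.
have lt_ax : (a < x)%N by rewrite ltn_neqAle eq_sym ne.
have gt_s : all (ltn a) s.
  move: srt; rewrite (path_sortedE leq_trans) => /andP[/allP le_x _].
  by apply/allP => y /le_x; apply: leq_trans.
have -> : count_mem a s = 0%N.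
  apply/eqP; rewrite -leqn0 leqNgt -has_count; apply/hasPn => y /(allP gt_s) /=; lia.
rewrite /= (_ : filter _ s = s) //; apply/all_filterP; apply: sub_all gt_s => y /=; lia.
Qed.

Lemma sorted_blocks (a M : nat) (s v : seq nat) : sorted leq s ->
  all (fun x => (a <= x < a + M)%N) s -> size v = size s ->
  all (sorted ltn) (reshape [seq count_mem x s | x <- iota a M] v) = compatible s v.
Proof.
elim: M a s v => [|M IHM] a s v srt bound_s size_v.
  case: s {srt} bound_s size_v => [_ /size0nil -> //|x s] /= /andP[]; lia.
have le_s : all (leq a) s by apply: sub_all bound_s => x /andP[].
set c := count_mem a s; set s' := filter (predC1 a) s.
have eq_s : s = nseq c a ++ s' := sorted_min srt le_s.
have srt' : sorted leq s' by apply: sorted_filter => //; exact: leq_trans.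
have size_s : size s = (c + size s')%N by rewrite eq_s size_cat size_nseq.
have count_s x : x \in iota a.+1 M -> count_mem x s = count_mem x s'.
  rewrite mem_iota eq_s count_cat count_nseq => /andP[lt_ax _] /=.
  by rewrite eqn_leq [(x <= a)%N]leqNgt lt_ax andbF mul0n.
have bound_s' : all (fun x => (a.+1 <= x < a.+1 + M)%N) s'.
  apply/allP => x; rewrite mem_filter /= => /andP[ne_x /(allP bound_s)]; lia.
have -> : [seq count_mem x s | x <- iota a M.+1] = c :: [seq count_mem x s' | x <- iota a.+1 M].
  by congr cons; apply/eq_in_map.
rewrite /=.
have size_drop_v : size (drop c v) = size s' by rewrite size_drop size_v size_s addKn.
rewrite IHM //.
have size_take_v : size (take c v) = c by rewrite size_takel // size_v size_s leq_addr.
have -> : compatible s v = compatible (nseq c a ++ s') (take c v ++ drop c v).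
  by rewrite cat_take_drop -eq_s.
rewrite /compatible zip_cat ?size_nseq ?size_take_v //.
set v1 := take c v; set z := zip s' _.
have -> : sorted ltn v1 = sorted (fun p q : nat * nat => (p.1 == q.1) ==> (p.2 < q.2)%N) (zip
    (nseq c a) v1).
  rewrite -{}size_take_v -/v1; case: v1 => //= x v1; elim: v1 x => //= y v1 IHv x.
  by rewrite eqxx IHv.
set e := fun p q : nat * nat => _; have z_gt p : p \in z -> p.1 != a.
  move=> p_z; have := map_f fst p_z.
  by rewrite -/(unzip1 z) unzip1_zip ?size_drop_v // mem_filter => /andP[].
have z0_eq p : p \in zip (nseq c a) v1 -> p.1 = a.
  move=> /(map_f fst); rewrite -/(unzip1 _) unzip1_zip ?size_nseq ?size_take_v //.
  by rewrite mem_nseq => /andP[_ /eqP].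
case: (zip (nseq c a) v1) z0_eq => //= p t z0_eq; rewrite cat_path; congr (_ && _).
case: z z_gt => //= q z z_gt; rewrite /e (z0_eq (last p t)) ?mem_last //.
by rewrite eq_sym (negbTE (z_gt q (mem_head _ _))).
Qed.

Lemma sumn_exponents (M : nat) (s : seq nat) : all (gtn M) s ->
  sumn (exponents M s) = size s.
Proof.
move=> lt_s; rewrite /exponents sumnE big_map -sum1_size.
under eq_bigr do rewrite -sum1_count big_mkcond.
rewrite exchange_big /= big_seq [RHS]big_seq; apply: eq_bigr => x /(allP lt_s) /= lt_x.
rewrite (bigD1_seq x) ?iota_uniq ?mem_iota //= eqxx big1 ?addn0 // => a.
by rewrite eq_sym => /negbTE ->.
Qed.

Lemma nth_map_ord (T : Type) (x0 : T) (n i : nat) (g : 'I_n -> T) (lt_i : (i < n)%N) :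
  nth x0 [seq g a | a <- enum 'I_n] i = g (Ordinal lt_i).
Proof.
rewrite (nth_map (Ordinal lt_i)) ?size_enum_ord //; congr g.
exact: (nth_ord_enum _ (Ordinal lt_i)).
Qed.

(** An index sequence with product [m] is weakly increasing, hence equal to [s]; the coefficient is
    therefore 0 or 1. *)
Lemma fund_quasisym_coef (n : nat) (sigma : n.-1.-tuple bool) (m : {mset nat}%mset) (s : seq nat) :
  sorted leq s -> perm_eq s (enum_mset m) ->
  fund_quasisym sigma m = ((size s == n) &&
    [forall j : 'I_n.-1, (nth 0 s j == nth 0 s j.+1) ==> tnth sigma j])%N%:R.
Proof.
move=> srt perm_s; rewrite /fund_quasisym /gen_series.
set A := [set f | _].
have AP (f : {ffun 'I_n -> finsupp m}) : f \in A ->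
    [seq val (f a) | a <- enum 'I_n] = s /\
    (forall a b : 'I_n, val b = a.+1 -> val (f a) == val (f b) -> nth true sigma a).
  rewrite inE seq_mset_perm => /andP[/forallP incr].
  rewrite -[image_mem _ _]/[seq val (f a) | a <- enum 'I_n] => perm_f.
  have incr2 (a b : 'I_n) : val b = a.+1 ->
      (val (f a) <= val (f b))%N && ((val (f a) == val (f b)) ==> nth true sigma a).
    by move=> e; have /forallP/(_ b)/implyP := incr a; rewrite e eqxx => /(_ isT).
  split=> [|a b e eq_f]; last by case/andP: (incr2 a b e) => _ /implyP; apply.
  apply: (sorted_eq leq_trans anti_leq) => //; last first.
    by apply: perm_trans perm_f _; rewrite perm_sym.
  apply/(sortedP 0%N) => i; rewrite size_map size_enum_ord => lt_i.
  have lt_i' := ltnW lt_i.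
  rewrite (nth_map_ord _ (fun a => val (f a)) lt_i') (nth_map_ord _ (fun a => val (f a)) lt_i).
  by case/andP: (incr2 (Ordinal lt_i') (Ordinal lt_i) erefl).
have nth_f (f : {ffun 'I_n -> finsupp m}) (a : 'I_n) : f \in A -> val (f a) = nth 0%N s a.
  by case/AP=> <- _; case: a => a lt_a; rewrite (nth_map_ord _ (fun a => val (f a)) lt_a).
have le1 : (#|A| <= 1)%N.
  apply/card_le1_eqP => f g fA gA; apply/ffunP => a; apply: val_inj.
  by rewrite /= (nth_f f) // (nth_f g).
congr _%:R; case: andP => [[/eqP size_s /forallP comp]|no]; last first.
  apply/eqP; rewrite cards_eq0 -subset0; apply/subsetP => f fA; case: no.
  have [e h] := AP f fA; have size_s : size s = n by rewrite -e size_map size_enum_ord.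
  split; first exact/eqP; apply/forallP => j; apply/implyP => ej.
  have lt_j : (j.+1 < n)%N by have := ltn_ord j; lia.
  rewrite (tnth_nth true); apply: (h (Ordinal (ltnW lt_j)) (Ordinal lt_j) erefl).
  by rewrite (nth_f f) // (nth_f f).
apply/eqP; rewrite eqn_leq le1 /=; apply/card_gt0P.
have mem_s (a : 'I_n) : nth 0%N s a \in finsupp m.
  by rewrite mem_finsupp_mset -(perm_mem perm_s) mem_nth ?size_s.
exists [ffun a => [` mem_s a]%fset]; rewrite inE seq_mset_perm; apply/andP; split.
  apply/forallP => a; apply/forallP => b; apply/implyP => /eqP e; rewrite !ffunE /=.
  have lt_a : (a < n.-1)%N by have := ltn_ord b; rewrite e; lia.
  have := comp (Ordinal lt_a); rewrite (tnth_nth true) e /= => ->; rewrite andbT.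
  by apply: (@sorted_leq_nth _ leq leq_trans leqnn 0%N s srt a a.+1); rewrite ?inE ?size_s // -?e
      ltn_ord.
suff e : [seq val ([ffun a => [` mem_s a]%fset] a0 : finsupp m) | a0 <- enum 'I_n] = s.
  by move: perm_s; rewrite -{1}e.
apply: (@eq_from_nth _ 0%N); rewrite size_map size_enum_ord ?size_s // => i lt_i.
by rewrite (nth_map_ord _ (fun a => val (_ a)) lt_i) ffunE.
Qed.

(** * Content words and their signatures *)

Section ContentWord.

Variables (k : nat) (nu : k.-tuple skew_shape).

Notation cell := (cell nu).
Notation sc := (@shifted_content k nu).
Notation n := (ncells nu).

Lemma reading_le_total : total (@reading_le k nu).
Proof.
by move=> x y; rewrite /reading_le; case: ltgtP => //= _; apply: leq_total.
Qed.

Lemma reading_le_trans : transitive (@reading_le k nu).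
Proof.
move=> y x z; rewrite /reading_le.
case/orP=> [lt_xy|/andP[/eqP e le_xy]]; case/orP=> [lt_yz|/andP[/eqP e' le_yz]].
- by rewrite (lt_trans lt_xy).
- by rewrite -e' lt_xy.
- by rewrite e lt_yz.
- by rewrite e e' eqxx (leq_trans le_xy) ?orbT.
Qed.

Variable T : filling nu.
Hypothesis SYT_T : SYT T.

Lemma SYT_inj : injective T.
Proof. by move: SYT_T; rewrite SYT_prec => /andP[/injectiveP]. Qed.

Lemma SYT_lt (x y : cell) : prec x y -> (T x < T y)%N.
Proof.
by move: SYT_T; rewrite SYT_prec => /andP[_ /forallP/(_ x)/forallP/(_ y)/implyP].
Qed.

(** In a standard filling the entries increase along a diagonal, through a corner between its cells,
    so ties of content may be broken by entry instead of row. *)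
Lemma index_content_word (x y : cell) :
  (index (entry T x) (content_word T) < index (entry T y) (content_word T))%N =
  (sc x < sc y) || ((sc x == sc y) && (T x < T y)%N).
Proof.
have inj_e : injective (entry T) by move=> a b [/val_inj /SYT_inj].
rewrite /content_word !index_map //; set s := sort _ _.
have srt : sorted (@reading_le k nu) s by apply: sort_sorted; apply: reading_le_total.
have mem_s z : z \in s by rewrite mem_sort mem_enum.
have sc_lt_T a b : sc a = sc b -> (cell_row a < cell_row b)%N -> (T a < T b)%N.
  move=> e lt_row; have [w [_ [_ aw wb _ _]]] := sc_eq_prec e lt_row.
  exact: ltn_trans (SYT_lt aw) (SYT_lt wb).
have imp a b : (index a s < index b s)%N -> (sc a < sc b) || ((sc a == sc b) && (T a < T b)%N).
  move=> lt_ab; have := sorted_ltn_index reading_le_trans srt a b (mem_s a) (mem_s b) lt_ab.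
  rewrite /reading_le; case/orP=> [->//|/andP[/eqP e]]; rewrite e eqxx /= leq_eqVlt.
  case/predU1P=> [e_row|/(sc_lt_T _ _ e) ->]; last by rewrite orbT.
  have ab : a = b by case/sc_eq: e => e_comp diag; apply: cell_eq => //; lia.
  by rewrite ab ltnn in lt_ab.
apply/idP/idP => [/imp //|lt_xy]; rewrite ltnNge leq_eqVlt; apply/negP => /orP[/eqP e|/imp].
  have e_yx : y = x by rewrite -(nth_index x (mem_s y)) e nth_index.
  by move: lt_xy; rewrite e_yx ltxx ltnn andbF.
case/orP: lt_xy => [lt_xy|/andP[/eqP -> lt_T]].
  by rewrite lt_gtF // gt_eqF.
by rewrite ltxx eqxx /= ltnNge (ltnW lt_T).
Qed.

Lemma nth_letters (i : 'I_n) : nth 0%N (letters T) i = letter (cell_at T i).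
Proof. by case: i => i lt_i; rewrite (nth_map_ord _ (fun i => letter (cell_at T i)) lt_i). Qed.

Lemma entry_cell_at (i : 'I_n) : entry T (cell_at T i) = i.+1.
Proof. by rewrite /entry (cell_atKV SYT_inj). Qed.

Lemma index_letters (i j : 'I_n) :
  (index i.+1 (content_word T) < index j.+1 (content_word T))%N =
  (nth 0%N (letters T) i < nth 0%N (letters T) j)%N
  || (nth 0%N (letters T) i == nth 0%N (letters T) j) && (i < j)%N.
Proof.
have := index_content_word (cell_at T i) (cell_at T j).
by rewrite !entry_cell_at !(cell_atKV SYT_inj) !nth_letters letter_lt letter_eq.
Qed.

(** Two cells on one diagonal have a cell between them whose entry is strictly between theirs, so
    their entries are not consecutive. Hence a sign of the signature is a strict comparison of
    adjacent letters. *)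
Lemma letters_step (i j : 'I_n) : val j = i.+1 ->
  nth 0%N (letters T) i != nth 0%N (letters T) j.
Proof.
move=> /= e_ij; rewrite !nth_letters letter_eq; apply/eqP => e.
have far x y : sc x = sc y -> (cell_row x < cell_row y)%N -> ((T x).+1 < T y)%N.
  move=> e' lt_row; have [w [_ [_ xw wy _ _]]] := sc_eq_prec e' lt_row.
  exact: leq_ltn_trans (SYT_lt xw) (SYT_lt wy).
have [lt|lt|e_row] := ltngtP (cell_row (cell_at T i)) (cell_row (cell_at T j)).
- by have := far _ _ e lt; rewrite !(cell_atKV SYT_inj); lia.
- by have := far _ _ (esym e) lt; rewrite !(cell_atKV SYT_inj); lia.
have e' : cell_at T i = cell_at T j.
  by case/sc_eq: e => e_comp diag; apply: cell_eq => //; lia.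
by have := congr1 T e'; rewrite !(cell_atKV SYT_inj) => /(congr1 val) /=; lia.
Qed.

Lemma compatible_signature (s : seq nat) : size s = n ->
  [forall j : 'I_n.-1, (nth 0%N s j == nth 0%N s j.+1) ==>
    tnth (signature n (content_word T)) j] = compatible s (letters T).
Proof.
move=> size_s; have size_z : size (zip s (letters T)) = n.
  by rewrite size_zip size_s size_letters minnn.
have sigE (i j : 'I_n) (jj : 'I_n.-1) : val i = jj -> val j = jj.+1 ->
    tnth (signature n (content_word T)) jj = (nth 0%N (letters T) i < nth 0%N (letters T) j)%N.
  move=> /= e_i e_j; rewrite tnth_mktuple; have := index_letters i j.
  rewrite e_i e_j => ->; have := @letters_step i j; rewrite /= e_i e_j.
  by move=> /(_ erefl) /negbTE ->; rewrite orbF.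
apply/forallP/(sortedP (0%N, 0%N)) => [h i|h jj]; rewrite ?size_z.
  move=> lt_i; have lt_i' : (i < n.-1)%N by lia.
  have := h (Ordinal lt_i').
  rewrite (sigE (Ordinal (ltnW lt_i)) (Ordinal lt_i)) // !nth_zip ?size_s ?size_letters //.
have lt_j : (jj.+1 < n)%N by have := ltn_ord jj; lia.
rewrite (sigE (Ordinal (ltnW lt_j)) (Ordinal lt_j)) //.
by have := h jj; rewrite size_z lt_j !nth_zip ?size_s ?size_letters //; apply.
Qed.

End ContentWord.

Lemma LLT_coef (k : nat) (nu : k.-tuple skew_shape) (m : {mset nat}%mset) (s : seq nat) (M : nat) :
  sorted leq s -> perm_eq s (enum_mset m) -> all (gtn M) s ->
  LLT nu m = word_coef nu (exponents M s).
Proof.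
move=> srt perm_s lt_s; rewrite /LLT fct_sumE word_coefE [RHS]big_mkcondr.
apply: eq_bigr => T SYT_T; rewrite scalrfctE (fund_quasisym_coef _ srt perm_s).
rewrite sumn_exponents //; have [size_s|ne] := eqVneq (size s) (ncells nu); last first.
  by rewrite scaler0.
rewrite compatible_signature // /exponents sorted_blocks //; last by rewrite size_letters.
by case: compatible; rewrite ?scaler0 //= /GRing.scale /= mulr1.
Qed.

(** * Standardization of semistandard fillings *)

Section Standardization.

Variables (k : nat) (nu : k.-tuple skew_shape).

Notation cell := (cell nu).
Notation sc := (@shifted_content k nu).
Notation n := (ncells nu).

Definition semistandard (F : cell -> nat) : bool :=
  [forall x, forall y, (cell_comp x == cell_comp y) ==>
    ((cell_row x == cell_row y) && (cell_col x < cell_col y)%N ==> (F x <= F y)%N)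
 && ((cell_col x == cell_col y) && (cell_row x < cell_row y)%N ==> (F x < F y)%N)].

(** Equal entries of a semistandard filling form a horizontal strip, whose cells are taken in
    increasing order of shifted content. *)
Definition std_lt (F : cell -> nat) (x y : cell) : bool :=
  (F x < F y)%N || ((F x == F y) && (sc x < sc y)).

Lemma std_lt_irr (F : cell -> nat) (x : cell) : std_lt F x x = false.
Proof. by rewrite /std_lt ltnn ltxx andbF. Qed.

Lemma std_lt_trans (F : cell -> nat) : transitive (std_lt F).
Proof.
move=> y x z; rewrite /std_lt.
case/orP=> [lt_xy|/andP[/eqP e lt_xy]]; case/orP=> [lt_yz|/andP[/eqP e' lt_yz]].
- by rewrite (ltn_trans lt_xy).
- by rewrite -e' lt_xy.
- by rewrite e lt_yz.
- by rewrite e e' eqxx (lt_trans lt_xy) ?orbT.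
Qed.

Lemma sc_row (x y : cell) : cell_comp x = cell_comp y -> cell_row x = cell_row y ->
  (cell_col x < cell_col y)%N -> sc x < sc y.
Proof.
move=> e e_row lt_col; rewrite !scE e e_row ltrD2r.
have k_gt0 : 0 < k%:Z by have := ltn_ord (cell_comp y); lia.
by rewrite (ltr_pM2l k_gt0); lia.
Qed.

Lemma sc_col (x y : cell) : cell_comp x = cell_comp y -> cell_col x = cell_col y ->
  (cell_row x < cell_row y)%N -> sc y < sc x.
Proof.
move=> e e_col lt_row; rewrite !scE e e_col ltrD2r.
have k_gt0 : 0 < k%:Z by have := ltn_ord (cell_comp y); lia.
by rewrite (ltr_pM2l k_gt0); lia.
Qed.

Lemma semistandard_prec (F : cell -> nat) (x y : cell) :
  semistandard F -> prec x y -> std_lt F x y.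
Proof.
move=> /forallP/(_ x)/forallP/(_ y)/implyP ssF /andP[e_comp].
case/andP: (ssF e_comp) => /implyP row /implyP col.
case/orP=> [cond|/col]; last by rewrite /std_lt => ->.
case/andP: (cond) => /eqP e_row lt_col.
by rewrite /std_lt (sc_row (eqP e_comp) e_row lt_col) andbT orbC -leq_eqVlt row.
Qed.

(** Cells of equal content lie on one diagonal; going through a corner, a weak row step and a strict
    column step make their values distinct. *)
Lemma semistandard_total (F : cell -> nat) (x y : cell) :
  semistandard F -> x != y -> std_lt F x y || std_lt F y x.
Proof.
move=> ssF ne_xy; rewrite /std_lt; have [//|//|e_F] := ltngtP (F x) (F y).
have [//|//|e] := ltgtP (sc x) (sc y).
have diag a b : sc a = sc b -> F a = F b -> (cell_row a < cell_row b)%N -> False.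
  move=> e' e_F' lt_row; have [e_comp e_diag] := sc_eq e'.
  have lt_col : (cell_col a < cell_col b)%N by lia.
  have [||w [c1 r1 d1]] := @cell_rect _ _ a b (cell_row a) (cell_col b) e_comp.
  - by rewrite leqnn ltnW.
  - by rewrite leqnn ltnW.
  have /forallP/(_ a)/forallP/(_ w) := ssF; rewrite c1 r1 d1 !eqxx lt_col /= => /andP[le_aw _].
  have /forallP/(_ w)/forallP/(_ b) := ssF; rewrite c1 r1 d1 e_comp !eqxx lt_row /= => /andP[_].
  by rewrite -e_F' ltnNge le_aw.
have [lt|lt|e_row] := ltngtP (cell_row x) (cell_row y).
- by case: (diag _ _ e e_F lt).
- by case: (diag _ _ (esym e) (esym e_F) lt).
case/eqP: ne_xy; case/sc_eq: e => e_comp e_diag; apply: cell_eq => //; lia.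
Qed.

Lemma std_rank_lt (F : cell -> nat) (x : cell) : (#|[pred y | std_lt F y x]| < n)%N.
Proof.
rewrite /ncells; apply: proper_card; apply/properP; split; first exact/subsetP.
by exists x => //; rewrite inE std_lt_irr.
Qed.

Definition standardize (F : cell -> nat) : filling nu := [ffun x => Ordinal (std_rank_lt F x)].

Lemma standardize_lt (F : cell -> nat) (x y : cell) : semistandard F ->
  (standardize F x < standardize F y)%N = std_lt F x y.
Proof.
move=> ssF; rewrite !ffunE /=.
have mono a b : std_lt F a b -> (#|[pred y | std_lt F y a]| < #|[pred y | std_lt F y b]|)%N.
  move=> ab; apply: proper_card; apply/properP; split.
    by apply/subsetP => z; rewrite !inE => /std_lt_trans; apply.
  by exists a; rewrite !inE ?std_lt_irr.
apply/idP/idP => [lt_xy|]; last exact: mono.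
have [e|ne] := eqVneq x y; first by rewrite e ltnn in lt_xy.
have /orP[//|/mono] := semistandard_total ssF ne.
by rewrite ltnNge (ltnW lt_xy).
Qed.

Lemma standardize_inj (F : cell -> nat) : semistandard F -> injective (standardize F).
Proof.
move=> ssF x y e; apply/eqP/negPn/negP => ne.
by have := semistandard_total ssF ne; rewrite -!standardize_lt // e ltnn.
Qed.

Lemma standardize_SYT (F : cell -> nat) : semistandard F -> SYT (standardize F).
Proof.
move=> ssF; rewrite SYT_prec; apply/andP; split; first exact/injectiveP/standardize_inj.
apply/forallP => x; apply/forallP => y; apply/implyP => xy.
by rewrite standardize_lt // semistandard_prec.
Qed.

Lemma perm_cells (T : filling nu) : injective T ->
  perm_eq [seq cell_at T i | i <- enum 'I_n] (enum cell).
Proof.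
move=> inj; apply: uniq_perm; rewrite ?enum_uniq //.
  by rewrite map_inj_uniq ?enum_uniq //; apply: can_inj (cell_atKV inj).
move=> x; rewrite mem_enum; apply/mapP; exists (T x); rewrite ?mem_enum //.
by rewrite cell_atK.
Qed.

Variable s : seq nat.
Hypothesis s_sorted : sorted leq s.

Lemma standardize_nth (F : cell -> nat) (x : cell) : semistandard F ->
  perm_eq s [seq F x | x <- enum cell] -> F x = nth 0%N s (standardize F x).
Proof.
move=> ssF perm_s; set T := standardize F.
have inj : injective T := standardize_inj ssF.
have -> : s = [seq F (cell_at T i) | i <- enum 'I_n].
  apply: (sorted_eq leq_trans anti_leq) => //; last first.
    apply: perm_trans perm_s _; rewrite perm_sym (map_comp F).
    by apply: perm_map; apply: perm_cells.
  apply/(sortedP 0%N) => i; rewrite size_map size_enum_ord => lt_i.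
  rewrite (nth_map_ord _ (fun i => F (cell_at T i)) (ltnW lt_i)).
  rewrite (nth_map_ord _ (fun i => F (cell_at T i)) lt_i).
  have : std_lt F (cell_at T (Ordinal (ltnW lt_i))) (cell_at T (Ordinal lt_i)).
    by rewrite -standardize_lt // !(cell_atKV inj) /=.
  by case/orP => [/ltnW //|/andP[/eqP -> _]].
case: (T x) (cell_atK inj x) => i lt_i.
by rewrite (nth_map_ord _ (fun i => F (cell_at T i)) lt_i) => ->.
Qed.

Hypothesis size_s : size s = n.

Lemma standardize_compatible (F : cell -> nat) : semistandard F ->
  perm_eq s [seq F x | x <- enum cell] -> compatible s (letters (standardize F)).
Proof.
move=> ssF perm_s; have inj := standardize_inj ssF.
have size_z : size (zip s (letters (standardize F))) = n.
  by rewrite size_zip size_s size_letters minnn.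
apply/(sortedP (0%N, 0%N)) => i; rewrite size_z => lt_i.
rewrite !nth_zip ?size_s ?size_letters //=; apply/implyP => e_s.
have lt_i' := ltnW lt_i.
have -> : nth 0%N (letters (standardize F)) i = nth 0%N (letters (standardize F)) (Ordinal lt_i')
    by [].
have -> : nth 0%N (letters (standardize F)) i.+1 = nth 0%N (letters (standardize F)) (Ordinal
    lt_i) by [].
rewrite !nth_letters letter_lt.
set x := cell_at _ _; set y := cell_at _ _.
have : std_lt F x y by rewrite -standardize_lt // !(cell_atKV inj) /=.
rewrite /std_lt [F x](standardize_nth _ ssF perm_s) [F y](standardize_nth _ ssF perm_s).
by rewrite !(cell_atKV inj) (eqP e_s) ltnn => /andP[].
Qed.

Section Unstandardize.

Variable T : filling nu.
Hypothesis SYT_T : SYT T.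
Hypothesis comp_T : compatible s (letters T).

Let F (x : cell) : nat := nth 0%N s (T x).

Lemma compatible_lt (i j : nat) : (i < j < n)%N -> nth 0%N s i = nth 0%N s j ->
  (nth 0%N (letters T) i < nth 0%N (letters T) j)%N.
Proof.
have size_z : size (zip s (letters T)) = n by rewrite size_zip size_s size_letters minnn.
have le_s a b : (a <= b < n)%N -> (nth 0 s a <= nth 0 s b)%N.
  case/andP=> le_ab lt_b.
  by apply: (@sorted_leq_nth _ leq leq_trans leqnn 0%N s s_sorted a b); rewrite ?inE ?size_s //;
      lia.
have step a : (a.+1 < n)%N -> nth 0%N s a = nth 0%N s a.+1 ->
    (nth 0%N (letters T) a < nth 0%N (letters T) a.+1)%N.
  move=> lt_a e; have /(sortedP (0%N, 0%N))/(_ a) := comp_T; rewrite size_z => /(_ lt_a).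
  by rewrite !nth_zip ?size_s ?size_letters //= e eqxx.
elim: j => // j IHj /andP[lt_ij lt_j] e.
have le1 := le_s i j ltac:(lia); have le2 := le_s j j.+1 ltac:(lia).
have e_j : nth 0%N s j = nth 0%N s j.+1 by lia.
move: lt_ij; rewrite ltnS leq_eqVlt => /predU1P[->|lt_ij]; first exact: step.
by apply: ltn_trans (IHj _ _) (step _ lt_j e_j); lia.
Qed.

Lemma filling_std_lt (x y : cell) : (T x < T y)%N -> std_lt F x y.
Proof.
move=> lt_xy; have inj := SYT_inj SYT_T.
have le_F : (F x <= F y)%N.
  apply: (@sorted_leq_nth _ leq leq_trans leqnn 0%N s s_sorted (T x) (T y)).
  - by rewrite inE size_s.
  - by rewrite inE size_s.
  - exact: ltnW.
rewrite /std_lt; move: le_F; rewrite leq_eqVlt => /predU1P[e|-> //].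
have := compatible_lt (i := T x) (j := T y); rewrite lt_xy ltn_ord => /(_ isT e).
by rewrite !nth_letters !(cell_atK inj) letter_lt e eqxx => ->; rewrite orbT.
Qed.

Lemma unstandardize_semistandard : semistandard F.
Proof.
apply/forallP => x; apply/forallP => y; apply/implyP => e_comp; apply/andP; split; apply/implyP.
  case/andP=> e_row lt_col; have : std_lt F x y.
    by apply: filling_std_lt; apply: SYT_lt; rewrite // /prec e_comp e_row lt_col.
  by case/orP => [/ltnW //|/andP[/eqP ->]].
case/andP=> e_col lt_row; have : std_lt F x y.
  by apply: filling_std_lt; apply: SYT_lt; rewrite // /prec e_comp e_col lt_row orbT.
case/orP => // /andP[_]; rewrite ltNge ltW //.
by apply: sc_col => //; apply/eqP.
Qed.

Lemma unstandardizeK : standardize F = T.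
Proof.
apply/ffunP => x; rewrite ffunE; apply: val_inj => /=.
have inj := SYT_inj SYT_T.
have -> : #|[pred y | std_lt F y x]| = #|[pred y | (T y < T x)%N]|.
  apply: eq_card => y; rewrite !inE; apply/idP/idP => [lt_yx|]; last exact: filling_std_lt.
  rewrite ltnNge leq_eqVlt; apply/negP => /orP[/eqP/val_inj/inj e|/filling_std_lt lt_xy].
    by rewrite e std_lt_irr in lt_yx.
  by have := std_lt_trans lt_xy lt_yx; rewrite std_lt_irr.
have card_lt : #|[pred i : 'I_n | (i < T x)%N]| = T x.
  rewrite -[RHS]card_ord -(card_image (f := widen_ord (ltnW (ltn_ord (T x))))).
    apply: eq_card => i; rewrite inE; apply/idP/imageP => [lt_i|[j _ ->]]; last exact: (ltn_ord j).
    by exists (Ordinal lt_i) => //; apply: val_inj.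
  by move=> i j /(congr1 val) /= /val_inj.
rewrite -[RHS]card_lt -(card_image inj); apply: eq_card => i; rewrite inE.
apply/imageP/idP => [[y + ->]|lt_i]; first by rewrite inE.
by exists (cell_at T i); rewrite ?inE (cell_atKV inj).
Qed.

Lemma unstandardize_perm : perm_eq s [seq F x | x <- enum cell].
Proof.
have inj := SYT_inj SYT_T.
have -> : s = [seq F (cell_at T i) | i <- enum 'I_n].
  have e : size s = size [seq F (cell_at T i) | i <- enum 'I_n].
    by rewrite size_map size_enum_ord.
  apply: (eq_from_nth (x0 := 0%N) e); rewrite size_s => i lt_i.
  by rewrite (nth_map_ord _ (fun i => F (cell_at T i)) lt_i) /F (cell_atKV inj).
by rewrite (map_comp F); apply: perm_map; apply: perm_cells.
Qed.

End Unstandardize.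

(** Standardization is a bijection between the two sets; its inverse replaces the entry of rank [i]
    by the [i]-th term of [s]. *)
Lemma card_semistandard (m : {mset nat}%mset) : perm_eq s (enum_mset m) ->
  #|[set f : {ffun cell -> finsupp m} | semistandard (fun x => val (f x))
      && perm_eq [seq val (f x) | x <- enum cell] (enum_mset m)]| =
  #|[set T : filling nu | SYT T && compatible s (letters T)]|.
Proof.
move=> perm_s; set A := [set f | _]; set B := [set T | _].
have AP (f : {ffun cell -> finsupp m}) : f \in A ->
    semistandard (fun x => val (f x)) /\ perm_eq s [seq val (f x) | x <- enum cell].
  rewrite inE => /andP[ss perm_f]; split=> //.
  by apply: perm_trans perm_s _; rewrite perm_sym.
pose phi (f : {ffun cell -> finsupp m}) := standardize (fun x => val (f x)).
have <- : phi @: A = B.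
  apply/setP => T; rewrite inE; apply/imsetP/andP => [[f /AP[ss perm_f] ->]|[SYT_T comp_T]].
    by split; [apply: standardize_SYT | apply: standardize_compatible].
  have mem_s x : nth 0%N s (T x) \in finsupp m.
    by rewrite mem_finsupp_mset -(perm_mem perm_s) mem_nth ?size_s.
  pose f : {ffun cell -> finsupp m} := [ffun x => [` mem_s x]%fset].
  have fE : (fun x => val (f x)) =1 (fun x => nth 0%N s (T x)) by move=> x; rewrite ffunE.
  have std_eq F G : F =1 G -> standardize F = standardize G.
    move=> FG; apply/ffunP => x; rewrite !ffunE; apply: val_inj => /=.
    by apply: eq_card => y; rewrite !inE /std_lt !FG.
  exists f; last by rewrite /phi (std_eq _ _ fE) unstandardizeK.
  rewrite inE; apply/andP; split.
    have := unstandardize_semistandard SYT_T comp_T; congr is_true.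
    by apply: eq_forallb => x; apply: eq_forallb => y; rewrite !fE.
  rewrite (eq_map fE); apply: perm_trans perm_s; rewrite perm_sym.
  exact: unstandardize_perm.
rewrite card_in_imset // => f g /AP[ssf permf] /AP[ssg permg] e.
apply/ffunP => x; apply: val_inj.
by rewrite /= (standardize_nth x ssf permf) (standardize_nth x ssg permg) -/(phi f) e.
Qed.

End Standardization.

(** * Straight shapes *)

(** Makes [straight] a function of arbitrary lists, so that it can stand under sums over
    [partitions n]. *)
Definition part_or_nil (la : seq nat) : seq nat := if is_part la then la else [::].

Lemma part_or_nilP (la : seq nat) : is_part (part_or_nil la).
Proof. by rewrite /part_or_nil; case: ifP. Qed.

Lemma nil_sub (la : seq nat) (r : nat) : (nth 0 [::] r <= nth 0 la r)%N.
Proof. by rewrite nth_nil. Qed.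

Definition straight (la : seq nat) : 1.-tuple skew_shape :=
  [tuple @SkewShape (part_or_nil la) [::] (part_or_nilP la) isT (nil_sub _)].

Section Straight.

Variable la : seq nat.
Hypothesis la_part : is_part la.

Notation nu := (straight la).
Notation cell := (cell nu).
Notation n := (ncells nu).

Lemma straight_cells : cells nu = [seq (ord0, x) | x <- diagram la [::]].
Proof.
rewrite /cells enum_ordSl enum_ord0 /= cats0.
by rewrite /part_or_nil la_part.
Qed.

Lemma mem_straight (p : 'I_1 * (nat * nat)) : (p \in cells nu) = (p.2 \in diagram la [::]).
Proof.
rewrite straight_cells; apply/mapP/idP => [[x x_in ->] //|p_in].
exists p.2 => //; case: p {p_in} => i x /=; congr (_, _).
by apply: val_inj; case: i => [[]].
Qed.

Lemma cell_diagram (x : cell) : (val x).2 \in diagram la [::].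
Proof. by rewrite -mem_straight; apply: valP. Qed.

Lemma diagram_cell (d : seq_sub (diagram la [::])) : (ord0, val d) \in cells nu.
Proof. by rewrite mem_straight; apply: valP. Qed.

Definition to_diagram (x : cell) : seq_sub (diagram la [::]) := SeqSub (cell_diagram x).
Definition of_diagram (d : seq_sub (diagram la [::])) : cell := SeqSub (diagram_cell d).

Lemma to_diagramK : cancel to_diagram of_diagram.
Proof.
move=> x; apply: val_inj; rewrite /= [RHS]surjective_pairing; congr (_, _).
by apply: val_inj; case: (val x).1 => [[]].
Qed.

Lemma of_diagramK : cancel of_diagram to_diagram.
Proof. by move=> d; apply: val_inj. Qed.

Lemma diagram_uniq (mu : seq nat) : uniq (diagram mu [::]).
Proof.
rewrite diagramE; apply: allpairs_uniq_dep; rewrite ?iota_uniq //.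
  by move=> *; apply: iota_uniq.
by move=> [r c] [r' c'] _ _ /= [-> ->].
Qed.

Lemma size_diagram (mu : seq nat) : size (diagram mu [::]) = sumn mu.
Proof.
rewrite diagramE size_allpairs_dep; congr sumn.
under eq_map do rewrite size_iota nth_nil subn0.
by rewrite map_nth_iota0 // take_size.
Qed.

Lemma ncells_straight : n = sumn la.
Proof.
rewrite -size_diagram -(card_seq_sub (diagram_uniq la)); apply/eqP; rewrite eqn_leq.
by rewrite (leq_card _ (can_inj to_diagramK)) (leq_card _ (can_inj of_diagramK)).
Qed.

Lemma straight_comp (x y : cell) : cell_comp x = cell_comp y.
Proof. by apply: val_inj; case: (cell_comp x) (cell_comp y) => [[|//] ?] [[|//] ?]. Qed.

Lemma straight_inv (T : filling nu) : inv_k T = 0%N.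
Proof.
apply/eqP; rewrite cards_eq0 -subset0; apply/subsetP => -[x y]; rewrite !inE /=.
by move=> /andP[near _]; exfalso; move: near; lia.
Qed.

Lemma straight_spread : four_spread nu.
Proof. by move=> w c y x; lia. Qed.

(** Semistandard tableaux with monomial [m] standardize to the compatible standard fillings; for
    [k = 1] there are no inversions, so each has weight 1. *)
Lemma schur_coef (m : {mset nat}%mset) (s : seq nat) (M : nat) :
  sorted leq s -> perm_eq s (enum_mset m) -> all (gtn M) s ->
  schur la m = word_coef nu (exponents M s).
Proof.
move=> srt perm_s lt_s; rewrite word_coefE sumn_exponents // /schur /gen_series.
have card_D : #|{: seq_sub (diagram la [::])}| = n.
  by rewrite (card_seq_sub (diagram_uniq la)) size_diagram ncells_straight.
have [size_s|ne] := eqVneq (size s) n; last first.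
  rewrite [RHS]big1 => [|T]; last by rewrite andbF.
  rewrite [X in X%:R](_ : _ = 0%N) //; apply/eqP; rewrite cards_eq0 -subset0; apply/subsetP => f;
      rewrite inE.
  case/andP=> _; rewrite seq_mset_perm => /perm_size; rewrite -(perm_size perm_s).
  by rewrite size_image card_D => e; rewrite e eqxx in ne.
transitivity (#|[set T : filling nu | SYT T && compatible s (letters T)]|%:R : {poly int}); last
    first.
  rewrite -sum1dep_card natr_sum; apply: eq_big => [T|T _]; last by rewrite straight_inv.
  by rewrite /exponents sorted_blocks // size_letters.
congr _%:R; rewrite -(card_semistandard srt size_s perm_s).
pose phi (f : {ffun seq_sub (diagram la [::]) -> finsupp m}) : {ffun cell -> finsupp m} :=
  [ffun x => f (to_diagram x)].
pose psi (f : {ffun cell -> finsupp m}) : {ffun seq_sub (diagram la [::]) -> finsupp m} :=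
  [ffun d => f (of_diagram d)].
have phiK : cancel phi psi by move=> f; apply/ffunP => d; rewrite !ffunE of_diagramK.
have psiK : cancel psi phi by move=> f; apply/ffunP => x; rewrite !ffunE to_diagramK.
rewrite -(card_imset _ (can_inj phiK)); apply: eq_card => f.
rewrite -{1}(psiK f) (mem_imset _ _ (can_inj phiK)) !inE seq_mset_perm; congr (_ && _).
  apply/forallP/forallP => [h x|h d]; apply/forallP => e.
    have /forallP/(_ (to_diagram e)) := h (to_diagram x).
    by rewrite !ffunE !to_diagramK (straight_comp x e) eqxx.
  have /forallP/(_ (of_diagram e)) := h (of_diagram d).
  by rewrite (straight_comp _ (of_diagram e)) eqxx !ffunE.
apply: permPl; rewrite [image_mem _ _](_ : _ =
    [seq val (f x) | x <- [seq of_diagram d | d <- enum {: seq_sub (diagram la [::])}]]).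
  apply: perm_map; apply: uniq_perm; rewrite ?enum_uniq //.
    by rewrite map_inj_uniq ?enum_uniq //; apply: can_inj of_diagramK.
  by move=> x; rewrite mem_enum; apply/mapP; exists (to_diagram x); rewrite ?mem_enum ?to_diagramK.
by rewrite -map_comp; apply: eq_map => d /=; rewrite ffunE.
Qed.

Lemma mem_straight_diagram (r c : nat) :
  reflect (exists x : cell, cell_row x = r /\ cell_col x = c) (c < nth 0 la r)%N.
Proof.
have -> : (c < nth 0 la r)%N = ((r, c) \in diagram la [::]) by rewrite mem_diagram nth_nil.
apply: (iffP idP) => [rc_in|[x [<- <-]]].
  by exists (of_diagram (SeqSub rc_in)).
by have := cell_diagram x; rewrite /cell_row /cell_col -surjective_pairing.
Qed.

Section Yamanouchi.

Variables (T : filling nu) (mu : seq nat).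
Hypothesis SYT_T : SYT T.
Hypothesis mu_sorted : sorted geq mu.
Hypothesis sum_mu : sumn mu = n.
Hypothesis yam_T : yam_word nu mu (letters T).

Let off (r : nat) : nat := sumn (take r mu).

Let offS (r : nat) : off r.+1 = (off r + nth 0 mu r)%N.
Proof. exact: sumn_takeS. Qed.

Let off_le (r : nat) : (off r <= n)%N.
Proof. by rewrite -sum_mu sumn_take_le. Qed.

Let off_lt (r c : nat) : (c < nth 0 mu r)%N -> (off r + c < n)%N.
Proof. by move=> lt_c; apply: leq_trans (off_le r.+1); rewrite offS -addnS leq_add2l. Qed.

Let mu_le (r r' : nat) : (r <= r')%N -> (nth 0 mu r' <= nth 0 mu r)%N.
Proof. exact: sorted_geq_nth. Qed.

Let row_letters (r : nat) :
  nth [::] (reshape mu (letters T)) r = take (nth 0 mu r) (drop (off r) (letters T)).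
Proof. exact: nth_reshape. Qed.

Let size_row (r : nat) : size (nth [::] (reshape mu (letters T)) r) = nth 0%N mu r.
Proof.
rewrite row_letters size_takel // size_drop size_letters.
by rewrite leq_subRL ?off_le // -offS off_le.
Qed.

Let nth_row (r c : nat) : (c < nth 0 mu r)%N ->
  nth 0%N (nth [::] (reshape mu (letters T)) r) c = nth 0%N (letters T) (off r + c).
Proof. by move=> lt_c; rewrite row_letters nth_take // nth_drop. Qed.

Let row_incr (r c c' : nat) : (c < c')%N -> (c' < nth 0 mu r)%N ->
  (nth 0 (letters T) (off r + c) < nth 0 (letters T) (off r + c'))%N.
Proof.
move=> lt_c lt_c'; case/andP: yam_T => /allP rows_incr _.
have lt_r : (r < size (reshape mu (letters T)))%N.
  rewrite ltnNge; apply/negP => /(nth_default [::]) e.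
  by have := size_row r; rewrite e /= => e0; rewrite -e0 in lt_c'.
have srt := rows_incr _ (mem_nth [::] lt_r).
rewrite -(nth_row lt_c') -nth_row; last exact: ltn_trans lt_c'.
apply: (@sorted_ltn_nth _ ltn ltn_trans 0%N _ srt c c') => //; rewrite inE size_row //.
exact: ltn_trans lt_c'.
Qed.

Let row_last (r : nat) : (0 < nth 0 mu r.+1)%N ->
  (nth 0 (letters T) (off r.+1 + (nth 0 mu r.+1).-1) < nth 0 (letters T) (off r + (nth 0 mu
      r).-1))%N.
Proof.
move=> mu_gt0; have mu_gt0' : (0 < nth 0 mu r)%N := leq_trans mu_gt0 (mu_le (leqnSn r)).
case/andP: yam_T => _ /allP ok.
have size_shape : size (reshape mu (letters T)) = size mu.
  have e : shape (reshape mu (letters T)) = mu by rewrite reshapeKl // size_letters sum_mu.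
  by rewrite -[in RHS]e size_map.
have lt_r : (r.+1 < size mu)%N.
  by rewrite ltnNge; apply/negP => /(nth_default 0%N) e; rewrite e in mu_gt0.
have m_gt0 : (0 < size (contents nu))%N.
  by apply: leq_ltn_trans (letter_size (cell_at T (Ordinal (off_lt mu_gt0)))).
have /allP/(_ r) := ok 0%N ltac:(by rewrite mem_iota); rewrite mem_iota size_map size_shape.
move=> /(_ ltac:(lia)); rewrite /pair_ok /col_ok !(nth_map [::]) ?size_shape ?(ltnW lt_r) //.
by rewrite !size_rev !size_row mu_gt0 mu_gt0' !nth_rev ?size_row // !subn1 !nth_row ?prednK.
Qed.

Let sc_letters (i j : 'I_n) :
  (nth 0 (letters T) i < nth 0 (letters T) j)%N -> 
  (cell_col (cell_at T i))%:Z - (cell_row (cell_at T i))%:Z <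
  (cell_col (cell_at T j))%:Z - (cell_row (cell_at T j))%:Z.
Proof.
rewrite !nth_letters letter_lt !scE !mul1r.
by rewrite (straight_comp (cell_at T i) (cell_at T j)); lia.
Qed.

(** Strong induction on the entry: the smaller ones occupy rows below [r], up to the lengths in
    [mu], and the first [c] cells of row [r]; comparing contents leaves only the cell [(r, c)]. *)
Lemma yam_cell (r c : nat) (lt_i : (off r + c < n)%N) : (c < nth 0 mu r)%N ->
  cell_row (cell_at T (Ordinal lt_i)) = r /\ cell_col (cell_at T (Ordinal lt_i)) = c.
Proof.
have inj := SYT_inj SYT_T.
have [i] := ubnP (off r + c); elim: i r c lt_i => // i IHi r c lt_i lt_rc lt_c.
set x := cell_at T _; have Tx : T x = Ordinal lt_i by apply: cell_atKV.
have before y : (T y < off r + c)%N -> exists r' c',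
    [/\ cell_row y = r', cell_col y = c', (c' < nth 0 mu r')%N & (off r' + c' < off r + c)%N].
  move=> lt_y; exists (reshape_index mu (T y)), (reshape_offset mu (T y)).
  have lt_Ty : (T y < sumn mu)%N by rewrite sum_mu.
  have eT : (off (reshape_index mu (T y)) + reshape_offset mu (T y) = T y)%N.
    exact: reshape_indexK.
  have lt_off := reshape_offsetP lt_Ty.
  have lt_n : (off (reshape_index mu (T y)) + reshape_offset mu (T y) < n)%N by rewrite eT.
  have [|e1 e2] := IHi _ _ lt_n _ lt_off; first by rewrite eT; lia.
  have ey : cell_at T (Ordinal lt_n) = y.
    by rewrite -[RHS](cell_atK inj); congr cell_at; apply: val_inj.
  by move: e1 e2; rewrite ey => -> ->; rewrite eT.
have off_mono a b : (a <= b)%N -> (off a <= off b)%N.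
  by move=> le_ab; rewrite -(subnKC le_ab); elim: (b - a)%N => [|d IHd];
    rewrite ?addn0 // addnS offS; apply: leq_trans IHd (leq_addr _ _).
have before_cell y : (T y < off r + c)%N ->
    (cell_row y < r)%N && (cell_col y < nth 0 mu (cell_row y))%N
    || (cell_row y == r) && (cell_col y < c)%N.
  move=> /before[r' [c' [-> -> lt_c' lt_off]]]; case: (ltngtP r' r) => //= [_|lt_r|e].
  - by rewrite lt_c'.
  - by have := off_mono _ _ lt_r; rewrite offS; lia.
  - by move: lt_off; rewrite e; lia.
have not_before y : cell_row y = cell_row x -> cell_col y = cell_col x -> ~~ (T y < off r + c)%N.
  move=> e1 e2; have -> : y = x by apply: cell_eq => //; apply: straight_comp.
  by rewrite Tx /= ltnn.
have sub_cell R C : (R <= cell_row x)%N -> (C <= cell_col x)%N ->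
    exists y : cell, cell_row y = R /\ cell_col y = C.
  move=> le_R le_C; apply/mem_straight_diagram; apply: leq_ltn_trans le_C _.
  apply: (@leq_trans (nth 0 la (cell_row x))%N); last exact: part_nth.
  by apply/mem_straight_diagram; exists x.
have prec_before y : prec y x -> (T y < off r + c)%N.
  by move=> /(SYT_lt SYT_T); rewrite Tx.
have earlier r' c' (lt_n : (off r' + c' < n)%N) :
    (off r' + c' < off r + c)%N -> (c' < nth 0 mu r')%N ->
    cell_row (cell_at T (Ordinal lt_n)) = r' /\ cell_col (cell_at T (Ordinal lt_n)) = c'.
  by move=> lt_off; apply: IHi; lia.
have new r' c' : (off r' + c' < off r + c)%N -> (c' < nth 0 mu r')%N ->
    cell_row x = r' -> cell_col x = c' -> False.
  move=> lt_off lt_c' e1 e2; have [e3 e4] := earlier r' c' (off_lt lt_c') lt_off lt_c'.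
  have := not_before _ (etrans e3 (esym e1)) (etrans e4 (esym e2)).
  by rewrite (cell_atKV inj) /= lt_off.
(* In an earlier row, [x] would lie beyond the filled part, with content above that of the last cell
   of row [r.-1]. But its letter is at most the last letter of array row [r], which is below the
   last letter of array row [r.-1]. *)
have row_ge : (r <= cell_row x)%N.
  rewrite leqNgt; apply/negP => lt_r.
  have ge_col : (nth 0 mu (cell_row x) <= cell_col x)%N.
    rewrite leqNgt; apply/negP => lt_col; apply: (new _ _ _ lt_col) => //.
    by have := off_mono _ _ lt_r; rewrite offS; lia.
  have r_gt0 : (0 < r)%N by lia.
  have le_mu : (nth 0 mu r.-1 <= nth 0 mu (cell_row x))%N by apply: mu_le; lia.
  have mu_gt0 : (0 < nth 0 mu r)%N by lia.
  have le_mu' : (nth 0 mu r <= nth 0 mu r.-1)%N by apply: mu_le; lia.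
  have lt_last : ((nth 0 mu r).-1 < nth 0 mu r)%N by rewrite prednK.
  have lt_last' : ((nth 0 mu r.-1).-1 < nth 0 mu r.-1)%N by lia.
  have lt_off' : (off r.-1 + (nth 0 mu r.-1).-1 < off r + c)%N.
    by have := offS r.-1; rewrite prednK // => ->; lia.
  have [e1 e2] := earlier _ _ (off_lt lt_last') lt_off' lt_last'.
  have := @row_last r.-1; rewrite prednK // => /(_ mu_gt0).
  move/(@sc_letters (Ordinal (off_lt lt_last)) (Ordinal (off_lt lt_last'))); rewrite e1 e2.
  have : (cell_col x)%:Z - (cell_row x)%:Z <=
    (cell_col (cell_at T (Ordinal (off_lt lt_last))))%:Z - (cell_row (cell_at T (Ordinal (off_lt
        lt_last))))%:Z.
    have [e|ne] := eqVneq c (nth 0%N mu r).-1.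
      have -> : Ordinal (off_lt lt_last) = Ordinal lt_i by apply: val_inj; rewrite /= e.
      exact: lexx.
    have lt_cl : (c < (nth 0 mu r).-1)%N by lia.
    by apply/ltW/(@sc_letters (Ordinal lt_i) (Ordinal (off_lt lt_last))); apply: row_incr.
  lia.
(* In a later row, the cell under [x] would already be filled, hence in row [r] and left of column
   [c]; then [x] would have smaller content than the preceding entry, in column [c.-1]. *)
have row_le : (cell_row x <= r)%N.
  rewrite leqNgt; apply/negP => lt_r.
  have [y [e1 e2]] := sub_cell (cell_row x).-1 (cell_col x) (leq_pred _) (leqnn _).
  have := prec_before y; rewrite /prec (straight_comp y x) e1 e2 !eqxx /=.
  rewrite prednK ?leqnn ?orbT; last by lia.
  move=> /(_ isT) /before_cell; rewrite e1 e2.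
  have -> : ((cell_row x).-1 < r)%N = false by lia.
  case/andP=> /eqP e_r lt_col.
  have lt_c1 : (c.-1 < c)%N by lia.
  have lt_n : (off r + c.-1 < n)%N by lia.
  have [|e3 e4] := earlier r c.-1 lt_n _ (ltn_trans lt_c1 lt_c); first by lia.
  have := @sc_letters (Ordinal lt_n) (Ordinal lt_i) (row_incr lt_c1 lt_c).
  by rewrite e3 e4 -/x; lia.
have row_eq : cell_row x = r by lia.
split=> //; apply/eqP; rewrite eqn_leq; apply/andP; split; rewrite leqNgt; apply/negP => lt_col.
  have [y [e1 e2]] := sub_cell r c row_ge (ltnW lt_col).
  have := prec_before y; rewrite /prec (straight_comp y x) e1 e2 row_eq !eqxx lt_col /=.
  by move=> /(_ isT) /before_cell; rewrite e1 e2 !ltnn andbF.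
by apply: (new r (cell_col x)) => //; lia.
Qed.

Lemma yam_shape (r : nat) : nth 0%N mu r = nth 0%N la r.
Proof.
have inj := SYT_inj SYT_T.
have sub1 R c : (c < nth 0 mu R)%N -> (c < nth 0 la R)%N.
  move=> lt_c; apply/mem_straight_diagram; exists (cell_at T (Ordinal (off_lt lt_c))).
  exact: yam_cell.
have sub2 R c : (c < nth 0 la R)%N -> (c < nth 0 mu R)%N.
  move=> /mem_straight_diagram[x [<- <-]].
  have lt_Tx : (T x < sumn mu)%N by rewrite sum_mu.
  have eT : (off (reshape_index mu (T x)) + reshape_offset mu (T x) = T x)%N.
    exact: reshape_indexK.
  have lt_off := reshape_offsetP lt_Tx.
  have lt_n : (off (reshape_index mu (T x)) + reshape_offset mu (T x) < n)%N by rewrite eT.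
  have [e1 e2] := yam_cell lt_n lt_off.
  have ex : cell_at T (Ordinal lt_n) = x.
    by rewrite -[RHS](cell_atK inj); congr cell_at; apply: val_inj.
  by rewrite -ex e1 e2.
apply/eqP; rewrite eqn_leq; apply/andP; split; rewrite leqNgt; apply/negP.
  by move/sub1; rewrite ltnn.
by move/sub2; rewrite ltnn.
Qed.

Lemma yam_entry (x : cell) : T x = (off (cell_row x) + cell_col x)%N :> nat.
Proof.
have lt_c : (cell_col x < nth 0 mu (cell_row x))%N.
  by rewrite yam_shape; apply/mem_straight_diagram; exists x.
have [e1 e2] := yam_cell (off_lt lt_c) lt_c.
have <- : cell_at T (Ordinal (off_lt lt_c)) = x.
  by apply: cell_eq => //; apply: straight_comp.
by rewrite (cell_atKV (SYT_inj SYT_T)) /= e1 e2.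
Qed.

End Yamanouchi.

End Straight.

Definition pad (l : nat) (la : seq nat) : seq nat := la ++ nseq (l - size la) 0%N.

Lemma size_pad (l : nat) (la : seq nat) : (size la <= l)%N -> size (pad l la) = l.
Proof. by move=> le_l; rewrite size_cat size_nseq subnKC. Qed.

Lemma sumn_pad (l : nat) (la : seq nat) : sumn (pad l la) = sumn la.
Proof. by rewrite sumn_cat sumn_nseq mul0n addn0. Qed.

Lemma nth_pad (l : nat) (la : seq nat) (r : nat) : nth 0%N (pad l la) r = nth 0%N la r.
Proof.
rewrite nth_cat nth_nseq; case: ltnP => // le_r; rewrite nth_default //.
by case: ifP.
Qed.

Lemma pad_sorted (l : nat) (la : seq nat) : sorted geq la -> sorted geq (pad l la).
Proof.
move=> srt; apply/(sortedP 0%N) => i _; rewrite !nth_pad /=.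
have [lt_i|le_i] := ltnP i.+1 (size la); last by rewrite nth_default.
by move/(sortedP 0%N): srt; apply.
Qed.

Lemma size_part (la : seq nat) : is_part la -> (size la <= sumn la)%N.
Proof.
case/andP=> _; elim: la => //= x la IHla; rewrite inE negb_or eq_sym -lt0n => /andP[x_gt0 /IHla].
by lia.
Qed.

(* The filling counted for [mu = pad l la] is unique if it exists; it exists
   because otherwise [jt_unique] would make [word_coef] zero, whereas it counts
   the standard tableaux at exponents 1, ..., 1. *)
Lemma straight_jt (la mu : seq nat) (l : nat) : is_part la -> (sumn la <= l)%N ->
  size mu = l -> sorted geq mu -> sumn mu = sumn la ->
  jt_sum l (word_coef (straight la)) mu = (mu == pad l la)%:R.
Proof.
move=> la_part le_l size_mu srt_mu sum_mu.
have size_la : (size la <= l)%N := leq_trans (size_part la_part) le_l.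
have jtE nu' : size nu' = l -> sorted geq nu' -> sumn nu' = sumn la ->
    jt_sum l (word_coef (straight la)) nu' =
    #|[set T : filling (straight la) | SYT T && yam_word (straight la) nu' (letters T)]|%:R.
  move=> size_nu' srt_nu' sum_nu'; rewrite word_coef_jt ?ncells_straight //; last exact:
      straight_spread.
  rewrite -sum1dep_card natr_sum; apply: eq_bigr => T _; by rewrite straight_inv.
rewrite jtE //; set B := [set T | _].
have BP T : T \in B -> forall r, nth 0%N mu r = nth 0%N la r.
  rewrite inE => /andP[SYT_T yam_T]; apply: (yam_shape la_part SYT_T srt_mu _ yam_T).
  by rewrite ncells_straight.
have le1 : (#|B| <= 1)%N.
  apply/card_le1_eqP => T T' T_B T'_B; apply/ffunP => x; apply: val_inj.
  move: T_B T'_B; rewrite !inE => /andP[SYT_T yam_T] /andP[SYT_T' yam_T'].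
  have sum_mu' : sumn mu = ncells (straight la) by rewrite ncells_straight.
  by rewrite /= (yam_entry la_part SYT_T srt_mu sum_mu' yam_T) (yam_entry la_part SYT_T' srt_mu
      sum_mu' yam_T').
have [e_mu|ne_mu] := eqVneq mu (pad l la); last first.
  have [->|[T T_B]] := set_0Vmem B; first by rewrite cards0.
  case/eqP: ne_mu; apply: (@eq_from_nth _ 0%N); rewrite ?size_pad // => r _.
  by rewrite nth_pad (BP _ T_B).
have [B0|B_gt0] := posnP #|B|; last by rewrite (_ : #|B| = 1%N) //; apply/eqP; rewrite eqn_leq le1.
have word_coef0 al : size al = l -> word_coef (straight la) al = 0.
  apply: (@jt_unique _ _ (sumn la)) => [s t||nu' size_nu' srt_nu' sum_nu'].
  - exact: word_coef_perm.
  - by move=> s; rewrite -(ncells_straight la_part); apply: word_coef_deg.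
  rewrite jtE //; have [->|ne] := eqVneq nu' mu; first by rewrite -/B B0.
  have [->|[T]] := set_0Vmem [set T : filling (straight la) | SYT T && yam_word (straight la) nu'
      (letters T)].
    by rewrite cards0.
  rewrite inE => /andP[SYT_T yam_T]; case/eqP: ne; rewrite e_mu.
  apply: (@eq_from_nth _ 0%N); rewrite ?size_pad // => r _; rewrite nth_pad.
  by apply: (yam_shape la_part SYT_T srt_nu' _ yam_T); rewrite ncells_straight.
pose al := pad l (nseq (sumn la) 1%N).
have := word_coef0 al; rewrite size_pad ?size_nseq // => /(_ erefl).
have sum_al : sumn al == ncells (straight la).
  by rewrite sumn_pad sumn_nseq mul1n ncells_straight.
rewrite word_coefE sum_al /=.
have all_short (T : filling (straight la)) : all (sorted ltn) (reshape al (letters T)).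
  have e : shape (reshape al (letters T)) = al.
    by rewrite reshapeKl // size_letters (eqP sum_al).
  apply/allP => w w_in; have : size w \in al by rewrite -e map_f.
  by rewrite mem_cat !mem_nseq => /orP[] /andP[_ /eqP]; case: w {w_in} => [|a []].
under eq_bigl do rewrite all_short andbT.
rewrite (eq_bigr (fun=> 1)); last by move=> T _; rewrite straight_inv.
rewrite sumr_const => /eqP; rewrite -[1 *+ _]/(_%:R) => card0.
(* The filling by row indices is semistandard, and its standardization shows that the count of
   standard fillings is positive. *)
have ss : semistandard (fun x : cell (straight la) => cell_row x).
  apply/forallP => x; apply/forallP => y; apply/implyP => _; apply/andP; split; apply/implyP.
    by case/andP=> /eqP ->.
  by case/andP.
have T0 := standardize_SYT ss.
have card_gt0 : (0 < #|[pred T : filling (straight la) | SYT T]|)%N.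
  by apply/card_gt0P; exists (standardize (fun x => cell_row x)); rewrite inE.
move: card0; rewrite -(rmorph_nat (@polyC int)) polyC_eq0 pnatr_eq0.
by rewrite eqn0Ngt card_gt0.
Qed.

(** * Standardized Yamanouchi words *)

(** Invariance under the elementary Knuth moves, for an arbitrary predicate: it transfers properties
    between a word and its insertion tableau. *)
Definition knuth_closed (Q : seq nat -> Prop) : Prop :=
  (forall p q a b c, (a <= b < c)%N ->
     Q (p ++ [:: a, c, b & q]) <-> Q (p ++ [:: c, a, b & q])) /\
  (forall p q a b c, (a < b <= c)%N ->
     Q (p ++ [:: b, c, a & q]) <-> Q (p ++ [:: b, a, c & q])).

(** Rows from the top down: the bottom row comes last, so inserting a letter starts by appending
    it. *)
Definition reading (t : seq (seq nat)) : seq nat := flatten (rev t).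

Lemma reading_cons (r : seq nat) (t : seq (seq nat)) : reading (r :: t) = reading t ++ r.
Proof. by rewrite /reading rev_cons flatten_rcons. Qed.

Section KnuthInsertion.

Variable Q : seq nat -> Prop.
Hypothesis QP : knuth_closed Q.

(** The inserted letter [x] travels left over the letters after the bumped letter [y]. *)
Lemma knuth_left (x y : nat) (r p q : seq nat) : (x < y)%N -> path leq y r ->
  Q (p ++ y :: r ++ x :: q) <-> Q (p ++ [:: y, x & r ++ q]).
Proof.
elim: r y p => //= z r IHr y p lt_xy /andP[le_yz srt].
rewrite -[p ++ _]/(p ++ [:: y] ++ _) catA IHr //; last exact: leq_trans le_yz.
by rewrite -catA /=; apply: (proj2 QP); rewrite lt_xy.
Qed.

(** The bumped letter [y] then travels left out of its row, towards the row above. *)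
Lemma knuth_out (x y : nat) (r p q : seq nat) : (x < y)%N -> sorted leq (rcons r x) ->
  Q (p ++ r ++ [:: y, x & q]) <-> Q (p ++ y :: r ++ x :: q).
Proof.
move=> lt_xy; elim: r p => //= z r IHr p srt.
rewrite -[p ++ _]/(p ++ [:: z] ++ _) catA IHr ?(path_sorted srt) // -catA /=.
have lt_head v t : path leq z (rcons r x) -> r ++ x :: q = v :: t -> (z <= v < y)%N.
  case: r {IHr srt} => [|v' r] /= /andP[le_z srt] [<- _]; first by rewrite le_z.
  rewrite le_z /=; apply: leq_ltn_trans lt_xy.
  have : all (leq v') (rcons r x) by apply: order_path_min srt; apply: leq_trans.
  by rewrite all_rcons => /andP[].
case e : (r ++ x :: q) => [|v t]; first by case: r e {IHr srt lt_head}.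
exact: (proj1 QP) (lt_head _ _ srt e).
Qed.

Lemma row_insert_split (x : nat) (r : seq nat) : sorted leq r ->
  (row_insert x r = (rcons r x, None) /\ sorted leq (rcons r x)) \/
  (exists r1 y r2, [/\ r = r1 ++ y :: r2, row_insert x r = (r1 ++ x :: r2, Some y),
     (x < y)%N & sorted leq (rcons r1 x) /\ sorted leq (r1 ++ x :: r2)]).
Proof.
elim: r => [|y r IHr] /= srt; first by left.
have [lt_xy|le_yx] := ltnP x y.
  right; exists [::], y, r; split=> //; split=> //=.
  by case: r srt {IHr} => //= z r /andP[le_yz ->]; rewrite (ltnW (leq_trans lt_xy le_yz)).
have [[-> srt']|[r1 [z [r2 [er -> lt_xz [srt1 srt2]]]]]] := IHr (path_sorted srt).
  left; split=> //=; case: r srt srt' {IHr} => [|z r] /=; first by rewrite le_yx.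
  by case/andP=> -> _.
right; exists (y :: r1), z, r2; rewrite er; split=> //; split.
  by case: r1 er srt1 {srt2} => [|v r1] er /=; [rewrite le_yx | move: srt; rewrite er /= =>
      /andP[->]].
by case: r1 er srt2 {srt1} => [|v r1] er /=; [move=> ->; rewrite le_yx | move: srt; rewrite er /=
    => /andP[->]].
Qed.

(** Columns enter through the first one alone: this condition is stable under insertion and is
    strong enough to recognise [U_tab]. *)
Definition tab_ok (t : seq (seq nat)) : bool :=
  all (fun r => (0 < size r)%N && sorted leq r) t && sorted ltn (map (head 0%N) t).

(** The second conclusion strengthens the induction: the new head of the rows above is compared with
    the head of the current row. *)
Lemma tab_insert_ok (x : nat) (t : seq (seq nat)) : tab_ok t ->
  tab_ok (tab_insert x t) /\
  head 0%N (head [::] (tab_insert x t)) = (if t is r :: _ then minn x (head 0%N r) else x).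
Proof.
elim: t x => [|r t IHt] x //= /andP[/= /andP[/andP[r_gt0 srt_r] rows_ok] heads].
have tab_t : tab_ok t by rewrite /tab_ok rows_ok (path_sorted heads).
have [[-> srt']|[r1 [y [r2 [er -> lt_xy [srt1 srt2]]]]]] := row_insert_split x srt_r.
  have e : head 0%N (rcons r x) = head 0%N r by case: r r_gt0 {srt_r heads srt'}.
  rewrite /= e; split; first by rewrite /tab_ok /= size_rcons srt' rows_ok /= e.
  case: r r_gt0 srt' {srt_r heads e} => //= h r _; rewrite (path_sortedE leq_trans) all_rcons.
  by case/andP=> /andP[le_hx _] _; apply/esym/minn_idPr.
have [ok_y head_y] := IHt y tab_t.
have e : head 0%N (r1 ++ x :: r2) = minn x (head 0%N r).
  rewrite er; case: r1 srt1 {er srt2} => [|h r1] /=; first by rewrite (minn_idPl (ltnW lt_xy)).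
  rewrite (path_sortedE leq_trans) all_rcons => /andP[/andP[le_hx _] _].
  by apply/esym/minn_idPr.
split; last by rewrite /= e.
move: ok_y => /andP[rows_y heads_y]; rewrite /tab_ok /= size_cat addnS srt2 rows_y /= e.
case e' : (tab_insert y t) heads_y head_y => [|r' t'] //= -> ->; rewrite andbT.
have lt_hy : (head 0 r <= y)%N.
  rewrite er; case: r1 er {srt1 srt2 e} => [|h r1] er //=.
  move: srt_r; rewrite er /= (path_sortedE leq_trans) all_cat /= => /andP[/and3P[]] //.
case: t heads {IHt tab_t rows_ok rows_y e'} => [|r'' t''] /= heads; first by rewrite gtn_min lt_xy.
case/andP: heads => lt_h _.
rewrite leq_min; apply/andP; split; first by rewrite gtn_min lt_xy.
by rewrite gtn_min lt_h orbT.
Qed.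

Lemma tab_insert_knuth (x : nat) (t : seq (seq nat)) (p q : seq nat) : tab_ok t ->
  Q (p ++ reading t ++ x :: q) <-> Q (p ++ reading (tab_insert x t) ++ q).
Proof.
elim: t x p q => [|r t IHt] x p q //= /andP[/= /andP[/andP[r_gt0 srt_r] rows_ok] heads].
have tab_t : tab_ok t by rewrite /tab_ok rows_ok (path_sorted heads).
have [[-> _]|[r1 [y [r2 [er -> lt_xy [srt1 _]]]]]] := row_insert_split x srt_r.
  by rewrite /= !reading_cons -cats1 -!catA.
rewrite /= !reading_cons -!catA.
have -> : Q (p ++ reading (tab_insert y t) ++ r1 ++ x :: r2 ++ q) <->
    Q (p ++ reading t ++ y :: r1 ++ x :: r2 ++ q) by rewrite IHt.
have srt_y : path leq y r2.
  by move: srt_r; rewrite er => /cat_sorted2[].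
have := knuth_out (p ++ reading t) (r2 ++ q) lt_xy srt1.
have := knuth_left (p ++ reading t ++ r1) q lt_xy srt_y.
by rewrite er -!catA /= => -> ->.
Qed.

Lemma RS_P_ok (w : seq nat) : tab_ok (RS_P w).
Proof.
rewrite /RS_P; have : tab_ok [::] by [].
by elim: w [::] => //= x w IHw t /(tab_insert_ok x)[/IHw].
Qed.

Lemma RS_P_knuth (w : seq nat) : Q w <-> Q (reading (RS_P w)).
Proof.
rewrite /RS_P -{1}[w]/(reading [::] ++ w); have : tab_ok [::] by [].
elim: w [::] => [|x w IHw] t ok_t /=; first by rewrite cats0.
have := tab_insert_knuth x [::] w ok_t; rewrite /= => ->.
by apply: IHw; case: (tab_insert_ok x ok_t).
Qed.

End KnuthInsertion.

(* The [p]-th entry from the right of row [r] of the tableau of shape [la]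
   filled with [s + 1, s + 2, ...] row by row. *)
Definition right_entry (s : nat) (la : seq nat) (r p : nat) : nat :=
  (s + sumn (take r.+1 la) - p)%N.

Definition before (w : seq nat) (i j : nat) : Prop := (index i w < index j w)%N.

(** The standardized lattice condition. Read entries of row [r] as letters [r]: the first clause
    numbers equal letters from left to right, the second says that every suffix has at least as many
    [r] as [r.+1]. *)
Definition yam_order (s : nat) (la w : seq nat) : Prop :=
  (forall r p, (p.+1 < nth 0 la r)%N ->
     before w (right_entry s la r p.+1) (right_entry s la r p)) /\
  (forall r p, (p < nth 0 la r.+1)%N ->
     before w (right_entry s la r.+1 p) (right_entry s la r p)).

Lemma yam_order_row (s : nat) (la w : seq nat) (r x y : nat) : yam_order s la w ->
  (y < x)%N -> (x < nth 0 la r)%N -> before w (right_entry s la r x) (right_entry s la r y).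
Proof.
case=> row _; elim: x => // x IHx; rewrite ltnS leq_eqVlt => /predU1P[->|lt_yx] lt_x.
  exact: row.
exact: ltn_trans (row _ _ lt_x) (IHx lt_yx (ltnW lt_x)).
Qed.

Lemma index_at (p q : seq nat) (x : nat) : uniq (p ++ x :: q) -> index x (p ++ x :: q) = size p.
Proof.
rewrite cat_uniq => /and3P[_ /hasPn/(_ x (mem_head _ _)) /= x_p _].
by rewrite index_cat (negbTE x_p) /= eqxx addn0.
Qed.

Lemma index_at_inv (p q : seq nat) (x z : nat) : index z (p ++ x :: q) = size p -> z = x.
Proof.
move=> e; have z_in : z \in p ++ x :: q by rewrite -index_mem e size_cat /= -addSnnS leq_addr.
by rewrite -(nth_index 0%N z_in) e nth_cat ltnn subnn.
Qed.

Lemma index_triple (p q : seq nat) (x y z : nat) : uniq (p ++ [:: x, y, z & q]) ->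
  [/\ index x (p ++ [:: x, y, z & q]) = size p,
      index y (p ++ [:: x, y, z & q]) = (size p).+1,
      index z (p ++ [:: x, y, z & q]) = (size p).+2 &
      forall t, index t (p ++ [:: x, y, z & q]) = (size p).+1 -> t = y].
Proof.
move=> w_uniq; have e1 : p ++ [:: x, y, z & q] = (p ++ [:: x]) ++ [:: y, z & q] by rewrite -catA.
have e2 : p ++ [:: x, y, z & q] = (p ++ [:: x; y]) ++ z :: q by rewrite -catA.
split; first exact: index_at.
- by rewrite e1 index_at -?e1 // size_cat addn1.
- by rewrite e2 index_at -?e2 // size_cat addn2.
by move=> t; rewrite e1 => e; apply: (@index_at_inv (p ++ [:: x]) [:: z & q]); rewrite e size_cat
    addn1.
Qed.

(** * Knuth invariance of the order conditions *)

Section Invariance.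

Variables (s : nat) (la : seq nat).
Hypothesis la_sorted : sorted geq la.

Let la_le (r : nat) : (nth 0 la r.+1 <= nth 0 la r)%N.
Proof. exact: sorted_geq_nth. Qed.

Let cell_between (r x b : nat) : (x < nth 0 la r.+1)%N ->
  (right_entry s la r x < b < right_entry s la r.+1 x)%N ->
  (exists2 y, (y < x)%N & b = right_entry s la r y) \/
  (exists2 y, (x < y < nth 0 la r.+1)%N & b = right_entry s la r.+1 y).
Proof.
rewrite /right_entry (sumn_takeS la r.+1).
set o := sumn _; set l := nth 0%N la r.+1 => lt_x /andP[lt_b b_lt].
have [le_b|gt_b] := leqP b (s + o).
  by left; exists (s + o - b)%N; lia.
by right; exists (s + (o + l) - b)%N; lia.
Qed.

Let right_entry_lt (r x y : nat) : (x < nth 0 la r.+1)%N ->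
  (right_entry s la r y < right_entry s la r.+1 x)%N.
Proof. by rewrite /right_entry (sumn_takeS la r.+1); lia. Qed.

(* A letter [b] between [a] and [c] in value is another entry of their two
   rows, and the order conditions do not allow it next to the adjacent letters
   [c a]. *)
Lemma yam_order_cab (p q : seq nat) (a b c r x : nat) : uniq (p ++ [:: c, a, b & q]) ->
  yam_order s la (p ++ [:: c, a, b & q]) -> (a < b < c)%N -> (x < nth 0 la r.+1)%N ->
  c = right_entry s la r.+1 x -> a = right_entry s la r x -> False.
Proof.
move=> w_uniq yam_w lt_abc lt_x e_c e_a.
have [ic ia ib at_a] := index_triple w_uniq.
have [|[y lt_y e_b]|[y /andP[lt_xy lt_y] e_b]] := @cell_between r x b lt_x; first by rewrite -e_a
    -e_c.
  have lt_y' := ltn_trans lt_y lt_x.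
  have b1 := yam_order_row yam_w lt_y lt_x; have b2 := proj2 yam_w r y lt_y'.
  rewrite /before -e_c -e_b ic ib in b1 b2.
  have e := at_a (right_entry s la r.+1 y) ltac:(lia).
  by have := right_entry_lt x lt_y'; rewrite e -e_a ltnn.
have := yam_order_row yam_w lt_xy lt_y.
by rewrite /before -e_c -e_b ic ib; lia.
Qed.

Lemma yam_order_bca (p q : seq nat) (a b c r x : nat) : uniq (p ++ [:: b, c, a & q]) ->
  yam_order s la (p ++ [:: b, c, a & q]) -> (a < b < c)%N -> (x < nth 0 la r.+1)%N ->
  c = right_entry s la r.+1 x -> a = right_entry s la r x -> False.
Proof.
move=> w_uniq yam_w lt_abc lt_x e_c e_a.
have [ib ic ia at_c] := index_triple w_uniq.
have [|[y lt_y e_b]|[y /andP[lt_xy lt_y] e_b]] := @cell_between r x b lt_x; first by rewrite -e_a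
    -e_c.
  have := yam_order_row yam_w lt_y (leq_trans lt_x (la_le r)).
  by rewrite /before -e_a -e_b ia ib; lia.
have b1 := yam_order_row yam_w lt_xy (leq_trans lt_y (la_le r)).
have b2 := proj2 yam_w r y lt_y.
rewrite /before -e_a -e_b ia ib in b1 b2.
have e := at_c (right_entry s la r y) ltac:(lia).
by have := right_entry_lt y lt_x; rewrite e -e_c ltnn.
Qed.

Lemma index_swap (p q : seq nat) (x y i j : nat) : uniq (p ++ [:: x, y & q]) ->
  before (p ++ [:: x, y & q]) i j -> before (p ++ [:: y, x & q]) i j \/ i = x /\ j = y.
Proof.
rewrite /before cat_uniq => /and3P[_ _ /= /andP[]]; rewrite inE negb_or eq_sym => /andP[ne_yx _] _.
have lt_p z : z \in p -> (index z p < size p)%N by rewrite index_mem.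
rewrite !index_cat; case: ifP => [/lt_p lt_i|_]; case: ifP => [/lt_p lt_j|_].
- by left.
- by left; apply: leq_trans lt_i (leq_addr _ _).
- by move=> lt_ij; have := ltn_trans lt_ij lt_j; rewrite ltnNge leq_addr.
rewrite !ltn_add2l /=.
have [ix|nix] := eqVneq x i; have [iy|niy] := eqVneq y i;
  have [jx|njx] := eqVneq x j; have [jy|njy] := eqVneq y j; rewrite ?ltnS //; try by left.
- by case/eqP: ne_yx; rewrite ix iy.
- by right.
Qed.

Lemma yam_order_move (p q : seq nat) (x y : nat) : uniq (p ++ [:: x, y & q]) ->
  (forall r t, (t.+1 < nth 0 la r)%N -> right_entry s la r t.+1 = x -> right_entry s la r t = y
      -> False) ->
  (forall r t, (t < nth 0 la r.+1)%N -> right_entry s la r.+1 t = x -> right_entry s la r t = y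
      -> False) ->
  yam_order s la (p ++ [:: x, y & q]) -> yam_order s la (p ++ [:: y, x & q]).
Proof.
move=> w_uniq no_row no_col [row col]; split=> r t lt_t.
  by case: (index_swap w_uniq (row r t lt_t)) => // -[e1 e2]; case: (no_row r t lt_t).
by case: (index_swap w_uniq (col r t lt_t)) => // -[e1 e2]; case: (no_col r t lt_t).
Qed.

Let right_entryS (r t : nat) : (t.+1 < nth 0 la r)%N ->
  right_entry s la r t = (right_entry s la r t.+1).+1.
Proof. by rewrite /right_entry (sumn_takeS la r); lia. Qed.

(** The exchanged letters [a] and [c] have [b] strictly between them in value. Row conditions
    concern consecutive values and column conditions want the larger value first, so only moving [c]
    to the right of [a] could do harm. *)
Lemma yam_order_knuth : knuth_closed (fun w => uniq w /\ yam_order s la w).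
Proof.
have uniq_swap (p q : seq nat) x y : uniq (p ++ [:: x, y & q]) = uniq (p ++ [:: y, x & q]).
  apply: perm_uniq; rewrite perm_cat2l; apply/permPl/(perm_catCA [:: x] [:: y]).
split=> p q a b c.
  case/andP; rewrite leq_eqVlt => /predU1P[-> lt_bc|lt_ab lt_bc].
    by split=> -[]; rewrite cat_uniq /= !inE eqxx ?orbT /= !andbF.
  split=> -[w_uniq yam_w].
    split; first by rewrite uniq_swap.
    apply: (yam_order_move w_uniq) => // r t lt_t e1 e2.
      by have := right_entryS lt_t; rewrite e1 e2; lia.
    by have := right_entry_lt t lt_t; rewrite e1 e2; lia.
  split; first by rewrite uniq_swap.
  apply: (yam_order_move w_uniq) => // r t lt_t e1 e2.
    by have := right_entryS lt_t; rewrite e1 e2; lia.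
  by apply: (yam_order_cab w_uniq yam_w _ lt_t) => //; rewrite lt_ab.
case/andP=> lt_ab; rewrite leq_eqVlt => /predU1P[->|lt_bc].
  by split=> -[]; rewrite cat_uniq /= !inE eqxx ?orbT /= !andbF.
have E x y : p ++ [:: b, x, y & q] = (p ++ [:: b]) ++ [:: x, y & q] by rewrite -catA.
split=> -[w_uniq yam_w]; (split; first by rewrite E uniq_swap -E).
  rewrite E; apply: yam_order_move; rewrite -?E // => r t lt_t e1 e2.
    by have := right_entryS lt_t; rewrite e1 e2; lia.
  by apply: (yam_order_bca w_uniq yam_w _ lt_t) => //; rewrite lt_ab.
rewrite E; apply: yam_order_move; rewrite -?E // => r t lt_t e1 e2.
  by have := right_entryS lt_t; rewrite e1 e2; lia.
by have := right_entry_lt t lt_t; rewrite e1 e2; lia.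
Qed.

End Invariance.

Lemma right_entry0 (s l0 : nat) (la : seq nat) (p : nat) :
  right_entry s (l0 :: la) 0 p = (s + l0 - p)%N.
Proof. by rewrite /right_entry /= take0 addn0. Qed.

Lemma right_entryS (s l0 : nat) (la : seq nat) (r p : nat) :
  right_entry s (l0 :: la) r.+1 p = right_entry (s + l0) la r p.
Proof. by rewrite /right_entry /= addnA. Qed.

Lemma right_entry_gt (s : nat) (la : seq nat) (r p : nat) : (p < nth 0 la r)%N ->
  (s < right_entry s la r p <= s + sumn la)%N.
Proof.
move=> lt_p; have := sumn_takeS la r; have := sumn_take_le la r.+1.
by rewrite /right_entry; lia.
Qed.

Lemma index_in_iota (a l x : nat) : (a <= x < a + l)%N -> index x (iota a l) = (x - a)%N.
Proof.
case/andP=> le_ax lt_x; have lt_l : (x - a < l)%N by lia.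
by rewrite -{1}(subnKC le_ax) -(nth_iota 0%N a lt_l) index_uniq ?size_iota ?iota_uniq.
Qed.

Lemma U_yam_order (s : nat) (la : seq nat) : sorted geq la ->
  yam_order s la (reading (reshape la (iota s.+1 (sumn la)))).
Proof.
elim: la s => [|l0 la IHla] s srt; first by split=> r p; rewrite nth_nil.
have srt' := path_sorted srt.
rewrite /= iotaD take_size_cat ?size_iota // drop_size_cat ?size_iota // reading_cons.
have [row col] := IHla (s + l0)%N srt'; set w := reading _ in row col *.
have mem_w x : (x \in w) = (s + l0 < x <= s + l0 + sumn la)%N.
  have /perm_mem -> : perm_eq w (iota (s + l0).+1 (sumn la)).
    rewrite /w /reading -[X in perm_eq _ X](@reshapeKr _ la) ?size_iota //.
    by apply: perm_flatten; rewrite perm_rev.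
  by rewrite mem_iota; lia.
have index_w x y : x \in w -> y \in w -> before w x y -> before (w ++ iota s.+1 l0) x y.
  by rewrite /before !index_cat => -> ->.
split=> [[|r] p lt_p|[|r] p lt_p]; rewrite ?right_entry0 ?right_entryS.
- rewrite /= in lt_p; rewrite /before !index_cat.
  have -> : (s + l0 - p.+1 \in w)%N = false by rewrite mem_w; lia.
  have -> : (s + l0 - p \in w)%N = false by rewrite mem_w; lia.
  by rewrite ltn_add2l !index_in_iota; lia.
- have /andP[h1 h2] := @right_entry_gt (s + l0) la r p.+1 lt_p.
  have /andP[h3 h4] := @right_entry_gt (s + l0) la r p (ltnW lt_p).
  by apply: index_w (row r p lt_p); rewrite mem_w ?h1 ?h2 ?h3 ?h4.
- have /andP[h1 h2] := @right_entry_gt (s + l0) la 0 p lt_p.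
  rewrite /before !index_cat mem_w h1 h2.
  have -> : (s + l0 - p \in w)%N = false by rewrite mem_w; lia.
  by apply: leq_trans (leq_addr _ _); rewrite index_mem mem_w h1 h2.
have /andP[h1 h2] := @right_entry_gt (s + l0) la r.+1 p lt_p.
have le_la : (nth 0 la r.+1 <= nth 0 la r)%N by apply: sorted_geq_nth.
have /andP[h3 h4] := @right_entry_gt (s + l0) la r p (leq_trans lt_p le_la).
by apply: index_w (col r p lt_p); rewrite mem_w ?h1 ?h2 ?h3 ?h4.
Qed.

(** Column conditions lead from any entry down to row 0, and row conditions then lead to the end of
    that row, always moving right in [w]. *)
Lemma yam_order_last (s : nat) (la w : seq nat) (r p : nat) : yam_order s la w -> sorted geq la ->
  (p < nth 0 la r)%N -> (right_entry s la r p != right_entry s la 0 0) ->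
  before w (right_entry s la r p) (right_entry s la 0 0).
Proof.
move=> yam_w srt lt_p; elim: r => [|r IHr] in p lt_p *.
  case: p lt_p => [|p] lt_p; first by rewrite eqxx.
  by move=> _; apply: (yam_order_row yam_w).
have le_la : (nth 0 la r.+1 <= nth 0 la r)%N by apply: sorted_geq_nth.
move=> _; have b := proj2 yam_w r p lt_p.
have [<- //|ne] := eqVneq (right_entry s la r p) (right_entry s la 0 0).
exact: ltn_trans b (IHr p (leq_trans lt_p le_la) ne).
Qed.

Lemma right_entry_onto (s : nat) (la : seq nat) (x : nat) : (s < x <= s + sumn la)%N ->
  exists r p, (p < nth 0 la r)%N /\ x = right_entry s la r p.
Proof.
elim: la s => [|l0 la IHla] s /=; first by lia.
have [le_x|gt_x] := leqP x (s + l0) => bx.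
  by exists 0%N, (s + l0 - x)%N; rewrite right_entry0 /=; lia.
have [|r [p [lt_p ->]]] := IHla (s + l0)%N; first by lia.
by exists r.+1, p; rewrite right_entryS.
Qed.

(** The bottom row is forced to be [s + 1, ..., s + l0]; the remaining rows satisfy the same
    hypotheses with [s + l0] in place of [s]. *)
Lemma yam_order_U (s : nat) (la : seq nat) (t : seq (seq nat)) : is_part la -> tab_ok t ->
  perm_eq (reading t) (iota s.+1 (sumn la)) -> yam_order s la (reading t) ->
  t = reshape la (iota s.+1 (sumn la)).
Proof.
elim: la s t => [|l0 la IHla] s t.
  case: t => [|[|x r] t] //= _ _; rewrite reading_cons => /perm_size.
  by rewrite size_cat addnS.
move=> la_part; have /andP[srt] := la_part; rewrite inE negb_or eq_sym -lt0n => /andP[l0_gt0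
    la_pos].
case: t => [|r0 t]; first by move=> _ /perm_size; rewrite /= size_iota; lia.
case/andP=> /= /andP[/andP[r0_gt0 srt_r0] rows_ok] heads perm_w yam_w.
set w := reading _ in perm_w yam_w; have eq_w : w = reading t ++ r0 by rewrite /w reading_cons.
have w_uniq : uniq w by rewrite (perm_uniq perm_w) iota_uniq.
have mem_w x : (x \in w) = (s < x <= s + (l0 + sumn la))%N.
  by rewrite (perm_mem perm_w) mem_iota /=; lia.
have last_w x : x \in w -> x != (s + l0)%N -> before w x (s + l0).
  rewrite mem_w => /(@right_entry_onto s (l0 :: la))[r [p [lt_p ->]]] ne.
  have := yam_order_last yam_w srt lt_p; rewrite right_entry0 subn0; exact.
have index_lt x : x \in w -> (index x w < size w)%N by rewrite index_mem.
(* By [yam_order_last] the letter [s + l0] ends the word, so it ends the bottom row and bounds it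
   from above. *)
have last_r0 : exists r1, r0 = rcons r1 (s + l0)%N.
  case/lastP: r0 r0_gt0 srt_r0 heads @w perm_w yam_w eq_w w_uniq mem_w last_w index_lt => // r1 z.
  move=> _ _ _ w perm_w yam_w eq_w w_uniq mem_w last_w index_lt; exists r1; congr rcons.
  have eq_w' : w = (reading t ++ r1) ++ z :: [::] by rewrite eq_w -cats1 catA.
  have iz : index z w = size (reading t ++ r1) by rewrite eq_w' index_at // -eq_w'.
  have [//|ne] := eqVneq z (s + l0)%N.
  have z_w : z \in w by rewrite eq_w' mem_cat mem_head orbT.
  have l_w : (s + l0)%N \in w by rewrite mem_w; lia.
  have := last_w z z_w ne; rewrite /before iz; have := index_lt _ l_w.
  by rewrite {2}eq_w' size_cat /=; lia.
have le_r0 x : x \in r0 -> (x <= s + l0)%N.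
  case: last_r0 => r1 e; move: srt_r0; rewrite e (sorted_pairwise leq_trans) pairwise_rcons.
  by case/andP=> /allP le_r1 _; rewrite mem_rcons inE => /predU1P[->|/le_r1].
have rows_ge r : r \in t -> (s.+1 < head 0 r)%N.
  move=> r_t; have lt_h : (head 0 r0 < head 0 r)%N.
    move: heads; rewrite /= (path_sortedE ltn_trans) => /andP[/allP lt_h _].
    by apply: lt_h; apply: map_f.
  apply: leq_ltn_trans lt_h; have : head 0%N r0 \in w.
    by rewrite eq_w mem_cat; case: (r0) r0_gt0 => //= h r1 _; rewrite mem_head orbT.
  by rewrite mem_w => /andP[].
have first_notin : s.+1 \notin reading t.
  apply/negP => /flattenP[r]; rewrite mem_rev => r_t s_r.
  have /andP[r_gt0 srt_r] := allP rows_ok _ r_t; have := rows_ge r r_t.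
  case: r s_r srt_r {r_t r_gt0} => //= h r; rewrite inE => /predU1P[->|s_r]; first by rewrite ltnn.
  by rewrite (path_sortedE leq_trans) => /andP[/allP/(_ _ s_r) le_h _]; lia.
(* The least letter [s.+1] can only be in the bottom row, and the row conditions place the letters
   up to [s + l0] after it in the word, hence in the bottom row too. *)
have in_r0 x : (s < x <= s + l0)%N -> x \in r0.
  move=> bx; have x_w : x \in w by rewrite mem_w; lia.
  have [ex|ne] := eqVneq x s.+1.
    by move: x_w; rewrite ex eq_w mem_cat (negbTE first_notin).
  have b : before w s.+1 x.
    have := @yam_order_row s (l0 :: la) w 0 l0.-1 (s + l0 - x) yam_w.
    rewrite !right_entry0 /=; have -> : (s + l0 - l0.-1 = s.+1)%N by lia.
    have -> : (s + l0 - (s + l0 - x) = x)%N by lia.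
    by apply; lia.
  move: x_w; rewrite eq_w mem_cat => /orP[x_t|//].
  move: b; rewrite /before eq_w !index_cat x_t (negbTE first_notin).
  have lt_x : (index x (reading t) < size (reading t))%N by rewrite index_mem.
  by move=> lt_s; have := ltn_trans lt_s lt_x; rewrite ltnNge leq_addr.
have r0_uniq : uniq r0 by move: w_uniq; rewrite eq_w cat_uniq => /and3P[].
have eq_r0 : r0 = iota s.+1 l0.
  apply: (sorted_eq leq_trans anti_leq) => //; first by apply: iota_sorted.
  apply: uniq_perm; rewrite ?iota_uniq // => x; rewrite mem_iota.
  apply/idP/idP => [x_r0|bx]; last by apply: in_r0; lia.
  have : x \in w by rewrite eq_w mem_cat x_r0 orbT.
  by rewrite mem_w; have := le_r0 x x_r0; lia.
have perm_t : perm_eq (reading t) (iota (s + l0).+1 (sumn la)).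
  by move: perm_w; rewrite eq_w eq_r0 /= iotaD addSn perm_sym perm_catC perm_cat2r perm_sym.
have mem_t x : (x \in reading t) = (s + l0 < x <= s + l0 + sumn la)%N.
  by rewrite (perm_mem perm_t) mem_iota; lia.
have before_t x y : x \in reading t -> y \in reading t -> before w x y -> before (reading t) x y.
  by rewrite /before eq_w !index_cat => -> ->.
have la_part' : is_part la by rewrite /is_part la_pos (path_sorted srt).
rewrite /= iotaD take_size_cat ?size_iota // drop_size_cat ?size_iota // -eq_r0; congr cons.
rewrite addSn; apply: IHla => //; first by rewrite /tab_ok rows_ok (path_sorted heads).
split=> r p lt_p; apply: before_t; rewrite ?mem_t; try exact: right_entry_gt.
- by apply: right_entry_gt; apply: ltnW.
- by have := proj1 yam_w r.+1 p lt_p; rewrite !right_entryS.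
- by apply: right_entry_gt; apply: leq_trans lt_p (part_nth _ _) => //.
by have := proj2 yam_w r.+1 p lt_p; rewrite !right_entryS.
Qed.

(** The order conditions pass from [w] to the reading word of its insertion tableau, and [U_tab la]
    is the only tableau that satisfies them. The content is kept in the invariant so that it passes
    along. *)
Lemma SYam_yam_order (la w : seq nat) : is_part la -> perm_eq w (iota 1 (sumn la)) ->
  SYam la w <-> yam_order 0 la w.
Proof.
move=> la_part perm_w; have srt : sorted geq la by case/andP: la_part.
have Q_closed : knuth_closed (fun v => perm_eq v (iota 1 (sumn la)) /\ yam_order 0 la v).
  have [cab bca] := yam_order_knuth 0 srt.
  have perm_Q v v' : perm_eq v v' ->
      (uniq v /\ yam_order 0 la v <-> uniq v' /\ yam_order 0 la v') ->
      (perm_eq v (iota 1 (sumn la)) /\ yam_order 0 la v <->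
       perm_eq v' (iota 1 (sumn la)) /\ yam_order 0 la v').
    move=> vv' iff; split=> -[pv yam_v].
      have pv' : perm_eq v' (iota 1 (sumn la)) by rewrite -(permPl vv').
      split=> //; apply: (proj1 iff _).2; split=> //.
      by rewrite (perm_uniq pv) iota_uniq.
    have pv' : perm_eq v (iota 1 (sumn la)) by rewrite (permPl vv').
    split=> //; apply: (proj2 iff _).2; split=> //.
    by rewrite (perm_uniq pv) iota_uniq.
  split=> p q a b c lt_abc; apply: perm_Q.
  - by rewrite perm_cat2l; apply/permPl/(perm_catCA [:: a] [:: c]).
  - exact: cab.
  - by rewrite perm_cat2l perm_cons; apply/permPl/(perm_catCA [:: c] [:: a]).
  - exact: bca.
have key := RS_P_knuth Q_closed w.
rewrite /SYam perm_w /=; split=> [/eqP e|yam_w].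
  apply: (proj2 key _).2; rewrite e; split; last exact: U_yam_order.
  rewrite /reading /U_tab -[X in perm_eq _ X](@reshapeKr _ la) ?size_iota //.
  by apply: perm_flatten; rewrite perm_rev.
have [perm_P yam_P] := proj1 key (conj perm_w yam_w).
by apply/eqP; apply: (yam_order_U la_part (RS_P_ok w) perm_P yam_P).
Qed.

(** * Arrays cut out of a word *)

Section ReshapedRows.

Variables (mu v : seq nat).
Hypothesis size_v : size v = sumn mu.

Let off (r : nat) : nat := sumn (take r mu).

Let off_le (r : nat) : (off r + nth 0 mu r <= size v)%N.
Proof. by rewrite -sumn_takeS size_v sumn_take_le. Qed.

Lemma size_reshape_row (r : nat) : size (nth [::] (reshape mu v) r) = nth 0%N mu r.
Proof.
rewrite nth_reshape size_takel // size_drop leq_subRL; first exact: off_le.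
exact: leq_trans (leq_addr _ _) (off_le r).
Qed.

Lemma nth_reshape_row (r c : nat) : (c < nth 0 mu r)%N ->
  nth 0%N (nth [::] (reshape mu v) r) c = nth 0%N v (off r + c).
Proof. by move=> lt_c; rewrite nth_reshape nth_take // nth_drop. Qed.

Lemma size_reshape_rows : size (reshape mu v) = size mu.
Proof. by rewrite -[in RHS](@reshapeKl _ mu v) ?size_map // size_v. Qed.

Lemma reshape_sortedP :
  reflect (forall r c, (c.+1 < nth 0 mu r)%N -> (nth 0 v (off r + c) < nth 0 v (off r + c.+1))%N)
    (all (sorted ltn) (reshape mu v)).
Proof.
apply: (iffP (all_nthP [::])) => [srt r c lt_c|incr r _].
  have lt_r : (r < size (reshape mu v))%N.
    by rewrite size_reshape_rows ltnNge; apply/negP => /(nth_default 0%N) e; rewrite e in lt_c.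
  have /(sortedP 0%N)/(_ c) := srt r lt_r; rewrite size_reshape_row => /(_ lt_c).
  by rewrite !nth_reshape_row // ltnW.
apply/(sortedP 0%N) => c; rewrite size_reshape_row => lt_c.
by rewrite !nth_reshape_row ?(ltnW lt_c) //; apply: incr.
Qed.

Lemma pair_ok_reshape (p r : nat) : sorted geq mu ->
  pair_ok p r (word_rows mu v) = ((p < nth 0 mu r.+1)%N ==>
    (nth 0 v (off r.+1 + (nth 0 mu r.+1 - p.+1)) < nth 0 v (off r + (nth 0 mu r - p.+1)))%N).
Proof.
move=> srt; have le_mu : (nth 0 mu r.+1 <= nth 0 mu r)%N by apply: sorted_geq_nth.
have size_rows : size (word_rows mu v) = size mu by rewrite size_map size_reshape_rows.
have size_row r' : size (nth [::] (word_rows mu v) r') = nth 0%N mu r'.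
  have [lt_r|le_r] := ltnP r' (size mu); last by rewrite !nth_default ?size_rows.
  by rewrite (nth_map [::]) ?size_rev ?size_reshape_row // size_reshape_rows.
have nth_row r' : (p < nth 0 mu r')%N ->
    nth 0%N (nth [::] (word_rows mu v) r') p = nth 0%N v (off r' + (nth 0 mu r' - p.+1)).
  move=> lt_p; have lt_r : (r' < size mu)%N.
    by rewrite ltnNge; apply/negP => /(nth_default 0%N) e; rewrite e in lt_p.
  rewrite (nth_map [::]) ?size_reshape_rows // nth_rev ?size_reshape_row //.
  by rewrite nth_reshape_row //; lia.
rewrite /pair_ok /col_ok !size_row; case: ltnP => //= lt_p.
by rewrite !nth_row ?(leq_trans lt_p le_mu).
Qed.

Lemma reshape_good (m : nat) : sorted geq mu ->
  (forall r p, (p < nth 0 mu r.+1)%N ->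
    (nth 0 v (off r.+1 + (nth 0 mu r.+1 - p.+1)) < nth 0 v (off r + (nth 0 mu r - p.+1)))%N) ->
  good m (word_rows mu v).
Proof.
move=> srt ok; apply/allP => p _; apply/allP => r _.
by rewrite pair_ok_reshape //; apply/implyP; apply: ok.
Qed.

Lemma good_reshape (m r p : nat) : sorted geq mu -> (forall r, (nth 0 mu r <= m)%N) ->
  good m (word_rows mu v) -> (p < nth 0 mu r.+1)%N ->
  (nth 0 v (off r.+1 + (nth 0 mu r.+1 - p.+1)) < nth 0 v (off r + (nth 0 mu r - p.+1)))%N.
Proof.
move=> srt le_m /allP ok lt_p; have lt_r : (r.+1 < size mu)%N.
  by rewrite ltnNge; apply/negP => /(nth_default 0%N) e; rewrite e in lt_p.
have /allP/(_ r) := ok p ltac:(by rewrite mem_iota; apply: leq_trans lt_p (le_m _)).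
rewrite mem_iota size_map size_reshape_rows pair_ok_reshape // lt_p; apply; lia.
Qed.

End ReshapedRows.

Lemma sumn_take_pad (l : nat) (la : seq nat) (r : nat) : sumn (take r (pad l la)) = sumn (take r
    la).
Proof. by elim: r => [|r IHr]; rewrite ?take0 // !sumn_takeS IHr nth_pad. Qed.

Section Bridge.

Variables (k : nat) (nu : k.-tuple skew_shape).

Notation n := (ncells nu).

Lemma content_word_perm (T : filling nu) : SYT T -> perm_eq (content_word T) (iota 1 n).
Proof.
move=> SYT_T; have inj := SYT_inj SYT_T; rewrite /content_word.
have perm_c := perm_cells inj.
apply: (@perm_trans _ [seq entry T x | x <- [seq cell_at T i | i <- enum 'I_n]]).
  by apply: perm_map; rewrite perm_sort perm_sym.
rewrite -map_comp (eq_map (g := fun i : 'I_n => (val i).+1)); last first.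
  by move=> i; rewrite /= entry_cell_at.
by rewrite (map_comp S val) val_enum_ord -(iotaDl 1 0).
Qed.

(** By [index_letters], comparing positions of entries in the content word amounts to comparing
    letters. The conditions on the array thus become those of [yam_order], up to the treatment of
    ties. *)
Lemma yam_word_SYam (T : filling nu) (la : seq nat) (l : nat) : SYT T -> is_part la ->
  sumn la = n -> yam_word nu (pad l la) (letters T) = SYam la (content_word T).
Proof.
move=> SYT_T la_part sum_la; have srt : sorted geq la by case/andP: la_part.
have size_v : size (letters T) = sumn (pad l la) by rewrite size_letters sumn_pad.
have iff := SYam_yam_order la_part.
have iffT := iff (content_word T); rewrite sum_la in iffT.
have {iff iffT} iffT := iffT (content_word_perm SYT_T).
have entry_lt r p : (p < nth 0 la r)%N -> (sumn (take r la) + (nth 0 la r - p.+1) < n)%N.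
  by move=> lt_p; have := right_entry_gt 0 lt_p; rewrite /right_entry sumn_takeS sum_la; lia.
have entryE r p : (p < nth 0 la r)%N ->
    (right_entry 0 la r p = (sumn (take r la) + (nth 0 la r - p.+1)).+1)%N.
  by move=> lt_p; rewrite /right_entry sumn_takeS; lia.
have beforeE r p r' p' : (p < nth 0 la r)%N -> (p' < nth 0 la r')%N ->
    before (content_word T) (right_entry 0 la r p) (right_entry 0 la r' p') <->
    let i := (sumn (take r la) + (nth 0 la r - p.+1))%N in
    let j := (sumn (take r' la) + (nth 0 la r' - p'.+1))%N in
    (nth 0 (letters T) i < nth 0 (letters T) j)%N || (nth 0 (letters T) i == nth 0 (letters T)
        j)%N && (i < j)%N.
  move=> lt_p lt_p'; rewrite /before !entryE //.
  by have := index_letters SYT_T (Ordinal (entry_lt r p lt_p)) (Ordinal (entry_lt r' p' lt_p'))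
      => /= ->.
have la_le r : (nth 0 la r.+1 <= nth 0 la r)%N by apply: part_nth.
apply/idP/idP.
  case/andP=> rows_incr ok; apply/(proj2 iffT).
  have le_m r : (nth 0 (pad l la) r <= size (contents nu))%N.
    have [lt_r|le_r] := ltnP r (size (pad l la)); last by rewrite nth_default.
    have := rows_incr; rewrite -(@word_rows_mem _ nu) ?letters_lt // mem_rows => /andP[_ /allP
        in_decs].
    have size_rows : size (word_rows (pad l la) (letters T)) = size (pad l la).
      by rewrite size_map size_reshape_rows.
    have := size_decs (in_decs _ (mem_nth [::] (s := word_rows (pad l la) (letters T)) (n := r) _)).
    rewrite size_rows (nth_map [::]) ?size_reshape_rows // size_rev size_reshape_row //; exact.
  move/(reshape_sortedP size_v): rows_incr => rows_incr.
  split=> r p lt_p; apply/beforeE => //=; rewrite ?(ltnW lt_p) ?(leq_trans lt_p (la_le r)) //.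
    have := rows_incr r (nth 0 la r - p.+2)%N; rewrite nth_pad sumn_take_pad.
    have -> : ((nth 0 la r - p.+2).+1 = nth 0 la r - p.+1)%N by lia.
    by move=> -> //; lia.
  have := good_reshape size_v (r := r) (p := p) (pad_sorted l srt) le_m ok.
  by rewrite !nth_pad !sumn_take_pad => ->.
move/(proj1 iffT) => [row col]; apply/andP; split.
  apply/(reshape_sortedP size_v) => r c; rewrite nth_pad sumn_take_pad => lt_c.
  have := row r (nth 0 la r - c.+2)%N => /(_ ltac:(lia)) /beforeE => /(_ ltac:(lia) ltac:(lia)) /=.
  have -> : (nth 0 la r - (nth 0 la r - c.+2).+2 = c)%N by lia.
  have -> : (nth 0 la r - (nth 0 la r - c.+2).+1 = c.+1)%N by lia.
  (* A tie in a row would involve consecutive entries, which [letters_step] excludes. *)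
  case/orP=> // /andP[/eqP e _].
  have lt_i : (sumn (take r la) + c < n)%N.
    by have := entry_lt r (nth 0 la r - c.+1)%N ltac:(lia); lia.
  have lt_j : (sumn (take r la) + c.+1 < n)%N.
    by have := entry_lt r (nth 0 la r - c.+2)%N ltac:(lia); lia.
  have := letters_step SYT_T (i := Ordinal lt_i) (j := Ordinal lt_j) (addnS _ _).
  by rewrite /= e eqxx.
apply: (reshape_good size_v _ (pad_sorted l srt)) => r p.
rewrite !nth_pad !sumn_take_pad => lt_p.
have := col r p lt_p => /beforeE => /(_ lt_p (leq_trans lt_p (la_le r))) /=.
(* No tie is possible here: the entry of row [r.+1] is larger than that of row [r], so the
   tie-breaking inequality fails. *)
case/orP=> // /andP[_]; have := sumn_takeS la r; have := la_le r; lia.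
Qed.

End Bridge.

(** * The Schur expansion *)

Lemma pad_filter (l : nat) (mu : seq nat) : size mu = l -> sorted geq mu ->
  pad l (filter (ltn 0) mu) = mu /\ is_part (filter (ltn 0) mu).
Proof.
move=> <- srt; have geq_tr : transitive geq by move=> ? ? ? /= h1 h2; apply: leq_trans h1.
split; last first.
  by rewrite /is_part sorted_filter // mem_filter.
elim: mu srt => //= x mu IHmu srt; have srt' := path_sorted srt.
case: x srt => [|x] srt /=; last by rewrite /pad /= subSS; congr cons; apply: IHmu.
have mu0 : all (pred1 0%N) mu.
  have := order_path_min geq_tr srt; apply: sub_all => y /=; rewrite leqn0; exact.
have -> : filter (ltn 0) mu = [::].
  by apply/eqP; rewrite -[_ == _]negbK -has_filter; apply/hasPn => y /(allP mu0) /= /eqP ->.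
by rewrite /pad /=; congr cons; apply/esym/all_pred1P.
Qed.

Lemma pad_inj (l : nat) (la mu : seq nat) : is_part la -> is_part mu ->
  pad l la = pad l mu -> la = mu.
Proof.
have filter_pad nu : is_part nu -> filter (ltn 0) (pad l nu) = nu.
  case/andP=> _ pos; rewrite filter_cat [X in _ ++ X](_ : _ = [::]).
    rewrite cats0; apply/all_filterP/allP => x x_nu /=; rewrite lt0n.
    by apply: contraNneq pos => <-.
  by apply/eqP; rewrite -[_ == _]negbK -has_filter has_nseq andbF.
by move=> /filter_pad {2}<- /filter_pad {2}<- ->.
Qed.

(** The difference of the two sides is symmetric and homogeneous, and its Jacobi-Trudi sum at [mu]
    vanishes: by [straight_jt] only the partition that pads to [mu] contributes, and its coefficient
    is the one counted by [word_coef_jt]. *)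
Lemma schur_expansion (k : nat) (nu : k.-tuple skew_shape) (l : nat) (al : seq nat) :
  four_spread nu -> (ncells nu <= l)%N -> size al = l ->
  word_coef nu al = \sum_(la <- partitions (ncells nu))
    \sum_(T in SYam_fillings nu la) 'X^(inv_k T) * word_coef (straight la) al.
Proof.
move=> spread le_l size_al; set n := ncells nu.
pose c la : {poly int} := \sum_(T in SYam_fillings nu la) 'X^(inv_k T).
transitivity (\sum_(la <- partitions n) c la * word_coef (straight la) al); last first.
  by apply: eq_bigr => la _; rewrite mulr_suml.
pose Psi a := word_coef nu a - \sum_(la <- partitions n) c la * word_coef (straight la) a.
apply/eqP; rewrite -subr_eq0; apply/eqP; rewrite -/(Psi al).
have partP la : la \in partitions n -> is_part la /\ sumn la = n.
  by rewrite mem_partitions => /andP[? /eqP].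
apply: (@jt_unique l _ n Psi) => // [s t st|s ne|mu size_mu srt_mu sum_mu].
- rewrite /Psi (word_coef_perm nu st); congr (_ - _).
  by apply: eq_bigr => la _; rewrite (word_coef_perm _ st).
- rewrite /Psi word_coef_deg // sub0r big1_seq ?oppr0 // => la /andP[_ /partP[la_part sum_la]].
  by rewrite word_coef_deg ?mulr0 // ncells_straight // sum_la.
have -> : jt_sum l Psi mu = jt_sum l (word_coef nu) mu -
    \sum_(la <- partitions n) c la * jt_sum l (word_coef (straight la)) mu.
  rewrite /jt_sum [X in _ - X](eq_bigr _ (fun la _ => mulr_sumr _ _ _ _)).
  rewrite exchange_big -sumrB; apply: eq_bigr => s _.
  by rewrite /Psi mulrzBl mulrz_suml; congr (_ - _); apply: eq_bigr => la _; rewrite mulrzAr.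
have [eq_mu mu_part] := pad_filter size_mu srt_mu; set la0 := filter _ _ in eq_mu mu_part.
have sum_la0 : sumn la0 = n by rewrite -sum_mu -eq_mu sumn_pad.
have la0_in : la0 \in partitions n by rewrite mem_partitions mu_part sum_la0 eqxx.
rewrite (bigD1_seq la0) ?partitions_uniq //= big1_seq ?addr0; last first.
  move=> la /andP[ne /partP[la_part sum_la]].
  rewrite straight_jt ?sum_la // -eq_mu; case: eqP => [/(pad_inj mu_part la_part) e|_].
    by rewrite e eqxx in ne.
  by rewrite mulr0.
rewrite straight_jt ?sum_la0 // eq_mu eqxx mulr1 word_coef_jt //.
apply/eqP; rewrite subr_eq0; apply/eqP; apply: eq_bigl => T; rewrite inE.
by rewrite -{1}eq_mu; case SYT_T : (SYT T) => //=; apply: yam_word_SYam.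
Qed.

Unset Implicit Arguments.

Theorem theorem4p3 (k : nat) (nu : k.-tuple skew_shape) :
  (diam nu <= 3)%N ->
  LLT nu =
  \sum_(la <- partitions (ncells nu))
    \sum_(T in SYam_fillings nu la) 'X^(inv_k T) *: schur la.
Proof.
move=> /diam_four_spread spread; apply/funext => m.
pose s := sort leq (enum_mset m).
have srt : sorted leq s by apply: sort_sorted; apply: leq_total.
have perm_s : perm_eq s (enum_mset m) by rewrite perm_sort.
(* Large enough to be both the number of variables of the monomial and the number of rows of arrays,
   which has to be at least the number of cells. *)
pose l := (ncells nu + (\max_(x <- s) x).+1)%N.
have lt_s : all (gtn l) s.
  by apply/allP => x x_s /=; rewrite /l addnS ltnS; apply: leq_trans (leq_addl _ _); apply:
      leq_bigmax_seq.
rewrite (LLT_coef nu srt perm_s lt_s) fct_sumE (@schur_expansion _ _ l) ?leq_addr //; last first.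
  by rewrite size_map size_iota.
rewrite big_seq [RHS]big_seq; apply: eq_bigr => la; rewrite mem_partitions => /andP[la_part _].
rewrite fct_sumE; apply: eq_bigr => T _.
by rewrite scalrfctE (schur_coef la_part srt perm_s lt_s).
Qed.
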